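(* Let $k\subset\overline{\mathbf F}_p$ be a perfect field containing the residue fields of all primes of $O_L$ over $p$, let $N\ge4$ be prime to $p$, and let $\psi\in X_k$. If $g\in\mathbf M(k,\mu_N,\psi)$, then $V(g)\in\mathbf M(k,\mu_N,\psi^{(p)})$.
   Context: $L$ is a totally real field of degree $g$ over $\mathbf Q$ with ring of integers $O_L$ and different $D_L$. $\mathfrak I$ is a fixed fractional ideal of $L$ with its cone $\mathfrak I^+$ of totally positive elements. $p$ is a prime. Modular forms. An $\mathfrak I$-polarized Hilbert–Blumenthal abelian scheme with $\mu_N$-level over $T$ is $\underline A=(A,\iota,\lambda,\varepsilon)$: $A/T$ an abelian scheme of relative dimension $[L:\mathbf Q]$; $\iota\colon O_L\hookrightarrow \mathrm{End}_T(A)$; $\lambda\colon (M_A,M_A^+)\cong(\mathfrak I,\mathfrak I^+)$ an $O_L$-isomorphism, $M_A$ being the module of symmetric $O_L$-linear homomorphisms $A\to A^\vee$ and $M_A^+$ the cone of polarizations; $\varepsilon\colon \mu_N\otimes_{\mathbf Z}D_L^{-1}\hookrightarrow A$ an injective $O_L$-homomorphism; such that $A\otimes_{O_L}M_A\to A^\vee$ is an isomorphism. $\mathcal G=\mathrm{Res}_{O_L/\mathbf Z}\mathbf G_m$, $X_k=\mathrm{Hom}(\mathcal G_k,\mathbf G_{m,k})$. $\mathbf M(k,\mu_N,\psi)$ is the space of rules $f$ assigning to every $k$-algebra $B$, every such $\underline A$ over $B$ and every generator $\omega$ of the $B\otimes O_L$-module $H^0(A,\Omega^1_{A/B})$ an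 element $f(\underline A,\omega)\in B$, depending only on the isomorphism class, compatible with base change along $k$-algebra homomorphisms, with $f(\underline A,\alpha^{-1}\omega)=\psi(\alpha)f(\underline A,\omega)$ for $\alpha\in(B\otimes O_L)^*$. The operator $V$. For $g\in\mathbf M(k,\mu_N,\psi)$, $V(g)$ is the rule $V(g)(\underline A,\omega)=g(\underline A^{(p)},\omega^{(p)})$, where the superscript $(p)$ denotes base change by the absolute Frobenius of the base $B$. For $\chi\in X_k$, $\chi^{(p)}=\chi\circ F_k$, where $F_k$ is the base change to $k$ of the absolute Frobenius morphism of $\mathcal G_{\mathbf F_p}$. *)

(* Defs.v *)
From HB Require Import structures.
From mathcomp Require Import all_boot all_order all_algebra all_field.
From mathcomp Require Import boolp.

Set Implicit Arguments.
Unset Strict Implicit.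
Unset Printing Implicit Defensive.

Import Order.TTheory GRing.Theory Num.Theory.
Local Open Scope ring_scope.

(* Conventions.  Schemes over a commutative ring B (possibly zero, hence
   comPzRingType) are given by their functors of points on commutative
   B-algebras; base change along B -> B' is then restriction of the functor to
   B'-algebras.  Structures are split into raw data (records without laws) and
   predicates on them, so that base change acts on raw data. *)

(** * The number field *)

Section NumberField.
Variable L : fieldExtType rat.

Definition integral_pred : {pred L} :=
  fun x => `[< integralOver (intr : int -> L) x >].

Fact integral_subring : subring_closed integral_pred.
Proof.
split=> [|x y|x y]; rewrite -!topredE /=; first exact/asboolP/integral1.
- by move=> /asboolP hx /asboolP hy; apply/asboolP/integral_sub.
- by move=> /asboolP hx /asboolP hy; apply/asboolP/integral_mul.
Qed.

HB.instance Definition _ :=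
  GRing.isSubringClosed.Build L integral_pred integral_subring.

Record ringOfIntegers := RingOfIntegers {
  integer_val :> L;
  integer_valP : integer_val \in integral_pred }.

HB.instance Definition _ := [isSub for integer_val].
HB.instance Definition _ := [Choice of ringOfIntegers by <:].
HB.instance Definition _ := [SubChoice_isSubComNzRing of ringOfIntegers by <:].

(* Embeddings of L in the complex numbers land in the algebraic numbers. *)
Definition totally_real : Prop :=
  forall (sigma : {rmorphism L -> algC}) (x : L), sigma x \is Num.real.

Definition totally_positive (x : L) : Prop :=
  forall sigma : {rmorphism L -> algC}, 0 < sigma x.

Definition fractional_ideal (I : L -> Prop) : Prop :=
  [/\ I 0 /\ (forall x y, I x -> I y -> I (x + y)),
      forall (a : ringOfIntegers) x, I x -> I (val a * x),
      exists2 x, I x & x != 0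
    & exists2 d : ringOfIntegers, d != 0 &
        forall x, I x -> exists b : ringOfIntegers, val d * x = val b].

Definition field_trace (x : L) : rat :=
  \sum_(i < \dim {:L}) coord (vbasis {:L}) i (x * (vbasis {:L})`_i).

(* The fractional ideal inverse to the different. *)
Definition inverse_different (d : L) : Prop :=
  forall a : ringOfIntegers, field_trace (d * val a) \is a Num.int.

(* A ring homomorphism to k with kernel P is an embedding of the residue
   field at P. *)
Definition contains_residue_fields (p : nat) (k : fieldType) : Prop :=
  forall P : {pred ringOfIntegers},
    idealr_closed P -> prime_idealr_closed P -> p%:R \in P ->
    exists r : {rmorphism ringOfIntegers -> k}, forall a, (a \in P) = (r a == 0).

End NumberField.

(* s stands for the sum of the u (x) v, (u, v) in s.  tensor_null says that it
   vanishes in the tensor product, over the ring acting through actU and actV,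
   of the modules carved out by PU and PV. *)
Definition tensor_null (H U : Type) (V : zmodType)
    (addU : U -> U -> U) (actU : H -> U -> U) (actV : H -> V -> V)
    (PU : U -> Prop) (PV : V -> Prop) (s : seq (U * V)) : Prop :=
  forall (G : zmodType) (beta : U -> V -> G),
    (forall u u' v, PU u -> PU u' -> PV v ->
       beta (addU u u') v = beta u v + beta u' v) ->
    (forall u v v', PU u -> PV v -> PV v' ->
       beta u (v + v') = beta u v + beta u v') ->
    (forall h u v, PU u -> PV v -> beta (actU h u) v = beta u (actV h v)) ->
    \sum_(x <- s) beta x.1 x.2 = 0.

(** * Algebras and functors on algebras *)

Definition is_unit (R : comPzRingType) (u : R) : Prop := exists v, u * v = 1.

Definition unit_ideal (R : comPzRingType) (I : R -> Prop) : Prop :=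
  exists (n : nat) (c x : 'I_n -> R),
    (forall i, I (x i)) /\ \sum_(i < n) c i * x i = 1.

(* f is a localization at the powers of r. *)
Definition is_localization (R S : comPzRingType) (r : R)
    (f : {rmorphism R -> S}) : Prop :=
  [/\ is_unit (f r),
      forall s, exists (a : R) (n : nat), s * f r ^+ n = f a
    & forall a, f a = 0 -> exists n : nat, r ^+ n * a = 0].

Record alg (B : comPzRingType) := Alg {
  alg_ring :> comPzRingType;
  str : {rmorphism B -> alg_ring} }.

Record ahom (B : comPzRingType) (R S : alg B) := AHom {
  ahom_fun :> {rmorphism R -> S};
  ahomE : forall b, ahom_fun (str R b) = str S b }.

Definition base (B : comPzRingType) : alg B := @Alg B B idfun.

Definition from_base (B : comPzRingType) (R : alg B) : ahom (base B) R :=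
  @AHom B (base B) R (str R) (fun b => erefl).

Definition res (B B' : comPzRingType) (phi : {rmorphism B -> B'}) (R : alg B') :
  alg B := @Alg B R (str R \o phi).

Definition ahom_res (B B' : comPzRingType) (phi : {rmorphism B -> B'})
    (R S : alg B') (f : ahom R S) : ahom (res phi R) (res phi S) :=
  @AHom B (res phi R) (res phi S) f (fun b => ahomE f (phi b)).

(* For a B-algebra R, the structure map of an R-algebra S is B-linear. *)
Definition from_alg (B : comPzRingType) (R : alg B) (S : alg R) :
    ahom R (res (str R) S) :=
  @AHom B R (res (str R) S) (str S) (fun b => erefl).

Record pre (B : comPzRingType) := Pre {
  pt :> alg B -> Type;
  pmap : forall R S : alg B, ahom R S -> pt R -> pt S }.
Arguments pmap {B} p {R S} f x.

Definition functorial (B : comPzRingType) (X : pre B) : Prop :=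
  (forall (R : alg B) (f : ahom R R) (x : X R),
     (forall r, f r = r) -> pmap X f x = x) /\
  (forall (R S T : alg B) (f : ahom R S) (g : ahom S T) (h : ahom R T) (x : X R),
     (forall r, h r = g (f r)) -> pmap X g (pmap X f x) = pmap X h x).

Definition pre_bc (B B' : comPzRingType) (phi : {rmorphism B -> B'}) (X : pre B) :
    pre B' :=
  @Pre B' (fun R => X (res phi R)) (fun R S f x => pmap X (ahom_res phi f) x).

(** * Schemes *)

Definition zariski_cover (B : comPzRingType) (R : alg B) (n : nat)
    (S : 'I_n -> alg B) (l : forall i, ahom R (S i)) : Prop :=
  exists r : 'I_n -> R,
    unit_ideal (fun x => exists i, x = r i) /\
    (forall i, is_localization (r i) (l i)).

Definition zariski_sheaf (B : comPzRingType) (X : pre B) : Prop :=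
  forall (R : alg B) (n : nat) (S : 'I_n -> alg B) (l : forall i, ahom R (S i))
    (x : forall i, X (S i)),
    zariski_cover l ->
    (forall i j (T : alg B) (g : ahom (S i) T) (g' : ahom (S j) T),
       (forall r, g (l i r) = g' (l j r)) ->
       pmap X g (x i) = pmap X g' (x j)) ->
    exists! z : X R, forall i, pmap X (l i) z = x i.

Definition sub (B : comPzRingType) (X : pre B) := forall R : alg B, X R -> Prop.

Definition is_open (B : comPzRingType) (X : pre B) (U : sub X) : Prop :=
  forall (R : alg B) (x : X R), exists I : R -> Prop,
  forall (S : alg B) (f : ahom R S),
    U S (pmap X f x) <-> unit_ideal (fun s => exists2 r, I r & s = f r).

(* Open subfunctors cover if and only if they do on points in fields. *)
Definition covers (B : comPzRingType) (X : pre B) (J : Type) (U : J -> sub X) :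
    Prop :=
  forall (K : fieldType) (j : {rmorphism B -> K}) (x : X (Alg j)),
    exists i, U i _ x.

Definition is_affine (B : comPzRingType) (X : pre B) (U : sub X) : Prop :=
  exists (R0 : alg B) (x0 : X R0), U R0 x0 /\
  forall (S : alg B) (x : X S), U S x ->
    exists f : ahom R0 S, pmap X f x0 = x /\
      forall f' : ahom R0 S, pmap X f' x0 = x -> forall r, f' r = f r.

Inductive pexpr (B : Type) (n : nat) : Type :=
  | PVar of 'I_n
  | PCst of B
  | PAdd of pexpr B n & pexpr B n
  | PMul of pexpr B n & pexpr B n.
Arguments PVar {B n} i.
Arguments PCst {B n} b.

Fixpoint peval (B : comPzRingType) (n : nat) (R : alg B) (v : 'I_n -> R)
    (e : pexpr B n) : R :=
  match e with
  | PVar i => v i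
  | PCst b => str R b
  | PAdd e1 e2 => peval v e1 + peval v e2
  | PMul e1 e2 => peval v e1 * peval v e2
  end.

Fixpoint pderiv (B : comPzRingType) (n : nat) (j : 'I_n) (e : pexpr B n) :
    pexpr B n :=
  match e with
  | PVar i => PCst (i == j)%:R
  | PCst _ => PCst 0
  | PAdd e1 e2 => PAdd (pderiv j e1) (pderiv j e2)
  | PMul e1 e2 => PAdd (PMul (pderiv j e1) e2) (PMul e1 (pderiv j e2))
  end.

(* U is open in X and isomorphic, through the coordinates y, to the spectrum of
   a standard smooth algebra of relative dimension d: a quotient
   B[x_1 .. x_(c+d)]/(e_1 .. e_c) in which the Jacobian of the e_i with respect
   to x_1 .. x_c is invertible. *)
Definition std_smooth_open (B : comPzRingType) (d : nat) (X : pre B) (U : sub X) :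
    Prop :=
  is_open U /\
  exists (c : nat) (e : 'I_c -> pexpr B (c + d))
    (y : forall R : alg B, X R -> 'I_(c + d) -> R),
    let solves R (v : 'I_(c + d) -> (R : alg B)) :=
      forall i, peval v (e i) = 0 in
    [/\ forall (R S : alg B) (f : ahom R S) (x : X R), U R x ->
          forall i, y S (pmap X f x) i = f (y R x i),
        forall (R : alg B) (v : 'I_(c + d) -> R),
          solves R v <-> exists2 x, U R x & forall i, y R x i = v i,
        forall (R : alg B) (x x' : X R), U R x -> U R x' ->
          (forall i, y R x i = y R x' i) -> x = x'
      & forall (R : alg B) (v : 'I_(c + d) -> R), solves R v ->
          exists N : 'M[R]_c,
            (\matrix_(i < c, j < c) peval v (pderiv (lshift d j) (e i))) *m N
              = 1%:M].

(* A quasi-compact scheme, smooth of relative dimension d over B. *)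
Definition smooth_qc_scheme (B : comPzRingType) (d : nat) (X : pre B) : Prop :=
  [/\ functorial X, zariski_sheaf X
    & exists (m : nat) (U : 'I_m -> sub X),
        (forall i, std_smooth_open d (U i)) /\ covers U].

(* The diagonal is a closed immersion. *)
Definition is_separated (B : comPzRingType) (X : pre B) : Prop :=
  forall (R : alg B) (x x' : X R), exists I : R -> Prop,
  forall (S : alg B) (f : ahom R S),
    pmap X f x = pmap X f x' <-> (forall r, I r -> f r = 0).

(* The image in Spec B of the complement of an open subfunctor is closed; a
   point of Spec B is given by a homomorphism to a field. *)
Definition is_closed_map (B : comPzRingType) (X : pre B) : Prop :=
  forall U : sub X, is_open U ->
  exists I : B -> Prop,
  forall (K : fieldType) (j : {rmorphism B -> K}),
    (exists (K' : fieldType) (e : {rmorphism K -> K'})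
       (x : X (@Alg B K' (e \o j))), ~ U _ x) <->
    (forall b, I b -> j b = 0).

Definition universally_closed (B : comPzRingType) (X : pre B) : Prop :=
  forall (B' : comPzRingType) (phi : {rmorphism B -> B'}),
    is_closed_map (pre_bc phi X).

(* Properness, for X of finite type. *)
Definition is_proper_qc (B : comPzRingType) (X : pre B) : Prop :=
  is_separated X /\ universally_closed X.

Definition is_empty (B : comPzRingType) (X : pre B) (U : sub X) : Prop :=
  forall (K : fieldType) (j : {rmorphism B -> K}) (x : X (Alg j)), ~ U _ x.

Definition is_connected (B : comPzRingType) (X : pre B) : Prop :=
  ~ is_empty (fun R (_ : X R) => True) /\
  forall U : bool -> sub X,
    is_open (U true) -> is_open (U false) -> covers U ->
    is_empty (fun R x => U true R x /\ U false R x) ->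
    is_empty (U true) \/ is_empty (U false).

Definition geometrically_connected_fibres (B : comPzRingType) (X : pre B) :
    Prop :=
  forall (K : closedFieldType) (phi : {rmorphism B -> K}),
    is_connected (pre_bc phi X).

(** * Line bundles *)

(* A line bundle on X is given by the G_m-torsor of its nowhere vanishing
   sections (frames): fr P R is the set of pairs of a point x of X in R and a
   frame of the pullback of the bundle by x, and scl multiplies frames by
   units (its values at non-units are irrelevant). *)
Record lbundle (B : comPzRingType) (X : pre B) := LBundle {
  fr : pre B;
  prj : forall R : alg B, fr R -> X R;
  scl : forall R : alg B, R -> fr R -> fr R }.
Arguments fr {B X}.
Arguments prj {B X} l {R}.
Arguments scl {B X} l {R}.

Record is_lbundle (B : comPzRingType) (X : pre B) (P : lbundle X) : Prop := {
  fr_functorial : functorial (fr P);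
  fr_sheaf : zariski_sheaf (fr P);
  prj_nat : forall (R S : alg B) (f : ahom R S) (p : fr P R),
    prj P (pmap (fr P) f p) = pmap X f (prj P p);
  scl_nat : forall (R S : alg B) (f : ahom R S) (u : R) (p : fr P R),
    is_unit u -> pmap (fr P) f (scl P u p) = scl P (f u) (pmap (fr P) f p);
  scl_one : forall (R : alg B) (p : fr P R), scl P 1 p = p;
  scl_mul : forall (R : alg B) (u v : R) (p : fr P R),
    is_unit u -> is_unit v -> scl P (u * v) p = scl P u (scl P v p);
  scl_prj : forall (R : alg B) (u : R) (p : fr P R),
    is_unit u -> prj P (scl P u p) = prj P p;
  scl_simply_transitive : forall (R : alg B) (p q : fr P R),
    prj P p = prj P q -> exists! u : R, is_unit u /\ q = scl P u p;
  fr_local : forall (R : alg B) (x : X R),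
    exists (n : nat) (S : 'I_n -> alg B) (l : forall i, ahom R (S i)),
      zariski_cover l /\
      (forall i, exists p : fr P (S i), prj P p = pmap X (l i) x) }.

Definition lb_bc (B B' : comPzRingType) (phi : {rmorphism B -> B'}) (X : pre B)
    (P : lbundle X) : lbundle (pre_bc phi X) :=
  @LBundle B' (pre_bc phi X) (pre_bc phi (fr P))
    (fun R p => @prj B X P (res phi R) p)
    (fun R u p => @scl B X P (res phi R) u p).

(* The pullback of P by h : Y -> X is trivial. *)
Definition lb_trivial (B : comPzRingType) (Y X : pre B)
    (h : forall R : alg B, Y R -> X R) (P : lbundle X) : Prop :=
  exists s : forall R : alg B, Y R -> fr P R,
    (forall (R : alg B) (y : Y R), prj P (s R y) = h R y) /\
    (forall (R S : alg B) (f : ahom R S) (y : Y R),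
       s S (pmap Y f y) = pmap (fr P) f (s R y)).

(* h0^* P0 is isomorphic to h1^* P1. *)
Definition lb_iso (B : comPzRingType) (Y X0 X1 : pre B)
    (h0 : forall R : alg B, Y R -> X0 R) (P0 : lbundle X0)
    (h1 : forall R : alg B, Y R -> X1 R) (P1 : lbundle X1) : Prop :=
  exists t : forall (R : alg B) (y : Y R) (p : fr P1 R), prj P1 p = h1 R y -> fr P0 R,
    [/\ forall (R : alg B) y p e, prj P0 (t R y p e) = h0 R y,
        forall (R : alg B) y p e (u : R) e', is_unit u ->
          t R y (scl P1 u p) e' = scl P0 u (t R y p e)
      & forall (R S : alg B) (f : ahom R S) y p e e',
          t S (pmap Y f y) (pmap (fr P1) f p) e'
            = pmap (fr P0) f (t R y p e)].

(* h0^* P0 is isomorphic to the tensor product of h1^* P1 and h2^* P2. *)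
Definition lb_tensor (B : comPzRingType) (Y X0 X1 X2 : pre B)
    (h0 : forall R : alg B, Y R -> X0 R) (P0 : lbundle X0)
    (h1 : forall R : alg B, Y R -> X1 R) (P1 : lbundle X1)
    (h2 : forall R : alg B, Y R -> X2 R) (P2 : lbundle X2) : Prop :=
  exists t : forall (R : alg B) (y : Y R) (p1 : fr P1 R) (p2 : fr P2 R),
      prj P1 p1 = h1 R y -> prj P2 p2 = h2 R y -> fr P0 R,
    [/\ forall (R : alg B) y p1 p2 e1 e2, prj P0 (t R y p1 p2 e1 e2) = h0 R y,
        forall (R : alg B) y p1 p2 e1 e2 (u1 u2 : R) e1' e2', is_unit u1 -> is_unit u2 ->
          t R y (scl P1 u1 p1) (scl P2 u2 p2) e1' e2'
            = scl P0 (u1 * u2) (t R y p1 p2 e1 e2)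
      & forall (R S : alg B) (f : ahom R S) y p1 p2 e1 e2 e1' e2',
          t S (pmap Y f y) (pmap (fr P1) f p1) (pmap (fr P2) f p2) e1' e2'
            = pmap (fr P0) f (t R y p1 p2 e1 e2)].

(* A section sigma of the m-th tensor power of P is given by its coordinates
   s p, where sigma = s p * p^m for a frame p. *)
Definition lb_section (B : comPzRingType) (X : pre B) (P : lbundle X) (m : nat)
    (s : forall R : alg B, fr P R -> R) : Prop :=
  (forall (R : alg B) (u : R) (p : fr P R), is_unit u ->
     s R (scl P u p) * u ^+ m = s R p) /\
  (forall (R S : alg B) (f : ahom R S) (p : fr P R),
     s S (pmap (fr P) f p) = f (s R p)).

Definition nonvanishing (B : comPzRingType) (X : pre B) (P : lbundle X)
    (s : forall R : alg B, fr P R -> R) : sub X :=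
  fun R x => forall (S : alg B) (f : ahom R S) (p : fr P S),
    prj P p = pmap X f x -> is_unit (s S p).

(* Ampleness, on a quasi-compact X: every point has an affine neighbourhood
   which is the non-vanishing locus of a section of a positive power. *)
Definition ample (B : comPzRingType) (X : pre B) (P : lbundle X) : Prop :=
  forall (K : fieldType) (j : {rmorphism B -> K}) (x : X (Alg j)),
    exists (m : nat) (s : forall R : alg B, fr P R -> R),
      [/\ (0 < m)%N, lb_section m s, is_affine (nonvanishing s)
        & nonvanishing s x].

(** * Abelian schemes *)

(* Group functors are taken commutative; abelian schemes always are. *)
Record gpre (B : comPzRingType) := GPre {
  gpt : alg B -> zmodType;
  gmap : forall R S : alg B, ahom R S -> gpt R -> gpt S }.
Arguments gmap {B} g {R S} f x.

Definition pre_of (B : comPzRingType) (A : gpre B) : pre B :=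
  @Pre B (fun R => gpt A R) (fun R S f => @gmap B A R S f).
Coercion pre_of : gpre >-> pre.

Definition gpre_bc (B B' : comPzRingType) (phi : {rmorphism B -> B'})
    (A : gpre B) : gpre B' :=
  @GPre B' (fun R => gpt A (res phi R)) (fun R S f x => gmap A (ahom_res phi f) x).

Definition abelian_scheme (B : comPzRingType) (d : nat) (A : gpre B) : Prop :=
  [/\ forall (R S : alg B) (f : ahom R S) (a b : gpt A R),
        gmap A f (a + b) = gmap A f a + gmap A f b,
      smooth_qc_scheme d A, is_proper_qc A
    & geometrically_connected_fibres A].

Definition sq (B : comPzRingType) (A : gpre B) : pre B :=
  @Pre B (fun R => (gpt A R * gpt A R)%type)
    (fun R S f x => (gmap A f x.1, gmap A f x.2)).

Definition cube (B : comPzRingType) (A : gpre B) : pre B :=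
  @Pre B (fun R => (gpt A R * gpt A R * gpt A R)%type)
    (fun R S f x => (gmap A f x.1.1, gmap A f x.1.2, gmap A f x.2)).

Definition pid (B : comPzRingType) (X : pre B) (R : alg B) (x : X R) : X R := x.
Arguments pid {B X} R x.

(* For A over a field: the bundle h^* P on A is isomorphic to all its
   translates. *)
Definition pic0_along (B : comPzRingType) (A : gpre B) (X : pre B)
    (h : forall R, A R -> X R) (P : lbundle X) : Prop :=
  forall x : gpt A (base B),
    @lb_iso B A X X
      (fun R (a : gpt A R) => h R (a + gmap A (from_base R) x)) P h P.

(* The dual abelian scheme: its points in the base are the isomorphism classes
   of the line bundles Q on A that are trivial along the zero section and belong
   to Pic^0 on every geometric fibre.  (For bundles trivial along the zero
   section, being isomorphic and being isomorphic as rigidified bundles are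
   equivalent.)  The group law is the tensor product; points with values in a
   B-algebra R are points in the base of gpre_bc (str R) A. *)
Definition dual_point (B : comPzRingType) (A : gpre B) (Q : lbundle A) : Prop :=
  [/\ is_lbundle Q,
      exists q : fr Q (base B), prj Q q = (0 : gpt A (base B))
    & forall (K : closedFieldType) (phi : {rmorphism B -> K}),
        @pic0_along K (gpre_bc phi A) (gpre_bc phi A) pid (lb_bc phi Q)].

(* Homomorphisms from A to its dual, as A-valued points of the dual: line
   bundles P on A x A, where the image of a point b of the second factor is
   the restriction of P to A x {b}. *)
Definition dual_hom (B : comPzRingType) (A : gpre B) (P : lbundle (sq A)) : Prop :=
  [/\ is_lbundle P,
      @lb_trivial B A (sq A) (fun R b => (0, b)) P,
      forall (K : closedFieldType) (phi : {rmorphism B -> K})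
        (b : gpt (gpre_bc phi A) (base K)),
        @pic0_along K (gpre_bc phi A) (sq (gpre_bc phi A))
          (fun R a => (a, gmap (gpre_bc phi A) (from_base R) b)) (lb_bc phi P)
    & @lb_tensor B (cube A) (sq A) (sq A) (sq A)
        (fun R x => (x.1.1, x.1.2 + x.2)) P
        (fun R x => (x.1.1, x.1.2)) P (fun R x => (x.1.1, x.2)) P].

(* Symmetry: the dual of the homomorphism given by P, composed with the
   biduality A -> A^vv, is given by the pullback of P by the swap. *)
Definition dual_symmetric (B : comPzRingType) (A : gpre B) (P : lbundle (sq A)) :
    Prop :=
  @lb_iso B (sq A) (sq A) (sq A) (fun R x => (x.2, x.1)) P pid P.

(* On geometric fibres the homomorphism is phi_M, a |-> t_a^* M (x) M^-1, for
   an ample M; it is given by m^* M (x) p_1^* M^-1 (x) p_2^* M^-1 on A x A. *)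
Definition polarization (B : comPzRingType) (A : gpre B) (P : lbundle (sq A)) :
    Prop :=
  forall (K : closedFieldType) (phi : {rmorphism B -> K}),
  let AK := gpre_bc phi A in
  exists M : lbundle AK, [/\ is_lbundle M, ample M &
    exists N : lbundle (sq AK), [/\ is_lbundle N,
      @lb_tensor K (sq AK) (sq AK) AK AK
        pid N (fun R x => x.1) M (fun R x => x.2) M &
      @lb_tensor K (sq AK) AK (sq AK) (sq AK)
        (fun R x => x.1 + x.2) M pid (lb_bc phi P) pid N]].

(** * Hilbert-Blumenthal abelian schemes *)

Section HilbertBlumenthal.
Variable L : fieldExtType rat.
Local Notation OL := (ringOfIntegers L).

(* lam i is the line bundle on A x A of the homomorphism from A to its dual
   attached to i in the fractional ideal; eps R z d is the image in A(R) of
   z (x) d.  Only z with z^N = 1, d in the inverse different and i in the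
   fractional ideal matter. *)
Record hb_data (B : comPzRingType) := HBData {
  hbA : gpre B;
  hb_iota : OL -> forall R : alg B, gpt hbA R -> gpt hbA R;
  hb_lam : L -> lbundle (sq hbA);
  hb_eps : forall R : alg B, R -> L -> gpt hbA R }.
Arguments hb_iota {B} D x {R} a : rename.
Arguments hb_lam {B} D i : rename.
Arguments hb_eps {B} D {R} z d : rename.

Definition hb_bc (B B' : comPzRingType) (phi : {rmorphism B -> B'})
    (D : hb_data B) : hb_data B' :=
  @HBData B' (gpre_bc phi (hbA D))
    (fun x R => @hb_iota B D x (res phi R))
    (fun i => lb_bc phi (hb_lam D i))
    (fun R => @hb_eps B D (res phi R)).

Definition is_real_multiplication (B : comPzRingType) (D : hb_data B) : Prop :=
  let A := hbA D in let iota := @hb_iota B D in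
  [/\ forall x (R S : alg B) (f : ahom R S) a,
        iota x S (gmap A f a) = gmap A f (iota x R a),
      forall x (R : alg B) a b, iota x R (a + b) = iota x R a + iota x R b,
      forall x y (R : alg B) a, iota (x + y) R a = iota x R a + iota y R a,
      (forall (R : alg B) a, iota 1 R a = a) /\
      (forall x y (R : alg B) a, iota (x * y) R a = iota x R (iota y R a))
    & forall x, (forall (R : alg B) a, iota x R a = 0) -> x = 0].

(* The sections over the base of the sheaf M_A. *)
Definition symmetric_hom (B : comPzRingType) (D : hb_data B)
    (P : lbundle (sq (hbA D))) : Prop :=
  [/\ dual_hom P, dual_symmetric P
    & forall x : OL, @lb_iso B (sq (hbA D)) (sq (hbA D)) (sq (hbA D))
        (fun R y => (y.1, hb_iota D x y.2)) P
        (fun R y => (hb_iota D x y.1, y.2)) P].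

(* The map i |-> lam i from the ideal I to M_A is O_L-linear. *)
Definition lam_linear (I : L -> Prop) (B : comPzRingType) (D : hb_data B) : Prop :=
  let A2 := sq (hbA D) in
  [/\ forall i, I i -> symmetric_hom (hb_lam D i),
      forall i j, I i -> I j ->
        @lb_tensor B A2 A2 A2 A2
          pid (hb_lam D (i + j)) pid (hb_lam D i) pid (hb_lam D j)
    & forall (x : OL) i, I i ->
        @lb_iso B A2 A2 A2
          pid (hb_lam D (val x * i))
          (fun R y => (y.1, hb_iota D x y.2)) (hb_lam D i)].

(* On the sections over Spec B, lam is an isomorphism from the constant sheaf I
   (whose sections are the locally constant functions to I) to the sheaf M_A,
   and it identifies polarizations with totally positive elements. *)
Definition lam_iso (I : L -> Prop) (B : comPzRingType) (D : hb_data B) : Prop :=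
  let A2 := sq (hbA D) in
  [/\ (1 : B) <> 0 -> forall i, I i ->
        @lb_trivial B A2 A2 pid (hb_lam D i) -> i = 0,
      forall P : lbundle A2, symmetric_hom P ->
        exists (n : nat) (S : 'I_n -> alg B) (i : 'I_n -> L),
        [/\ zariski_cover (fun j => from_base (S j)), forall j, I (i j)
          & forall j,
            let A2j := sq (gpre_bc (str (S j)) (hbA D)) in
            @lb_iso (S j) A2j A2j A2j
              pid (lb_bc (str (S j)) P)
              pid (lb_bc (str (S j)) (hb_lam D (i j)))]
    & (1 : B) <> 0 -> forall i, I i ->
        (polarization (hb_lam D i) <-> totally_positive i)].

(* For a dual_point Q: the point Q of the dual is the sum of the lam i (a), (a, i) in s, where
   lam i (a) is the restriction of lam i to A x {a}. *)
Fixpoint dual_sum (B : comPzRingType) (D : hb_data B)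
    (s : seq (gpt (hbA D) (base B) * L)) (Q : lbundle (hbA D)) : Prop :=
  match s with
  | [::] => @lb_trivial B (hbA D) (hbA D) pid Q
  | ai :: s' => exists Q' : lbundle (hbA D),
      [/\ dual_point Q', dual_sum s' Q'
        & @lb_tensor B (hbA D) (hbA D) (sq (hbA D)) (hbA D)
            pid Q
            (fun R b => (b, gmap (hbA D) (from_base R) ai.1)) (hb_lam D ai.2)
            pid Q']
  end.

(* The map from the tensor product of A and I over O_L to the dual of A is
   bijective on the points in the base.  The ideal I being projective,
   R |-> A(R) (x) I is the sheaf tensor product. *)
Definition dual_iso (I : L -> Prop) (B : comPzRingType) (D : hb_data B) : Prop :=
  let Apt := gpt (hbA D) (base B) in
  (forall Q : lbundle (hbA D), dual_point Q ->
     exists s : seq (Apt * L),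
       (forall ai, ai \in s -> I ai.2) /\ dual_sum s Q) /\
  (forall (s : seq (Apt * L)) (Q : lbundle (hbA D)),
     (forall ai, ai \in s -> I ai.2) -> dual_point Q ->
     dual_sum s Q -> @lb_trivial B (hbA D) (hbA D) pid Q ->
     tensor_null +%R (fun (x : OL) a => hb_iota D x a) (fun x i => val x * i)
       (fun=> True) I s).

Definition in_mu (N : nat) (R : comPzRingType) (z : R) : Prop := z ^+ N = 1.

(* The inverse different is free over Z, so that R |-> mu_N(R) (x) D_L^-1 is
   the functor of points of the tensor product; void stands for the absence of
   scalars other than the integers. *)
Definition is_level (N : nat) (B : comPzRingType) (D : hb_data B) : Prop :=
  let A := hbA D in let eps := @hb_eps B D in
  let Dinv := @inverse_different L in
  [/\ forall (R S : alg B) (f : ahom R S) z d, in_mu N z -> Dinv d ->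
        eps S (f z) d = gmap A f (eps R z d),
      forall (R : alg B) z z' d, in_mu N z -> in_mu N z' -> Dinv d ->
        eps R (z * z') d = eps R z d + eps R z' d,
      forall (R : alg B) z d d', in_mu N z -> Dinv d -> Dinv d' ->
        eps R z (d + d') = eps R z d + eps R z d',
      forall (R : alg B) z (x : OL) d, in_mu N z -> Dinv d ->
        eps R z (val x * d) = hb_iota D x (eps R z d)
    & forall (R : alg B) (s : seq (R * L)),
        (forall zd, zd \in s -> in_mu N zd.1 /\ Dinv zd.2) ->
        \sum_(zd <- s) eps R zd.1 zd.2 = 0 ->
        tensor_null (H := void) *%R (fun _ z => z) (fun _ d => d)
          (@in_mu N R) Dinv s].

(* M_A is a sheaf on all B-algebras, so that the conditions on lam hold after
   every base change. *)
Definition is_hb (N : nat) (I : L -> Prop) (B : comPzRingType) (D : hb_data B) :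
    Prop :=
  [/\ abelian_scheme (\dim {:L}) (hbA D),
      is_real_multiplication D,
      lam_linear I D,
      forall (B' : comPzRingType) (phi : {rmorphism B -> B'}),
        lam_iso I (hb_bc phi D) /\ dual_iso I (hb_bc phi D)
    & is_level N D].

(** * Differentials *)

Definition is_derivation (B : comPzRingType) (R : alg B) (M : lmodType R)
    (d : R -> M) : Prop :=
  [/\ forall r s, d (r + s) = d r + d s,
      forall r s, d (r * s) = r *: d s + s *: d r
    & forall b, d (str R b) = 0].

(* s stands for the Kaehler differential sum of r dt, (r, t) in s; two such
   sums are equal in Omega_(R/B) if and only if all derivations say so. *)
Definition omega_eq (B : comPzRingType) (R : alg B) (s t : seq (R * R)) : Prop :=
  forall (M : lmodType R) (d : R -> M), is_derivation d ->
    \sum_(x <- s) x.1 *: d x.2 = \sum_(x <- t) x.1 *: d x.2.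

(* A global section of Omega^1_(A/B) is the compatible family of its pullbacks
   in Omega_(R/B) by the points Spec R -> A. *)
Definition form (B : comPzRingType) (A : gpre B) :=
  forall R : alg B, gpt A R -> seq (R * R).

Definition is_form (B : comPzRingType) (A : gpre B) (w : form A) : Prop :=
  forall (R S : alg B) (f : ahom R S) (a : gpt A R),
    omega_eq (w S (gmap A f a)) [seq (f x.1, f x.2) | x <- w R a].

Definition form_bc (B B' : comPzRingType) (phi : {rmorphism B -> B'})
    (A : gpre B) (w : form A) : form (gpre_bc phi A) :=
  fun R a => w (res phi R) a.
Arguments form_bc {B B'} phi {A} w R a.

(** * The tensor product R (x) O_L and characters *)

Definition tens (R : comPzRingType) := seq (R * OL).

Definition tens_eq (R : comPzRingType) (s t : tens R) : Prop :=
  tensor_null (H := void) +%R (fun _ r => r) (fun _ x => x)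
    (fun=> True) (fun=> True) (s ++ [seq (- y.1, y.2) | y <- t]).

Definition tens_one (R : comPzRingType) : tens R := [:: (1, 1)].

Definition tens_mul (R : comPzRingType) (s t : tens R) : tens R :=
  [seq (x.1 * y.1, x.2 * y.2) | x <- s, y <- t].

Definition tens_map (R S : comPzRingType) (f : R -> S) (s : tens R) : tens S :=
  [seq (f x.1, x.2) | x <- s].

Definition tens_inverse (R : comPzRingType) (s t : tens R) : Prop :=
  tens_eq (tens_mul s t) (tens_one R).

Definition tens_unit (R : comPzRingType) (s : tens R) : Prop :=
  exists t, tens_inverse s t.

(* Homomorphisms from Res_(O_L/Z) G_m to G_m over k, as natural homomorphisms
   (R (x) O_L)^* -> R^*; the values outside the units are irrelevant. *)
Definition char_data (k : comPzRingType) := forall R : alg k, tens R -> R.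

Definition is_char (k : comPzRingType) (psi : char_data k) : Prop :=
  [/\ forall (R : alg k) (s t : tens R),
        tens_unit s -> tens_eq s t -> psi R s = psi R t,
      forall (R : alg k) (s : tens R), tens_unit s -> is_unit (psi R s),
      forall (R : alg k) (s t : tens R), tens_unit s -> tens_unit t ->
        psi R (tens_mul s t) = psi R s * psi R t
    & forall (R S : alg k) (f : ahom R S) (s : tens R), tens_unit s ->
        psi S (tens_map f s) = f (psi R s)].

(* The action of B (x) O_L on H^0(A, Omega^1_(A/B)); x in O_L acts by pullback
   along iota x. *)
Definition tens_act (B : comPzRingType) (D : hb_data B) (s : tens B)
    (w : form (hbA D)) : form (hbA D) :=
  fun R a => flatten
    [seq [seq (str R bx.1 * u.1, u.2) | u <- w R (hb_iota D bx.2 a)] | bx <- s].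
Arguments tens_act {B D} s w R a.

Definition is_generator (B : comPzRingType) (D : hb_data B)
    (w : form (hbA D)) : Prop :=
  is_form w /\
  forall eta : form (hbA D), is_form eta ->
    exists s : tens B, forall (R : alg B) a,
      omega_eq (eta R a) (tens_act s w R a).

(** * Modular forms *)

(* An isomorphism h from (D, w) to (D', w'). *)
Definition hb_iso (I : L -> Prop) (N : nat) (B : comPzRingType)
    (D D' : hb_data B) (w : form (hbA D)) (w' : form (hbA D'))
    (h : forall R : alg B, gpt (hbA D) R -> gpt (hbA D') R) : Prop :=
  [/\ (forall (R S : alg B) (f : ahom R S) a,
         h S (gmap (hbA D) f a) = gmap (hbA D') f (h R a)) /\
      (forall R : alg B, bijective (h R)),
      (forall (R : alg B) a b, h R (a + b) = h R a + h R b) /\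
      (forall (x : OL) (R : alg B) a,
         h R (hb_iota D x a) = hb_iota D' x (h R a)),
      forall i, I i ->
        @lb_iso B (sq (hbA D)) (sq (hbA D')) (sq (hbA D))
          (fun R y => (h R y.1, h R y.2)) (hb_lam D' i) pid (hb_lam D i),
      forall (R : alg B) z d, in_mu N z -> inverse_different d ->
        h R (hb_eps D z d) = hb_eps D' z d
    & forall (R : alg B) a, omega_eq (w' R (h R a)) (w R a)].

(* A rule is a function on raw data, of which only the values at the (A, w)
   satisfying test_object matter. *)
Definition rule (k : comPzRingType) :=
  forall (B : alg k) (D : hb_data B), form (hbA D) -> B.

Definition test_object (N : nat) (I : L -> Prop) (B : comPzRingType)
    (D : hb_data B) (w : form (hbA D)) : Prop :=
  is_hb N I D /\ is_generator w.

(* The space M(k, mu_N, psi) of I-polarized modular forms. *)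
Definition modular_form (N : nat) (I : L -> Prop) (k : comPzRingType)
    (psi : char_data k) (g : rule k) : Prop :=
  [/\ forall (B : alg k) (D D' : hb_data B) w w' h,
        test_object N I w -> test_object N I w' ->
        @hb_iso I N B D D' w w' h -> g B D w = g B D' w',
      forall (B B' : alg k) (f : ahom B B') (D : hb_data B) w,
        test_object N I w ->
        g B' (hb_bc f D) (form_bc f w) = f (g B D w)
    & forall (B : alg k) (D : hb_data B) w (s t : tens B),
        test_object N I w -> tens_inverse s t ->
        g B D (tens_act t w) = psi B s * g B D w].

(** * Frobenius *)

Section Frobenius.
Variables (k : fieldType) (p : nat) (kp : p \in [pchar k]) (R : alg k).

Definition frob_fun & p \in [pchar k] := fun r : R => r ^+ p.

Fact frob_is_nmod_morphism : nmod_morphism (frob_fun kp).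
Proof.
have p_pr : prime p := pcharf_prime kp.
have p0 : p%:R = 0 :> R.
  by have /(congr1 (str R)) := pcharf0 kp; rewrite rmorph_nat rmorph0.
rewrite /frob_fun; split=> [|x y]; first by rewrite expr0n gtn_eqF ?prime_gt0.
rewrite -[X in (x + y) ^+ X](prednK (prime_gt0 p_pr)).
rewrite exprDn big_ord_recr big_ord_recl /= prednK ?prime_gt0 //.
rewrite subn0 subnn !expr0 mulr1 mul1r bin0 binn !mulr1n.
rewrite big1 ?addr0 // => i _; rewrite /bump add1n.
have /dvdnP[q ->] : (p %| 'C(p, i.+1))%N.
  by apply: prime_dvd_bin => //=; rewrite -ltn_predRL ltn_ord.
by rewrite -mulr_natr natrM p0 mulr0 mulr0.
Qed.

Fact frob_is_monoid_morphism : monoid_morphism (frob_fun kp).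
Proof.
by rewrite /frob_fun; split=> [|x y]; rewrite ?expr1n ?exprMn.
Qed.

HB.instance Definition _ :=
  GRing.isNmodMorphism.Build R R (frob_fun kp) frob_is_nmod_morphism.
HB.instance Definition _ :=
  GRing.isMonoidMorphism.Build R R (frob_fun kp) frob_is_monoid_morphism.

(* The absolute Frobenius of R; it is not k-linear. *)
Definition frob : {rmorphism R -> R} := frob_fun kp.

End Frobenius.

(* The base change along frob is again taken over B with its given structure of
   k-algebra. *)
Definition V_op (k : fieldType) (p : nat) (kp : p \in [pchar k]) (g : rule k) :
    rule k :=
  fun B D w => g B (hb_bc (frob kp B) D) (form_bc (frob kp B) w).

(* On points in a k-algebra R, the base change to k of the absolute Frobenius
   of Res_(O_L/Z) G_m is induced by the absolute Frobenius of R. *)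
Definition char_frob (k : fieldType) (p : nat) (kp : p \in [pchar k])
    (psi : char_data k) : char_data k :=
  fun R s => psi R (tens_map (frob kp R) s).

End HilbertBlumenthal.

(* Main.v *)
(* The main point is that if w generates the differentials of A, then w^(p) generates
   those of A^(p).

   A function f on a proper smooth scheme X with geometrically connected fibres over
   a ring in characteristic p is constant.  Over an algebraically closed field, the
   image in the affine line of the hyperbola t g = 1 over X is closed and misses 0;
   hence g takes finitely many values, and by connectedness only one.  A function
   that vanishes at all points over fields vanishes after a power of the relative
   Frobenius, and the latter is an epimorphism by smoothness.  In general let f vanish
   on a section.  If f <> 0, the coefficients of the equations of X generate a
   Noetherian ring S, and the annihilator in S of some multiple of f is a prime Z; up
   to a factor outside Z, write f = sum q_s u_s, with q_s annihilated by Z, u_s over S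
   and as few terms as possible.  By flatness of smooth algebras a linear map
   q_s |-> b_s to an algebraically closed field yields a function sum b_s u_s on a
   fibre, which vanishes; this relation between the u_s shortens the sum.

   Consequently a form eta on A is invariant: it is determined by the function
   v |-> eta(v) on the functor T of tangent vectors of A at 0.  Conversely, a function
   on T gives a form, through its values at the tangent vectors that the universal
   derivations of the rings R attach to the points of A in R.  Now T is representable
   over a basic open cover of Spec B.  Therefore every function on the base change of
   T along phi : B -> E is a finite sum of multiples e_s l_s, with e_s in E and l_s a
   function on T over B: on the members of the cover this is clear, and a power of
   the elements that define them clears the denominators of the l_s.  The forms over
   B given by the l_s are multiples of w, so that the forms over E are multiples of
   the base change of w. *)
Require Import Defs.
From HB Require Import structures.
From mathcomp Require Import all_boot all_order all_algebra all_field.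
From mathcomp Require Import boolp.
From mathcomp Require classical_sets.
From mathcomp Require Import ring zify.
Import Defs.

Set Implicit Arguments.
Unset Strict Implicit.
Unset Printing Implicit Defensive.

Import Order.TTheory GRing.Theory Num.Theory.
Local Open Scope ring_scope.

(** A form on the base change of A need not come from a form on A. The usual remedy, cohomology and
    base change for the direct image of the differentials, is out of reach of the definitions here:
    B is an arbitrary k-algebra, possibly neither Noetherian nor reduced, and its Frobenius need not
    be flat. Only the constancy of functions on proper connected schemes is used in its place. It is
    needed over nilpotent thickenings of the base, such as square-zero extensions R + M, so that a
    check on fibres is not enough; flatness must carry the vanishing on fibres back to a ring with
    nilpotents.

    Of the remaining conditions on the twisted abelian scheme, one is not inherited formally: the
    action of O_L must stay faithful, although Frobenius may kill elements of B. It is recovered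
    from the isomorphism of the ideal with the module of symmetric homomorphisms, which is assumed
    after every base change. The rules for V itself then rest on the fact that Frobenius commutes
    with all homomorphisms of k-algebras. *)

(** * Quotient rings by arbitrary equivalence relations *)

Record setoid_ring (T : Type) := SetoidRing {
  sr_eq : T -> T -> Prop;
  sr0 : T; sr1 : T; srD : T -> T -> T; srN : T -> T; srM : T -> T -> T;
  sr_refl : forall x, sr_eq x x;
  sr_sym : forall x y, sr_eq x y -> sr_eq y x;
  sr_trans : forall y x z, sr_eq x y -> sr_eq y z -> sr_eq x z;
  srD_eq : forall x x' y y', sr_eq x x' -> sr_eq y y' -> sr_eq (srD x y) (srD x' y');
  srN_eq : forall x x', sr_eq x x' -> sr_eq (srN x) (srN x');
  srM_eq : forall x x' y y', sr_eq x x' -> sr_eq y y' -> sr_eq (srM x y) (srM x' y');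
  srDA : forall x y z, sr_eq (srD x (srD y z)) (srD (srD x y) z);
  srDC : forall x y, sr_eq (srD x y) (srD y x);
  sr0D : forall x, sr_eq (srD sr0 x) x;
  srND : forall x, sr_eq (srD (srN x) x) sr0;
  srMA : forall x y z, sr_eq (srM x (srM y z)) (srM (srM x y) z);
  srMC : forall x y, sr_eq (srM x y) (srM y x);
  sr1M : forall x, sr_eq (srM sr1 x) x;
  srMDl : forall x y z, sr_eq (srM (srD x y) z) (srD (srM x z) (srM y z)) }.

Section SetoidQuotient.
Variables (T : Type) (S : setoid_ring T).

(** A class is its characteristic predicate, so that by extensionality equivalent representatives
    give equal elements even though the relation is not decidable. *)
Definition setoid_quot := {P : T -> Prop | exists t, P = sr_eq S t}.
Definition sq_class (t : T) : setoid_quot :=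
  exist _ (sr_eq S t) (ex_intro _ t erefl).
Definition sq_repr (q : setoid_quot) : T := projT1 (cid (proj2_sig q)).

Lemma sq_classP s t : sq_class s = sq_class t <-> sr_eq S s t.
Proof.
split=> [[e]|e]; first by rewrite e; exact: sr_refl.
rewrite /sq_class; apply: eq_exist; apply/funext => u; apply/propext; split=> h.
  exact: sr_trans (sr_sym e) h.
exact: sr_trans e h.
Qed.

Lemma sq_reprK q : sq_class (sq_repr q) = q.
Proof.
case: q => P hP; rewrite /sq_repr; case: cid => t /= e.
by rewrite /sq_class; apply: eq_exist.
Qed.

Lemma sq_repr_eq t : sr_eq S (sq_repr (sq_class t)) t.
Proof. by apply/sq_classP; exact: sq_reprK. Qed.

HB.instance Definition _ := gen_eqMixin setoid_quot.
HB.instance Definition _ := gen_choiceMixin setoid_quot.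

Let addq x y := sq_class (srD S (sq_repr x) (sq_repr y)).
Let oppq x := sq_class (srN S (sq_repr x)).
Let mulq x y := sq_class (srM S (sq_repr x) (sq_repr y)).

Let addqE s t : addq (sq_class s) (sq_class t) = sq_class (srD S s t).
Proof. by apply/sq_classP/srD_eq; exact: sq_repr_eq. Qed.
Let oppqE s : oppq (sq_class s) = sq_class (srN S s).
Proof. by apply/sq_classP/srN_eq; exact: sq_repr_eq. Qed.
Let mulqE s t : mulq (sq_class s) (sq_class t) = sq_class (srM S s t).
Proof. by apply/sq_classP/srM_eq; exact: sq_repr_eq. Qed.

Let addqA : associative addq.
Proof.
move=> x y z; rewrite -(sq_reprK x) -(sq_reprK y) -(sq_reprK z) !addqE.
by apply/sq_classP; exact: srDA.
Qed.
Let addqC : commutative addq.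
Proof.
move=> x y; rewrite -(sq_reprK x) -(sq_reprK y) !addqE.
by apply/sq_classP; exact: srDC.
Qed.
Let add0q : left_id (sq_class (sr0 S)) addq.
Proof. by move=> x; rewrite -(sq_reprK x) addqE; apply/sq_classP; exact: sr0D. Qed.
Let addNq : left_inverse (sq_class (sr0 S)) oppq addq.
Proof.
by move=> x; rewrite -(sq_reprK x) oppqE addqE; apply/sq_classP; exact: srND.
Qed.
HB.instance Definition _ := GRing.isZmodule.Build setoid_quot addqA addqC add0q addNq.

Let mulqA : associative mulq.
Proof.
move=> x y z; rewrite -(sq_reprK x) -(sq_reprK y) -(sq_reprK z) !mulqE.
by apply/sq_classP; exact: srMA.
Qed.
Let mulqC : commutative mulq.
Proof.
move=> x y; rewrite -(sq_reprK x) -(sq_reprK y) !mulqE.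
by apply/sq_classP; exact: srMC.
Qed.
Let mul1q : left_id (sq_class (sr1 S)) mulq.
Proof. by move=> x; rewrite -(sq_reprK x) mulqE; apply/sq_classP; exact: sr1M. Qed.
Let mulqDl : left_distributive mulq addq.
Proof.
move=> x y z; rewrite -(sq_reprK x) -(sq_reprK y) -(sq_reprK z) !(addqE, mulqE).
by apply/sq_classP; exact: srMDl.
Qed.
HB.instance Definition _ :=
  GRing.Zmodule_isComPzRing.Build setoid_quot mulqA mulqC mul1q mulqDl.

Lemma sq_class0 : sq_class (sr0 S) = 0. Proof. by []. Qed.
Lemma sq_class1 : sq_class (sr1 S) = 1. Proof. by []. Qed.
Lemma sq_classD s t : sq_class (srD S s t) = sq_class s + sq_class t.
Proof. by rewrite -addqE. Qed.
Lemma sq_classN s : sq_class (srN S s) = - sq_class s.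
Proof. by rewrite -oppqE. Qed.
Lemma sq_classM s t : sq_class (srM S s t) = sq_class s * sq_class t.
Proof. by rewrite -mulqE. Qed.

Section Lift.
Variables (R : comPzRingType) (h : T -> R).
Hypotheses (h_eq : forall s t, sr_eq S s t -> h s = h t) (h1 : h (sr1 S) = 1)
  (hD : forall s t, h (srD S s t) = h s + h t)
  (hM : forall s t, h (srM S s t) = h s * h t).

(** The hypotheses are arguments of the definition so that the structure of a ring morphism can be
    attached to it. *)
Definition sq_lift & (forall s t, sr_eq S s t -> h s = h t) & h (sr1 S) = 1
    & (forall s t, h (srD S s t) = h s + h t)
    & (forall s t, h (srM S s t) = h s * h t) :=
  fun q : setoid_quot => h (sq_repr q).
Let lift := sq_lift h_eq h1 hD hM.

Lemma sq_liftE t : lift (sq_class t) = h t.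
Proof. by apply: h_eq; exact: sq_repr_eq. Qed.

Let liftD : {morph lift : x y / x + y}.
Proof.
by move=> x y; rewrite -(sq_reprK x) -(sq_reprK y) -sq_classD !sq_liftE hD.
Qed.
Let lift_nmod : nmod_morphism lift.
Proof.
split; last exact: liftD.
by apply: (addrI (lift 0)); rewrite -liftD !addr0.
Qed.
Let lift_mon : monoid_morphism lift.
Proof.
split=> [|x y]; first by rewrite -sq_class1 sq_liftE h1.
by rewrite -(sq_reprK x) -(sq_reprK y) -sq_classM !sq_liftE hM.
Qed.
HB.instance Definition _ := GRing.isNmodMorphism.Build _ _ lift lift_nmod.
HB.instance Definition _ := GRing.isMonoidMorphism.Build _ _ lift lift_mon.
Definition sq_lift_rmorphism : {rmorphism setoid_quot -> R} := lift.

End Lift.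
End SetoidQuotient.

(** * Ideals, generators and units *)

Record is_ideal (R : comPzRingType) (I : R -> Prop) : Prop := IsIdeal {
  ideal0 : I 0;
  idealD : forall x y, I x -> I y -> I (x + y);
  idealM : forall a x, I x -> I (a * x) }.

Lemma ideal_sum (R : comPzRingType) (I : R -> Prop) (J : Type) (r : seq J)
    (P : pred J) (F : J -> R) :
  is_ideal I -> (forall j, P j -> I (F j)) -> I (\sum_(j <- r | P j) F j).
Proof.
by move=> hI hF; apply: big_ind => //; [exact: (ideal0 hI)|exact: (idealD hI)].
Qed.

Lemma idealN (R : comPzRingType) (I : R -> Prop) x : is_ideal I -> I x -> I (- x).
Proof. by move=> hI Ix; rewrite -mulN1r; exact: (idealM hI). Qed.

Lemma idealMr (R : comPzRingType) (I : R -> Prop) x a : is_ideal I -> I x -> I (x * a).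
Proof. by move=> hI Ix; rewrite mulrC; exact: (idealM hI). Qed.

Lemma rker_ideal (R S : comPzRingType) (f : {rmorphism R -> S}) :
  is_ideal (fun x => f x = 0).
Proof.
split=> [|x y fx fy|a x fx]; first exact: rmorph0.
  by rewrite rmorphD fx fy addr0.
by rewrite rmorphM fx mulr0.
Qed.

Lemma ex_ideal_quotient (R : comPzRingType) (I : R -> Prop) :
  is_ideal I -> exists (Q : comPzRingType) (pi : {rmorphism R -> Q}),
    (forall y, exists x, pi x = y) /\ (forall x, pi x = 0 <-> I x).
Proof.
move=> hI.
pose e (x y : R) := I (x - y).
have er x : e x x by rewrite /e subrr; exact: (ideal0 hI).
have E (x y x' y' : R) : x = x' -> y = y' -> e x y -> e x' y' by move=> -> ->.
have es x y : e x y -> e y x by move=> h; rewrite /e -opprB; exact: idealN.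
have et y x z : e x y -> e y z -> e x z.
  by move=> h1 h2; rewrite /e -(subrKA y); exact: (idealD hI).
have eD x x' y y' : e x x' -> e y y' -> e (x + y) (x' + y').
  by move=> h1 h2; rewrite /e opprD addrACA; exact: (idealD hI).
have eN x x' : e x x' -> e (- x) (- x').
  by move=> h; rewrite /e -opprD; exact: idealN.
have eM x x' y y' : e x x' -> e y y' -> e (x * y) (x' * y').
  move=> h1 h2; rewrite /e; have -> : x * y - x' * y' = y * (x - x') + x' * (y - y').
    by rewrite !mulrBr ![y * _]mulrC addrA subrK.
  by apply: (idealD hI); apply: (idealM hI).
have eqe x y : x = y -> e x y by move=> ->.
pose S := @SetoidRing R e 0 1 +%R -%R *%R er es et eD eN eM
  (fun x y z => eqe _ _ (addrA x y z)) (fun x y => eqe _ _ (addrC x y))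
  (fun x => eqe _ _ (add0r x)) (fun x => eqe _ _ (addNr x))
  (fun x y z => eqe _ _ (mulrA x y z)) (fun x y => eqe _ _ (mulrC x y))
  (fun x => eqe _ _ (mul1r x)) (fun x y z => eqe _ _ (mulrDl x y z)).
pose f : R -> setoid_quot S := sq_class S.
have f_nmod : nmod_morphism f by split=> // x y; exact: (sq_classD S).
have f_mon : monoid_morphism f by split=> // x y; exact: (sq_classM S).
pose fA := GRing.isNmodMorphism.Build _ _ f f_nmod.
pose fM := GRing.isMonoidMorphism.Build _ _ f f_mon.
pose F : {rmorphism R -> setoid_quot S} := HB.pack f fA fM.
exists (setoid_quot S), F; split=> [y|x]; first by exists (sq_repr y); exact: sq_reprK.
have -> : (F x = 0) = (sq_class S x = sq_class S 0) by [].
by rewrite sq_classP /= /e subr0.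
Qed.

(** The ideal generated by [I], built by adding one multiple at a time in order to allow induction;
    [spanP] gives the form with finite sums. *)
Inductive span (R : comPzRingType) (I : R -> Prop) : R -> Prop :=
  | span0 : span I 0
  | span_add a x y : I x -> span I y -> span I (a * x + y).

Lemma span_mem (R : comPzRingType) (I : R -> Prop) x : I x -> span I x.
Proof. by move=> Ix; rewrite -[x]addr0 -[x]mul1r; apply: span_add => //; exact: span0. Qed.

Lemma span_ideal (R : comPzRingType) (I : R -> Prop) : is_ideal (span I).
Proof.
split; first exact: span0.
  move=> x y hx hy; elim: hx => [|a u v Iu _ IH]; first by rewrite add0r.
  by rewrite -addrA; apply: span_add.
move=> a x; elim=> [|b u v Iu _ IH]; first by rewrite mulr0; exact: span0.
by rewrite mulrDr mulrA; apply: span_add.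
Qed.

Lemma span_min (R : comPzRingType) (I J : R -> Prop) x :
  is_ideal J -> (forall y, I y -> J y) -> span I x -> J x.
Proof.
move=> hJ IJ; elim=> [|a u v Iu _ Jv]; first exact: (ideal0 hJ).
by apply: (idealD hJ) => //; apply: (idealM hJ); exact: IJ.
Qed.

Lemma spanP (R : comPzRingType) (I : R -> Prop) x : span I x <->
  exists (n : nat) (c y : 'I_n -> R),
    (forall i, I (y i)) /\ \sum_(i < n) c i * y i = x.
Proof.
split=> [|[n [c [y [Iy <-]]]]]; last first.
  apply: ideal_sum; first exact: span_ideal.
  by move=> i _; apply: (idealM (span_ideal I)); exact: span_mem.
elim=> [|a u v Iu _ [n [c [y [Iy <-]]]]].
  by exists 0, (fun=> 0), (fun=> 0); rewrite big_ord0; split=> // -[].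
exists n.+1, (fun i => if unlift ord0 i is Some j then c j else a),
  (fun i => if unlift ord0 i is Some j then y j else u); split.
  by move=> i; case: unliftP.
rewrite big_ord_recl unlift_none; congr (_ + _).
by apply: eq_bigr => i _; rewrite liftK.
Qed.

Lemma span_range (R : comPzRingType) n (g : 'I_n -> R) x :
  span (fun y => exists i, y = g i) x -> exists c : 'I_n -> R, x = \sum_i c i * g i.
Proof.
elim=> [|a _ y [i ->] _ [c ->]].
  by exists (fun=> 0); rewrite big1 // => i _; rewrite mul0r.
exists (fun j => (if j == i then a else 0) + c j).
under [RHS]eq_bigr do rewrite mulrDl.
rewrite big_split /=; congr (_ + _).
rewrite (bigD1 i) //= eqxx big1 ?addr0 // => j /negbTE ->.
by rewrite mul0r.
Qed.

Lemma unit_idealE (R : comPzRingType) (I : R -> Prop) : unit_ideal I <-> span I 1.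
Proof. by rewrite spanP. Qed.

Lemma span_map (R S : comPzRingType) (f : {rmorphism R -> S}) (I : R -> Prop) x :
  span I x -> span (fun s => exists2 r, I r & s = f r) (f x).
Proof.
elim=> [|a u v Iu _ IH]; first by rewrite rmorph0; exact: span0.
by rewrite rmorphD rmorphM; apply: span_add => //; exists u.
Qed.

Lemma unit_unit_ideal (R : comPzRingType) (x : R) : is_unit x <-> unit_ideal (fun y => y = x).
Proof.
rewrite unit_idealE; split=> [[v xv]|].
  by rewrite -xv mulrC; apply: (idealM (span_ideal _)); exact: span_mem.
move=> h; suff [v e] : exists v, 1 = v * x by exists v; rewrite mulrC -e.
elim: h => [|a u v -> _ [w ->]]; first by exists 0; rewrite mul0r.
by exists (a + w); rewrite mulrDl.
Qed.

Lemma is_unitM (R : comPzRingType) (x y : R) : is_unit x -> is_unit y -> is_unit (x * y).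
Proof.
by move=> [u xu] [v yv]; exists (u * v); rewrite mulrACA xu yv mulr1.
Qed.

Lemma is_unitX (R : comPzRingType) (x : R) n : is_unit x -> is_unit (x ^+ n).
Proof.
move=> ux; elim: n => [|n IH]; first by exists 1; rewrite mulr1.
by rewrite exprS; exact: is_unitM.
Qed.

Lemma is_unit_factor (R : comPzRingType) (x y : R) : is_unit (x * y) -> is_unit x.
Proof. by move=> [v e]; exists (y * v); rewrite mulrA. Qed.

Lemma is_unit_map (R S : comPzRingType) (f : {rmorphism R -> S}) x :
  is_unit x -> is_unit (f x).
Proof. by move=> [v e]; exists (f v); rewrite -rmorphM e rmorph1. Qed.

Lemma is_unit_cancel (R : comPzRingType) (u x y : R) :
  is_unit u -> u * x = u * y -> x = y.
Proof.
by move=> [v e] /(congr1 ( *%R v)); rewrite !mulrA [v * u]mulrC e !mul1r.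
Qed.

Lemma field_is_unit (K : fieldType) (x : K) : is_unit x <-> x != 0.
Proof.
split=> [[v e]|x0]; last by exists x^-1; rewrite mulfV.
by apply/eqP => x0; move: (oner_neq0 K); rewrite -e x0 mul0r eqxx.
Qed.

Lemma field_unit_ideal (K : fieldType) (I : K -> Prop) :
  unit_ideal I <-> exists2 x, I x & x != 0.
Proof.
rewrite unit_idealE; split=> [h|[x Ix x0]]; last first.
  by rewrite -(mulVf x0); apply: (idealM (span_ideal _)); exact: span_mem.
apply: contrapT => no; have : 1 = 0 :> K.
  apply: (span_min (J := fun x => x = 0)) h.
    by split=> // [x y -> ->|a x ->]; rewrite ?addr0 ?mulr0.
  by move=> y Iy; apply/eqP; apply: contrapT => /negP y0; apply: no; exists y.
by apply/eqP; exact: oner_neq0.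
Qed.

(** * Localization *)

Definition multiplicative_set (R : comPzRingType) (M : R -> Prop) :=
  M 1 /\ forall x y, M x -> M y -> M (x * y).

(** These conditions determine the localization without fixing a model; [localizes_lift] extracts
    the universal property from them. *)
Definition localizes (R S : comPzRingType) (M : R -> Prop) (f : {rmorphism R -> S}) :=
  [/\ forall r, M r -> is_unit (f r),
      forall s, exists a r, M r /\ s * f r = f a
    & forall a, f a = 0 -> exists r, M r /\ r * a = 0].

Lemma ex_localization (R : comPzRingType) (M : R -> Prop) : multiplicative_set M ->
  exists (S : comPzRingType) (f : {rmorphism R -> S}), localizes M f.
Proof.
move=> [M1 MM].
pose T := (R * {s : R | M s})%type.
pose d (x : T) : R := sval x.2.
pose mk a s (hs : M s) : T := (a, exist _ s hs).
have Md x : M (d x) by exact: (proj2_sig x.2).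
pose e (x y : T) := exists u, M u /\ u * (x.1 * d y) = u * (y.1 * d x).
pose z : T := mk 0 1 M1.
pose o : T := mk 1 1 M1.
pose ad (x y : T) : T := mk (x.1 * d y + y.1 * d x) (d x * d y) (MM _ _ (Md x) (Md y)).
pose op (x : T) : T := mk (- x.1) (d x) (Md x).
pose mu (x y : T) : T := mk (x.1 * y.1) (d x * d y) (MM _ _ (Md x) (Md y)).
have eqe x y : x.1 * d y = y.1 * d x -> e x y by move=> h; exists 1; rewrite h.
have er x : e x x by apply: eqe.
have es x y : e x y -> e y x by move=> [u [Mu h]]; exists u.
have et y x t : e x y -> e y t -> e x t.
  (* The denominator of the middle fraction belongs to the witness, since it may be a zero divisor
     and cannot be cancelled. *)
  move=> [u [Mu h1]] [v [Mv h2]]; exists (u * v * d y); split; first exact: (MM _ _ (MM _ _ Mu Mv) (Md y)).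
  have -> : u * v * d y * (x.1 * d t) = v * d t * (u * (x.1 * d y)) by ring.
  rewrite h1; have -> : v * d t * (u * (y.1 * d x)) = u * d x * (v * (y.1 * d t)) by ring.
  by rewrite h2; ring.
have eD x x' y y' : e x x' -> e y y' -> e (ad x y) (ad x' y').
  move=> [u [Mu h1]] [v [Mv h2]]; exists (u * v); split; first exact: (MM _ _ Mu Mv).
  rewrite /ad /d /=; rewrite -/(d x) -/(d y) -/(d x') -/(d y').
  have -> : u * v * ((x.1 * d y + y.1 * d x) * (d x' * d y')) =
    v * d y * d y' * (u * (x.1 * d x')) + u * d x * d x' * (v * (y.1 * d y')) by ring.
  by rewrite h1 h2; ring.
have eN x x' : e x x' -> e (op x) (op x').
  move=> [u [Mu h1]]; exists u; split=> //; rewrite /op /d /= -/(d x) -/(d x').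
  by rewrite !mulNr !mulrN h1.
have eM x x' y y' : e x x' -> e y y' -> e (mu x y) (mu x' y').
  move=> [u [Mu h1]] [v [Mv h2]]; exists (u * v); split; first exact: (MM _ _ Mu Mv).
  rewrite /mu /d /= -/(d x) -/(d y) -/(d x') -/(d y').
  have -> : u * v * (x.1 * y.1 * (d x' * d y')) = (u * (x.1 * d x')) * (v * (y.1 * d y')) by ring.
  by rewrite h1 h2; ring.
have DA x y t : e (ad x (ad y t)) (ad (ad x y) t).
  by apply: eqe; rewrite /ad /d /= -/(d x) -/(d y) -/(d t); ring.
have DC x y : e (ad x y) (ad y x).
  by apply: eqe; rewrite /ad /d /= -/(d x) -/(d y); ring.
have D0 x : e (ad z x) x.
  by apply: eqe; rewrite /ad /z /d /= -/(d x); ring.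
have DN x : e (ad (op x) x) z.
  by apply: eqe; rewrite /ad /op /z /d /= -/(d x); ring.
have MA x y t : e (mu x (mu y t)) (mu (mu x y) t).
  by apply: eqe; rewrite /mu /d /= -/(d x) -/(d y) -/(d t); ring.
have MC x y : e (mu x y) (mu y x).
  by apply: eqe; rewrite /mu /d /= -/(d x) -/(d y); ring.
have M1l x : e (mu o x) x.
  by apply: eqe; rewrite /mu /o /d /= -/(d x); ring.
have MD x y t : e (mu (ad x y) t) (ad (mu x t) (mu y t)).
  by apply: eqe; rewrite /mu /ad /d /= -/(d x) -/(d y) -/(d t); ring.
pose S := SetoidRing er es et eD eN eM DA DC D0 DN MA MC M1l MD.
pose f (a : R) : setoid_quot S := sq_class S (mk a 1 M1).
have f_nmod : nmod_morphism f.
  split=> [//|x y]; rewrite -(sq_classD S); apply/sq_classP; apply: eqe.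
  by rewrite /= /ad /mu /mk /d /=; ring.
have f_mon : monoid_morphism f.
  split=> [//|x y]; rewrite -(sq_classM S); apply/sq_classP; apply: eqe.
  by rewrite /= /ad /mu /mk /d /=; ring.
pose fA := GRing.isNmodMorphism.Build _ _ f f_nmod.
pose fM := GRing.isMonoidMorphism.Build _ _ f f_mon.
pose F : {rmorphism R -> setoid_quot S} := HB.pack f fA fM.
exists (setoid_quot S), F; split.
- move=> r Mr; exists (sq_class S (mk 1 r Mr)).
  change (F r) with (sq_class S (mk r 1 M1)); rewrite -(sq_classM S) -(sq_class1 S).
  by apply/sq_classP; apply: eqe; rewrite /= /ad /mu /mk /d /=; ring.
- move=> s; exists (sq_repr s).1, (d (sq_repr s)); split=> //.
  rewrite -{1}(sq_reprK s); change (F ?r) with (sq_class S (mk r 1 M1)).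
  by rewrite -(sq_classM S); apply/sq_classP; apply: eqe; rewrite /= /ad /mu /mk /d /=; ring.
- move=> a; change (F a) with (sq_class S (mk a 1 M1)); rewrite -(sq_class0 S).
  move=> /sq_classP [u [Mu /= h]]; exists u; split=> //.
  by move: h; rewrite /d /= !mulr1 mulr0.
Qed.

Lemma localizes_lift (R S T : comPzRingType) (M : R -> Prop) (f : {rmorphism R -> S})
    (g : {rmorphism R -> T}) :
  multiplicative_set M -> localizes M f -> (forall r, M r -> is_unit (g r)) ->
  exists h : {rmorphism S -> T}, forall r, h (f r) = g r.
Proof.
move=> [M1 MM] [fu ff fk] gu.
(* The value at [s] is specified through all fractions that represent [s], which settles
   independence of the fraction once and for all. *)
have ex s : exists t, forall a r, M r -> s * f r = f a -> t * g r = g a.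
  have [a [r [Mr e]]] := ff s; have [v gv] := gu _ Mr.
  exists (g a * v) => a' r' Mr' e'.
  have [u [Mu h]] : exists u, M u /\ u * (a * r' - a' * r) = 0.
    apply: fk; rewrite rmorphB !rmorphM -e -e'; ring.
  have {h} h : g a * g r' = g a' * g r.
    apply: (is_unit_cancel (gu _ Mu)); rewrite -!rmorphM.
    by apply/eqP; rewrite -subr_eq0 -rmorphB -mulrBr h rmorph0.
  by rewrite mulrAC h -mulrA gv mulr1.
pose h s := sval (cid (ex s)).
have hE s a r : M r -> s * f r = f a -> h s * g r = g a.
  exact: (proj2_sig (cid (ex s))).
have hf r : h (f r) = g r.
  by rewrite -(mulr1 (h _)) -(rmorph1 g); apply: hE => //; rewrite rmorph1 mulr1.
have h_nmod : nmod_morphism h.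
  split=> [|x y]; first by rewrite -(rmorph0 f) hf rmorph0.
  have [a [r [Mr ea]]] := ff x; have [b [s [Ms eb]]] := ff y.
  apply: (is_unit_cancel (gu _ (MM _ _ Mr Ms))); rewrite mulrC.
  rewrite (hE _ (a * s + b * r) _ (MM _ _ Mr Ms)); last first.
    by rewrite !(rmorphM, rmorphD) -ea -eb; ring.
  by rewrite !(rmorphM, rmorphD) -(hE _ _ _ Mr ea) -(hE _ _ _ Ms eb); ring.
have h_mon : monoid_morphism h.
  split=> [|x y]; first by rewrite -(rmorph1 f) hf rmorph1.
  have [a [r [Mr ea]]] := ff x; have [b [s [Ms eb]]] := ff y.
  apply: (is_unit_cancel (gu _ (MM _ _ Mr Ms))); rewrite mulrC.
  rewrite (hE _ (a * b) _ (MM _ _ Mr Ms)); last by rewrite !rmorphM -ea -eb; ring.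
  by rewrite !rmorphM -(hE _ _ _ Mr ea) -(hE _ _ _ Ms eb); ring.
pose hA := GRing.isNmodMorphism.Build _ _ h h_nmod.
pose hM := GRing.isMonoidMorphism.Build _ _ h h_mon.
by exists (HB.pack h hA hM : {rmorphism S -> T}).
Qed.

Definition powers (R : comPzRingType) (r x : R) := exists n, x = r ^+ n.

Lemma powers_mult (R : comPzRingType) (r : R) : multiplicative_set (powers r).
Proof.
split; first by exists 0.
by move=> _ _ [m ->] [n ->]; exists (m + n)%N; rewrite exprD.
Qed.

Lemma is_localizationP (R S : comPzRingType) (r : R) (f : {rmorphism R -> S}) :
  is_localization r f <-> localizes (powers r) f.
Proof.
split=> -[h1 h2 h3]; split.
- by move=> _ [n ->]; rewrite rmorphXn; exact: is_unitX.
- move=> s; have [a [n e]] := h2 s; exists a, (r ^+ n); rewrite rmorphXn.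
  by split=> //; exists n.
- by move=> a /h3 [n e]; exists (r ^+ n); split=> //; exists n.
- by apply: h1; exists 1.
- by move=> s; have [a [_ [[n ->]]]] := h2 s; rewrite rmorphXn; exists a, n.
- by move=> a /h3 [_ [[n ->] e]]; exists n.
Qed.

(** * Maximal ideals and tests in fields *)

Lemma ex_maximal_ideal (R : comPzRingType) (J : R -> Prop) : is_ideal J -> ~ J 1 ->
  exists I : R -> Prop, [/\ is_ideal I, ~ I 1, forall x, J x -> I x
    & forall x, ~ I x -> exists y, I (1 - x * y)].
Proof.
move=> hJ J1.
pose P (I : R -> Prop) := [/\ is_ideal I, ~ I 1 & forall x, J x -> I x].
pose T := {I : R -> Prop | P I}.
pose mk I (h : P I) : T := exist P I h.
pose rel (s t : T) := `[< forall x, sval s x -> sval t x >].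
have [| | | |[m [hm m1 Jm]] mx] := @classical_sets.Zorn T rel.
- by move=> t; apply/asboolP.
- by move=> r s t /asboolP h1 /asboolP h2; apply/asboolP => x /h1 /h2.
- move=> [s ps] [t pt] /asboolP /= h1 /asboolP /= h2; apply: eq_exist.
  by apply/funext => x; apply/propext; split=> [/h1|/h2].
- move=> A tot; have [[a Aa]|no] := pselect (exists a, A a); last first.
    have h : P J by [].
    by exists (mk J h) => s As; case: no; exists s.
  have h : P (fun x => exists2 s, A s & sval s x).
    split.
    - split.
      + by exists a => //; case: (proj2_sig a) => ha _ _; exact: (ideal0 ha).
      + move=> x y [s As sx] [t At ty]; have := tot _ _ As At.
        case=> /asboolP le; [exists t => //; have hs := proj2_sig t|exists s => //; have hs := proj2_sig s];
          by case: hs => hs _ _; apply: (idealD hs) => //; exact: le.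
      + by move=> b x [s As sx]; exists s => //; case: (proj2_sig s) => hs _ _; exact: (idealM hs).
    - by case=> s _; case: (proj2_sig s).
    - by move=> x Jx; exists a => //; case: (proj2_sig a) => _ _; apply.
  by exists (mk _ h) => s As; apply/asboolP => x sx /=; exists s.
exists m; split=> // x mx'; apply: contrapT => no.
pose m' z := exists a b, m a /\ z = a + x * b.
have h : P m'.
  split.
  - split.
    + by exists 0, 0; rewrite mulr0 addr0; split=> //; exact: (ideal0 hm).
    + move=> _ _ [a [b [ma ->]]] [c [d [mc ->]]]; exists (a + c), (b + d).
      by split; [exact: (idealD hm)|ring].
    + move=> c _ [a [b [ma ->]]]; exists (c * a), (c * b).
      by split; [exact: (idealM hm)|ring].
  - by move=> [a [b [ma e]]]; apply: no; exists b; rewrite e addrK.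
  - by move=> y Jy; exists y, 0; rewrite mulr0 addr0; split=> //; exact: (Jm y Jy).
have /(congr1 sval) /= e : mk _ h = exist P m (And3 hm m1 Jm).
  apply: mx.
  by apply/asboolP => y /= my; exists y, 0; rewrite mulr0 addr0.
apply: mx'; rewrite -e; exists 0, 1; rewrite mulr1 add0r; split=> //.
exact: (ideal0 hm).
Qed.

Lemma ex_residue_field (R : comPzRingType) (J : R -> Prop) : is_ideal J -> ~ J 1 ->
  exists (K : fieldType) (j : {rmorphism R -> K}),
    (forall x, J x -> j x = 0) /\ (forall y, exists x, j x = y).
Proof.
move=> hJ J1; have [m [hm m1 Jm mx]] := ex_maximal_ideal hJ J1.
have [Q [pi [surj ker]]] := ex_ideal_quotient hm.
have nz : (1 : Q) != 0.
  by apply/eqP => e; apply: m1; apply/ker; rewrite rmorph1.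
have inv_ex (x : Q) : exists y, (x != 0 -> y * x = 1) /\ (x = 0 -> y = 0).
  have [->|x0] := eqVneq x 0; first by exists 0.
  have [z zx] := surj x; have /mx [y /ker] : ~ m z.
    by move=> /ker; rewrite zx => /eqP; rewrite (negbTE x0).
  rewrite rmorphB rmorph1 rmorphM zx => /eqP; rewrite subr_eq0 => /eqP e.
  by exists (pi y); split=> [_|/eqP]; [rewrite mulrC|rewrite (negbTE x0)].
have [inv invE] := choice inv_ex.
have invP (x : Q) : x != 0 -> inv x * x = 1 by case: (invE x).
have inv0 : inv 0 = 0 by case: (invE 0) => _; apply.
pose nzm := GRing.PzSemiRing_isNonZero.Build Q nz.
pose Qn : comNzRingType := HB.pack (GRing.ComPzRing.sort Q) (GRing.ComPzRing.class Q) nzm.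
pose fm := GRing.ComNzRing_isField.Build Qn invP inv0.
pose K : fieldType := HB.pack (GRing.ComNzRing.sort Qn) (GRing.ComNzRing.class Qn) fm.
have p1 : @nmod_morphism R K pi by split; [exact: rmorph0|exact: rmorphD].
have p2 : @monoid_morphism R K pi by split; [exact: rmorph1|exact: rmorphM].
pose pA := GRing.isNmodMorphism.Build R K pi p1.
pose pM := GRing.isMonoidMorphism.Build R K pi p2.
pose F : {rmorphism R -> K} := HB.pack (pi : R -> K) pA pM.
by exists K, F; split=> // x /Jm /ker.
Qed.

(** A maximal ideal of the localization at [M] that contains the image of [J] restricts to a prime
    ideal of [R] that contains [J] and misses [M]. *)
Lemma ex_field_avoiding (R : comPzRingType) (M J : R -> Prop) :
  multiplicative_set M -> is_ideal J -> (forall x, M x -> ~ J x) ->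
  exists (K : fieldType) (j : {rmorphism R -> K}),
    (forall x, J x -> j x = 0) /\ (forall x, M x -> j x != 0).
Proof.
move=> hM hJ MJ; have [S [f [fu ff fk]]] := ex_localization hM.
pose J' (s : S) := exists a r, [/\ J a, M r & s * f r = f a].
have hJ' : is_ideal J'.
  split.
  - by exists 0, 1; rewrite mul0r rmorph0; split=> //; [exact: (ideal0 hJ)|case: hM].
  - move=> x y [a [r [Ja Mr e]]] [b [s [Jb Ms e']]]; exists (a * s + b * r), (r * s).
    split; [apply: (idealD hJ); exact: idealMr|exact: (proj2 hM)|].
    by rewrite rmorphD !rmorphM -e -e'; ring.
  - move=> c x [a [r [Ja Mr e]]]; have [b [s [Ms e']]] := ff c.
    exists (b * a), (s * r); split; [exact: (idealM hJ)|exact: (proj2 hM)|].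
    by rewrite !rmorphM -e -e'; ring.
have J'1 : ~ J' 1.
  move=> [a [r [Ja Mr]]]; rewrite mul1r => e.
  have [u [Mu h]] : exists u, M u /\ u * (r - a) = 0.
    by apply: fk; rewrite rmorphB e subrr.
  apply: (MJ (u * r)); first exact: (proj2 hM).
  by move/eqP: h; rewrite mulrBr subr_eq0 => /eqP ->; exact: (idealM hJ).
have [K [j [j0 _]]] := ex_residue_field hJ' J'1.
exists K, (j \o f); split=> x h /=.
  by apply: j0; exists x, 1; rewrite rmorph1 mulr1; split=> //; case: hM.
by apply/field_is_unit; apply: is_unit_map; exact: fu.
Qed.

Lemma unit_ideal_fields (R : comPzRingType) (I : R -> Prop) :
  (forall (K : fieldType) (j : {rmorphism R -> K}), exists2 x, I x & j x != 0) ->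
  unit_ideal I.
Proof.
move=> h; rewrite unit_idealE; apply: contrapT => no.
have [K [j [j0 _]]] := ex_residue_field (span_ideal I) no.
by have [x Ix /eqP[]] := h K j; apply: j0; exact: span_mem.
Qed.

Lemma not_nilpotent_field (R : comPzRingType) (r : R) : (forall n, r ^+ n <> 0) ->
  exists (K : fieldType) (j : {rmorphism R -> K}), j r != 0.
Proof.
move=> nr; have [] := @ex_field_avoiding R (powers r) (fun x => x = 0).
- exact: powers_mult.
- by split=> // [x y -> ->|a x ->]; rewrite ?addr0 ?mulr0.
- by move=> x [n ->].
by move=> K [j [_ h]]; exists K, j; apply: h; exists 1.
Qed.

Lemma unit_ideal_field_mem (R : comPzRingType) (I : R -> Prop) (K : fieldType)
    (j : {rmorphism R -> K}) : unit_ideal I -> exists2 x, I x & j x != 0.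
Proof.
rewrite unit_idealE => /(span_map j); rewrite rmorph1 -unit_idealE.
by case/field_unit_ideal => _ [r Ir ->] h; exists r.
Qed.

Lemma unit_ideal_map (R S : comPzRingType) (f : {rmorphism R -> S}) (I : R -> Prop) :
  unit_ideal I -> unit_ideal (fun s => exists2 r, I r & s = f r).
Proof. by rewrite !unit_idealE => /(span_map f); rewrite rmorph1. Qed.

(** The annihilator of [x] contains a power of each member of [I]. In every field one of these
    powers is nonzero, so the annihilator is the whole ring. *)
Lemma cover_vanish (R : comPzRingType) (I : R -> Prop) x :
  unit_ideal I -> (forall r, I r -> exists n : nat, r ^+ n * x = 0) -> x = 0.
Proof.
move=> hI h; have : unit_ideal (fun y => y * x = 0).
  apply: unit_ideal_fields => K j; have [r Ir r0] := unit_ideal_field_mem j hI.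
  have [n rx] := h r Ir; exists (r ^+ n) => //.
  by rewrite rmorphXn expf_neq0.
rewrite unit_idealE => /(@span_min _ _ (fun y => y * x = 0)) h1; rewrite -(mul1r x).
apply: h1 => //; split=> [|a b ha hb|a b hb]; first by rewrite mul0r.
  by rewrite mulrDl ha hb addr0.
by rewrite -mulrA hb mulr0.
Qed.

(** * Gluing elements of localizations *)

Section Cover.
Variables (R : comPzRingType) (n : nat) (S : 'I_n -> comPzRingType)
  (l : forall i, {rmorphism R -> S i}) (r : 'I_n -> R).
Hypotheses (r_unit : unit_ideal (fun x => exists i, x = r i))
  (l_loc : forall i, is_localization (r i) (l i)).

Lemma cover_inj x y : (forall i, l i x = l i y) -> x = y.
Proof.
move=> e; apply/eqP; rewrite -subr_eq0; apply/eqP; apply: (cover_vanish r_unit).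
move=> _ [i ->]; have [_ _ h] := l_loc i; apply: h.
by rewrite rmorphB e subrr.
Qed.

Lemma cover_combination (b : 'I_n -> R) :
  (forall i, exists k : nat, b i = r i ^+ k) -> exists c, \sum_(i < n) c i * b i = 1.
Proof.
move=> hb; have : unit_ideal (fun x => exists i, x = b i).
  apply: unit_ideal_fields => K j.
  have [_ [i ->] h] := unit_ideal_field_mem j r_unit; exists (b i); first by exists i.
  by have [k ->] := hb i; rewrite rmorphXn expf_neq0.
by rewrite unit_idealE => /span_range [c ->]; exists c.
Qed.

Lemma cover_glue (x : forall i, S i) :
  (forall i j (T : comPzRingType) (g : {rmorphism S i -> T}) (g' : {rmorphism S j -> T}),
     (forall a, g (l i a) = g' (l j a)) -> g (x i) = g' (x j)) ->
  exists z, forall i, l i z = x i.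
Proof.
move=> compat.
have /choice [p hp] i : exists p : R * nat, x i * l i (r i) ^+ p.2 = l i p.1.
  by have [_ h _] := l_loc i; have [a [k e]] := h (x i); exists (a, k).
pose a i := (p i).1; pose b i := r i ^+ (p i).2.
have ab i : x i * l i (b i) = l i (a i) by rewrite rmorphXn hp.
(* Compatibility is used in the localization at [r i * r j]; there the two fractions agree, so a
   power of this product kills the difference of the cross products. *)
have /choice [N hN] (q : 'I_n * 'I_n) : exists N : nat,
    (r q.1 * r q.2) ^+ N * (b q.2 * a q.1 - b q.1 * a q.2) = 0.
  case: q => i j /=; have [Q [f loc]] := ex_localization (powers_mult (r i * r j)).
  have [fu _ fk] := loc.
  have ur : is_unit (f (r i * r j)) by apply: fu; exists 1.
  have uri : is_unit (f (r i)) by move: ur; rewrite rmorphM; exact: is_unit_factor.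
  have urj : is_unit (f (r j)).
    by move: ur; rewrite rmorphM mulrC; exact: is_unit_factor.
  have [g gE] : exists g : {rmorphism S i -> Q}, forall a, g (l i a) = f a.
    apply: (localizes_lift (powers_mult (r i))); first exact/is_localizationP.
    by move=> _ [k ->]; rewrite rmorphXn; exact: is_unitX.
  have [g' gE'] : exists g : {rmorphism S j -> Q}, forall a, g (l j a) = f a.
    apply: (localizes_lift (powers_mult (r j))); first exact/is_localizationP.
    by move=> _ [k ->]; rewrite rmorphXn; exact: is_unitX.
  have e : g (x i) = g' (x j) by apply: compat => c; rewrite gE gE'.
  have [] := fk (b j * a i - b i * a j).
    rewrite rmorphB !rmorphM -!gE' -(ab j) !gE' -!gE -(ab i) rmorphM !gE e.
    by rewrite rmorphM gE'; ring.
  by move=> _ [[k ->] h]; exists k.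
(* There are finitely many pairs, so one exponent serves all. Absorbed into numerators and
   denominators, it makes the cross products [ab'] agree exactly. *)
pose M := \max_q N q.
have NM i j : (r i * r j) ^+ M * (b j * a i - b i * a j) = 0.
  have le : (N (i, j) <= M)%N := leq_bigmax (F := N) (i, j).
  by rewrite -(subnK le) exprD -mulrA (hN (i, j)) mulr0.
pose b' i := r i ^+ M * b i; pose a' i := r i ^+ M * a i.
have ab' i j : b' j * a' i = b' i * a' j.
  apply/eqP; rewrite -subr_eq0; apply/eqP; rewrite -[RHS](NM i j) exprMn /b' /a'; ring.
have [c hc] : exists c, \sum_(i < n) c i * b' i = 1.
  by apply: cover_combination => i; exists (M + (p i).2)%N; rewrite exprD.
exists (\sum_i c i * a' i) => j.
have ub : is_unit (l j (b' j)).
  have [u _ _] := l_loc j; rewrite /b' rmorphM !rmorphXn.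
  by apply: is_unitM; exact: is_unitX.
apply: (is_unit_cancel ub); rewrite -rmorphM mulr_sumr.
have -> : \sum_i b' j * (c i * a' i) = (\sum_i c i * b' i) * a' j.
  by rewrite mulr_suml; apply: eq_bigr => i _; rewrite mulrCA ab' mulrA.
by rewrite hc mul1r /a' /b' !rmorphM -ab; ring.
Qed.

End Cover.

(** * Points of functors and open covers *)

Definition push (B : comPzRingType) (R : alg B) (S : comPzRingType)
  (f : {rmorphism R -> S}) : alg B := @Alg B S (f \o str R).
Definition to_push (B : comPzRingType) (R : alg B) (S : comPzRingType)
  (f : {rmorphism R -> S}) : ahom R (push f) := @AHom B R (push f) f (fun b => erefl).
Definition ahom_comp (B : comPzRingType) (R S T : alg B) (g : ahom S T) (f : ahom R S) :
  ahom R T := @AHom B R T (g \o f) (fun b => etrans (congr1 g (ahomE f b)) (ahomE g b)).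
Definition ahom_id (B : comPzRingType) (R : alg B) : ahom R R :=
  @AHom B R R idfun (fun b => erefl).

Section Functorial.
Variables (B : comPzRingType) (X : pre B).
Hypothesis X_func : functorial X.

Lemma pmap_id (R : alg B) (f : ahom R R) x : (forall r, f r = r) -> pmap X f x = x :> X R.
Proof. by have [h _] := X_func; exact: h. Qed.

Lemma pmap_comp (R S T : alg B) (f : ahom R S) (g : ahom S T) (h : ahom R T) (x : X R) :
  (forall r, h r = g (f r)) -> pmap X g (pmap X f x) = pmap X h x.
Proof. by have [_ e] := X_func; exact: e. Qed.

Lemma open_stable (U : sub X) (R S : alg B) (f : ahom R S) x :
  is_open U -> U R x -> U S (pmap X f x).
Proof.
move=> oU Ux; have [I hI] := oU R x; apply/hI.
have h : unit_ideal (fun s => exists2 r, I r & s = ahom_id R r).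
  by apply/hI; rewrite pmap_id.
have /unit_ideal_map -/(_ _ f) := h; rewrite !unit_idealE; apply: span_min.
  exact: span_ideal.
by move=> _ [_ [r Ir ->] ->]; apply: span_mem; exists r.
Qed.

(** [covers] only speaks of points in fields. For a fixed [x] each open set is given by a set of
    elements of [R]; by the field condition all these elements together generate the unit ideal, and
    finitely many of them suffice. *)
Lemma open_cover (J : Type) (U : J -> sub X) (R : alg B) (x : X R) :
  (forall j, is_open (U j)) -> covers U ->
  exists (n : nat) (S : 'I_n -> alg B) (l : forall i, ahom R (S i)) (k : 'I_n -> J),
    zariski_cover l /\ forall i, U (k i) _ (pmap X (l i) x).
Proof.
move=> oU cU.
have /choice [I hI] j := oU j R x.
have : unit_ideal (fun r => exists j, I j r).
  apply: unit_ideal_fields => K f.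
  have [j Uj] := cU K _ (pmap X (to_push f) x).
  have /hI /field_unit_ideal [_ [r Ir ->] r0] := Uj; exists r => //; by exists j.
rewrite unit_idealE => /spanP [n [c [y [Iy e]]]].
have [k hk] := choice Iy.
have ex i : exists Sf : {S : comPzRingType & {rmorphism R -> S}},
    localizes (powers (y i)) (projT2 Sf).
  by have [S [f h]] := ex_localization (powers_mult (y i)); exists (existT _ S f).
have [Sf hSf] := choice ex.
exists n, (fun i => push (projT2 (Sf i))), (fun i => to_push (projT2 (Sf i))), k.
split.
  exists y; split; last by move=> i; apply/is_localizationP; exact: hSf.
  rewrite unit_idealE -e; apply: ideal_sum; first exact: span_ideal.
  by move=> i _; apply: (idealM (span_ideal _)); apply: span_mem; exists i.
move=> i; apply/hI.
have u : is_unit (projT2 (Sf i) (y i)) by have [h _ _] := hSf i; apply: h; exists 1.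
have := iffLR (unit_unit_ideal _) u; rewrite !unit_idealE; apply: span_min.
  exact: span_ideal.
by move=> _ ->; apply: span_mem; exists (y i).
Qed.

End Functorial.

(** * Existence of algebraically closed extensions *)

Lemma ex_root_field (F : fieldType) (p : {poly F}) : (1 < size p)%N ->
  exists (E : fieldType) (i : {rmorphism F -> E}) (z : E), root (map_poly i p) z.
Proof.
move=> sp; pose J (q : {poly F}) := p %| q.
have hJ : is_ideal (R := {poly F}) (fun q => J q).
  split=> [|x y|a x]; rewrite /J; first exact: dvdp0.
    by move=> hx hy; exact: dvdp_add.
  by move=> hx; exact: dvdp_mull.
have J1 : ~ J 1 by rewrite /J dvdp1 => /eqP e; rewrite e in sp.
(* A maximal ideal containing [p] plays the role of an irreducible factor of [p]. *)
have [E [j [j0 _]]] := ex_residue_field hJ J1.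
exists E, (j \o polyC), (j 'X); rewrite map_poly_comp /= rootE.
rewrite -[X in _.[X]]/(j 'X) horner_map /= -/(comp_poly 'X p) comp_polyXr.
by apply/eqP; apply: j0; exact: dvdpp.
Qed.

Lemma ex_splitting_field (F : fieldType) (p : {poly F}) : p != 0 ->
  exists (E : fieldType) (i : {rmorphism F -> E}) (zs : seq E),
    map_poly i p = i (lead_coef p) *: \prod_(z <- zs) ('X - z%:P).
Proof.
have [n] := ubnP (size p); elim: n F p => // n IH F p sp p0.
have [s1|s1] := leqP (size p) 1.
  exists F, idfun, [::]; rewrite big_nil map_poly_id //=.
  by rewrite {1}(size1_polyC s1) -[in RHS]mul_polyC mulr1 lead_coefE (eqP (_ : size p == 1%N)) // eqn_leq s1 size_poly_gt0.
have [E [i [z /factor_theorem [q hq]]]] := ex_root_field s1.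
have q0 : q != 0.
  by apply: contraNneq p0 => q0; rewrite -(map_poly_eq0 i) hq q0 mul0r.
have sq : (size q < n)%N.
  by move: sp; rewrite -(size_map_poly i) hq size_Mmonic ?monicXsubC // size_XsubC addn2.
have [E' [i' [zs e]]] := IH E q sq q0.
exists E', (i' \o i), (i' z :: zs).
rewrite map_poly_comp /= hq rmorphM /= e map_polyXsubC big_cons /=.
have -> : i (lead_coef p) = lead_coef q.
  by rewrite -lead_coef_map hq lead_coef_Mmonic // monicXsubC.
by rewrite -scalerAl mulrC.
Qed.

Section FieldProduct.
Variables (I : Type) (i0 : I) (F : I -> fieldType).
(** The extra argument witnesses that the index type is inhabited, hence that the product ring is
    nonzero. *)
Definition field_prod & I := forall i, F i.
Local Notation P := (field_prod i0).
HB.instance Definition _ := gen_eqMixin P.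
HB.instance Definition _ := gen_choiceMixin P.
Let z : P := fun i => 0.
Let o : P := fun i => 1.
Let ad (x y : P) : P := fun i => x i + y i.
Let op (x : P) : P := fun i => - x i.
Let mu (x y : P) : P := fun i => x i * y i.
Let pext (x y : P) : (forall i, x i = y i) -> x = y.
Proof. by move=> e; apply: functional_extensionality_dep. Qed.
Let adA : associative ad. Proof. by move=> x y t; apply: pext => i; exact: addrA. Qed.
Let adC : commutative ad. Proof. by move=> x y; apply: pext => i; exact: addrC. Qed.
Let ad0 : left_id z ad. Proof. by move=> x; apply: pext => i; exact: add0r. Qed.
Let adN : left_inverse z op ad. Proof. by move=> x; apply: pext => i; exact: addNr. Qed.
HB.instance Definition _ := GRing.isZmodule.Build P adA adC ad0 adN.
Let muA : associative mu. Proof. by move=> x y t; apply: pext => i; exact: mulrA. Qed.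
Let muC : commutative mu. Proof. by move=> x y; apply: pext => i; exact: mulrC. Qed.
Let mu1 : left_id o mu. Proof. by move=> x; apply: pext => i; exact: mul1r. Qed.
Let muD : left_distributive mu ad. Proof. by move=> x y t; apply: pext => i; exact: mulrDl. Qed.
Let nz : o != 0.
Proof.
by apply/eqP => /(congr1 (fun x : P => x i0)) e; move: (oner_neq0 (F i0)); rewrite -[1]/(o i0) e eqxx.
Qed.
HB.instance Definition _ := GRing.Zmodule_isComNzRing.Build P muA muC mu1 muD nz.

Definition fproj i (x : P) : F i := x i.
Let fproj_nmod i : nmod_morphism (fproj i). Proof. by []. Qed.
Let fproj_mon i : monoid_morphism (fproj i). Proof. by []. Qed.
HB.instance Definition _ i := GRing.isNmodMorphism.Build P (F i) (fproj i) (fproj_nmod i).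
HB.instance Definition _ i := GRing.isMonoidMorphism.Build P (F i) (fproj i) (fproj_mon i).

Section Diag.
Variables (R : pzRingType) (f : forall i, {rmorphism R -> F i}).
Definition fdiag (x : R) : P := fun i => f i x.
Let fdiag_nmod : nmod_morphism fdiag.
Proof. by split=> [|x y]; apply: pext => i; [exact: rmorph0|exact: rmorphD]. Qed.
Let fdiag_mon : monoid_morphism fdiag.
Proof. by split=> [|x y]; apply: pext => i; [exact: rmorph1|exact: rmorphM]. Qed.
HB.instance Definition _ := GRing.isNmodMorphism.Build R P fdiag fdiag_nmod.
HB.instance Definition _ := GRing.isMonoidMorphism.Build R P fdiag fdiag_mon.
End Diag.
End FieldProduct.

(* A field in which every polynomial over K splits: the quotient of the product
   of the splitting fields of all polynomials p by a maximal ideal containing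
   the families that vanish at all multiples of some p. *)
Lemma ex_universal_splitting_field (K : fieldType) :
  exists (E : fieldType) (i : {rmorphism K -> E}), forall p : {poly K}, p != 0 ->
    exists zs : seq E, map_poly i p = i (lead_coef p) *: \prod_(z <- zs) ('X - z%:P).
Proof.
pose Ty := {E : fieldType & ({rmorphism K -> E} * seq E)%type}.
have ex (p : {poly K}) : exists t : Ty, p != 0 ->
    map_poly (projT2 t).1 p = (projT2 t).1 (lead_coef p) *: \prod_(z <- (projT2 t).2) ('X - z%:P).
  have [->|p0] := eqVneq p 0; first by exists (existT _ K (idfun : {rmorphism K -> K}, [::])).
  by have [E [i [zs e]]] := ex_splitting_field p0; exists (existT _ E (i, zs)).
have {ex} [t ht] := choice ex.
pose F p := projT1 (t p).
pose i p : {rmorphism K -> F p} := (projT2 (t p)).1.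
pose P := @field_prod {poly K} F 1.
pose J (x : P) := exists p : {poly K}, p != 0 /\ forall q, q != 0 -> p %| q -> x q = 0.
have hJ : is_ideal (J : (P : comPzRingType) -> Prop).
  split.
  - by exists 1; rewrite oner_neq0.
  - move=> x y [p [p0 hx]] [q [q0 hy]]; exists (p * q); rewrite mulf_neq0 //; split=> // r r0 d.
    rewrite -[LHS]/(x r + y r) hx ?hy ?addr0 // (dvdp_trans _ d) //; [exact: dvdp_mull|exact: dvdp_mulr].
  - move=> a x [p [p0 hx]]; exists p; split=> // q q0 d.
    by rewrite -[LHS]/(a q * x q) hx // mulr0.
have J1 : ~ J (1 : P).
  move=> [p [p0 h]]; have := h p p0 (dvdpp p); rewrite -[LHS]/(1 : F p).
  by move/eqP; rewrite oner_eq0.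
have [E [j [j0 _]]] := ex_residue_field hJ J1.
pose d : {rmorphism K -> P} := @fdiag {poly K} 1 F K i.
pose jd : {rmorphism K -> E} := (j : {rmorphism (P : comPzRingType) -> E}) \o d.
exists E, jd => p p0.
(* Whenever [p] divides [q], it splits in [F q] with the same number of roots. The k-th roots for
   all these [q] form one element [rho k] of the product. *)
have rs q : exists rs : seq (F q), q != 0 -> p %| q -> size rs = (size p).-1 /\
    map_poly (i q) p = i q (lead_coef p) *: \prod_(z <- rs) ('X - z%:P).
  have [[q0 pq]|no] := pselect (q != 0 /\ p %| q); last first.
    by exists [::] => q0 pq; case: no.
  have := ht q q0; rewrite -/(F q) -[(projT2 (t q)).1]/(i q) => e.
  have : map_poly (i q) p %| \prod_(z <- (projT2 (t q)).2) ('X - z%:P).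
    have := pq; rewrite -(dvdp_map (i q)) e dvdpZr // fmorph_eq0 lead_coef_eq0 //.
  move=> /dvdp_prod_XsubC [m /eqpP [[a b] /= /andP[a0 b0] eab]].
  exists (mask m (projT2 (t q)).2) => _ _.
  have em : map_poly (i q) p = (a^-1 * b) *: \prod_(z <- mask m (projT2 (t q)).2) ('X - z%:P).
    by rewrite -scalerA -eab scalerA mulVf // scale1r.
  have ab0 : a^-1 * b != 0 by rewrite mulf_neq0 ?invr_eq0.
  have : size (map_poly (i q) p) = (size (mask m (projT2 (t q)).2)).+1.
    by rewrite em size_scale // size_prod_XsubC.
  rewrite size_map_poly => ->; split=> //.
  rewrite em -(lead_coef_map (i q)) em lead_coefZ.
  by rewrite (monicP (monic_prod_XsubC _ _ _)) mulr1.
pose r q := sval (cid (rs q)).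
have hr q : q != 0 -> p %| q -> size (r q) = (size p).-1 /\
    map_poly (i q) p = i q (lead_coef p) *: \prod_(z <- r q) ('X - z%:P).
  exact: (proj2_sig (cid (rs q))).
pose rho k : P := fun q => (r q)`_k.
pose D : {poly P} := map_poly d p -
  d (lead_coef p) *: \prod_(k < (size p).-1) ('X - (rho k)%:P).
have D0 : map_poly j D = 0.
  apply/polyP => k; rewrite coef_map coef0; apply: j0; exists p; split=> // q q0 pq.
  rewrite -[LHS]/(fproj q (D`_k)) -coef_map rmorphB /= map_polyZ /= -map_poly_comp.
  have [sz e] := hr q q0 pq.
  rewrite -[map_poly _ p]/(map_poly (i q) p) e -[fproj q _]/(i q (lead_coef p)).
  rewrite rmorph_prod /= (big_nth 0) big_mkord sz -scalerBr.
  rewrite [X in _ - X](eq_bigr (fun k : 'I_(size p).-1 => 'X - ((r q)`_k)%:P)).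
    by rewrite subrr scaler0 coef0.
  by move=> l _; rewrite map_polyXsubC.
exists [seq j (rho (k : 'I__)) | k <- enum 'I_((size p).-1)].
move: D0; rewrite /D rmorphB /= map_polyZ /= -map_poly_comp => /eqP.
rewrite subr_eq0 => /eqP ->; congr (_ *: _).
rewrite rmorph_prod /= big_map big_enum /=.
by apply: eq_bigr => k _; rewrite map_polyXsubC.
Qed.

Section AlgebraicElements.
Variables (K E : fieldType) (i : {rmorphism K -> E}).
Definition alg_pred : {pred E} := fun x => `[< algebraicOver i x >].
Fact alg_divring : divring_closed alg_pred.
Proof.
split=> [|x y|x y]; rewrite -!topredE /=.
- by apply/asboolP; exact: algebraic1.
- by move=> /asboolP hx /asboolP hy; apply/asboolP; exact: algebraic_sub.
- by move=> /asboolP hx /asboolP hy; apply/asboolP; exact: algebraic_div.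
Qed.
HB.instance Definition _ := GRing.isDivringClosed.Build E alg_pred alg_divring.
Record alg_elt := AlgElt { alg_val :> E; alg_valP : alg_val \in alg_pred }.
HB.instance Definition _ := [isSub for alg_val].
HB.instance Definition _ := [Choice of alg_elt by <:].
HB.instance Definition _ := [SubChoice_isSubIntegralDomain of alg_elt by <:].
HB.instance Definition _ := [SubIntegralDomain_isSubField of alg_elt by <:].
End AlgebraicElements.

(** The elements of [E] algebraic over [K] form an algebraically closed field: a root of a
    polynomial with such coefficients is algebraic over [K], and its annihilating polynomial over
    [K] already splits in [E]. *)
Lemma ex_closed_field (K : fieldType) :
  exists (F : closedFieldType) (i : {rmorphism K -> F}), True.
Proof.
have [E [i split_i]] := ex_universal_splitting_field K.
pose A : fieldType := alg_elt i.
have iA x : i x \in alg_pred i by apply/asboolP; exact: algebraic_id.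
pose a (x : K) : A := AlgElt (iA x).
have a_nmod : nmod_morphism a.
  by split=> [|x y]; apply: val_inj; rewrite /= ?rmorph0 ?rmorphD.
have a_mon : monoid_morphism a.
  by split=> [|x y]; apply: val_inj; rewrite /= ?rmorph1 ?rmorphM.
pose aA := GRing.isNmodMorphism.Build _ _ a a_nmod.
pose aM := GRing.isMonoidMorphism.Build _ _ a a_mon.
pose F : {rmorphism K -> A} := HB.pack a aA aM.
have algA (x : A) : algebraicOver F x.
  have /asboolP [p p0 rp] := alg_valP x; exists p => //.
  rewrite -(fmorph_root (val : {rmorphism A -> E})) -map_poly_comp.
  exact: rp.
have closed : GRing.closed_field_axiom A.
  move=> n P n0; pose h : {poly A} := 'X^n - \poly_(k < n) P k.
  have sP : (size (\poly_(k < n) P k)%R < size ('X^n : {poly A})%R)%N.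
    by rewrite size_polyXn ltnS size_poly.
  have sh : size h = n.+1 by rewrite size_polyDl ?size_polyN // size_polyXn.
  have mh : h \is monic.
    by rewrite monicE lead_coefDl ?size_polyN // lead_coefXn.
  have [E' [g [z hz]]] : exists (E' : fieldType) (g : {rmorphism A -> E'}) z, root (map_poly g h) z.
    by apply: (@ex_root_field A h); rewrite sh ltnS.
  have /integral_algebraic [p p0 rp] : integralOver (g \o F) z.
    apply: (integral_root_monic (p := map_poly g h)) => //; first by rewrite map_monic.
    move=> y /(nthP 0) [k _ <-]; rewrite coef_map; apply/integral_algebraic.
    have [q q0 rq] := algA h`_k; exists q => //.
    by rewrite map_poly_comp fmorph_root.
  have p_neq0 : p != 0 by exact: p0.
  have [zs e] := split_i p p_neq0.
  have zsA y : y \in zs -> y \in alg_pred i.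
    move=> yz; apply/asboolP; exists p => //; rewrite e rootZ ?fmorph_eq0 ?lead_coef_eq0 //.
    by rewrite root_prod_XsubC.
  have [ys eys] : exists ys : seq A, map val ys = zs.
    elim: zs zsA {e} => [|y zs IH] zsA; first by exists [::].
    have [ys <-] : exists ys : seq A, map val ys = zs.
      by apply: IH => t tz; apply: zsA; rewrite inE tz orbT.
    by exists (AlgElt (zsA y (mem_head _ _)) :: ys).
  have eA : map_poly F p = F (lead_coef p) *: \prod_(y <- ys) ('X - y%:P).
    apply: (map_poly_inj (val : {rmorphism A -> E})).
    rewrite -map_poly_comp map_polyZ rmorph_prod /= -eys big_map in e *.
    rewrite [LHS]e; congr (_ *: _); apply: eq_bigr => y _.
    by symmetry; exact: (map_polyXsubC (val : {rmorphism A -> E}) y).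
  have : root (map_poly g (map_poly F p)) z by rewrite -map_poly_comp.
  rewrite eA map_polyZ rootZ ?fmorph_eq0 ?lead_coef_eq0 // rmorph_prod /=.
  under eq_bigr do rewrite map_polyXsubC.
  rewrite -(big_map g xpredT (fun y => 'X - y%:P)) root_prod_XsubC => /mapP [y _ zy].
  exists y; move: hz; rewrite zy fmorph_root rootE /h !hornerE subr_eq0 => /eqP ->.
  by rewrite horner_poly.
pose cl := Field_isAlgClosed.Build A closed.
pose C : closedFieldType := HB.pack (GRing.Field.sort A) (GRing.Field.class A) cl.
have p1 : @nmod_morphism K C F by split; [exact: rmorph0|exact: rmorphD].
have p2 : @monoid_morphism K C F by split; [exact: rmorph1|exact: rmorphM].
pose pA := GRing.isNmodMorphism.Build K C F p1.
pose pM := GRing.isMonoidMorphism.Build K C F p2.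
pose FF : {rmorphism K -> C} := HB.pack (F : K -> C) pA pM.
by exists C, FF.
Qed.

(** * Polynomial expressions and polynomial rings *)

Lemma peval_hom (B : comPzRingType) n (R S : alg B) (f : ahom R S) (v : 'I_n -> R) e :
  f (peval v e) = peval (fun i => f (v i)) e.
Proof.
elim: e => [i|b|e1 IH1 e2 IH2|e1 IH1 e2 IH2] //=; first exact: ahomE.
  by rewrite rmorphD IH1 IH2.
by rewrite rmorphM IH1 IH2.
Qed.

Lemma eq_peval (B : comPzRingType) n (R : alg B) (v w : 'I_n -> R) e :
  (forall i, v i = w i) -> peval v e = peval w e.
Proof. by move=> vw; elim: e => [i|b|e1 IH1 e2 IH2|e1 IH1 e2 IH2] //=; rewrite IH1 IH2. Qed.

Fixpoint pexpr_map (B B' : Type) (f : B -> B') n (e : pexpr B n) : pexpr B' n :=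
  match e with
  | PVar i => PVar i
  | PCst b => PCst (f b)
  | PAdd e1 e2 => PAdd (pexpr_map f e1) (pexpr_map f e2)
  | PMul e1 e2 => PMul (pexpr_map f e1) (pexpr_map f e2)
  end.

Lemma peval_map (B B' : comPzRingType) (f : {rmorphism B -> B'}) n (R : alg B')
    (v : 'I_n -> R) e :
  peval v (pexpr_map f e) = peval (R := res f R) v e.
Proof. by elim: e => [i|b|e1 IH1 e2 IH2|e1 IH1 e2 IH2] //=; rewrite IH1 IH2. Qed.

Lemma pderiv_map (B B' : comPzRingType) (f : {rmorphism B -> B'}) n j (e : pexpr B n) :
  pderiv j (pexpr_map f e) = pexpr_map f (pderiv j e).
Proof.
elim: e => [i|b|e1 IH1 e2 IH2|e1 IH1 e2 IH2] //=; first by rewrite rmorph_nat.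
- by rewrite rmorph0.
- by rewrite IH1 IH2.
- by rewrite IH1 IH2.
Qed.

Fixpoint psubst (B : Type) n m (w : 'I_n -> pexpr B m) (e : pexpr B n) : pexpr B m :=
  match e with
  | PVar i => w i
  | PCst b => PCst b
  | PAdd e1 e2 => PAdd (psubst w e1) (psubst w e2)
  | PMul e1 e2 => PMul (psubst w e1) (psubst w e2)
  end.

Lemma peval_subst (B : comPzRingType) n m (R : alg B) (v : 'I_m -> R)
    (w : 'I_n -> pexpr B m) e :
  peval v (psubst w e) = peval (fun i => peval v (w i)) e.
Proof. by elim: e => [i|b|e1 IH1 e2 IH2|e1 IH1 e2 IH2] //=; rewrite IH1 IH2. Qed.

Definition popp (B : comPzRingType) n (e : pexpr B n) : pexpr B n := PMul (PCst (-1)) e.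
Definition psum (B : comPzRingType) n (I : Type) (r : seq I) (F : I -> pexpr B n) :
  pexpr B n := foldr (fun i e => PAdd (F i) e) (PCst 0) r.

Lemma peval_opp (B : comPzRingType) n (R : alg B) (v : 'I_n -> R) e :
  peval v (popp e) = - peval v e.
Proof. by rewrite /= rmorphN rmorph1 mulN1r. Qed.

Lemma peval_sum (B : comPzRingType) n (R : alg B) (v : 'I_n -> R) I (r : seq I) F :
  peval v (psum r F) = \sum_(i <- r) peval v (F i).
Proof.
elim: r => [|i r IH] /=; first by rewrite big_nil rmorph0.
by rewrite big_cons IH.
Qed.

(** Iterated univariate polynomials, so that statements on n variables follow by induction; the
    variable [ord0] is the outermost one. *)
Fixpoint Pn (Q : comNzRingType) (n : nat) : comNzRingType :=
  if n is n'.+1 then {poly (Pn Q n')} else Q.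

Fixpoint Pcst (Q : comNzRingType) (n : nat) : {rmorphism Q -> Pn Q n} :=
  match n return {rmorphism Q -> Pn Q n} with
  | 0 => idfun
  | n'.+1 => (polyC : {rmorphism Pn Q n' -> {poly (Pn Q n')}}) \o Pcst Q n'
  end.

Fixpoint Pvar (Q : comNzRingType) (n : nat) : 'I_n -> Pn Q n :=
  match n return 'I_n -> Pn Q n with
  | 0 => fun=> 0
  | n'.+1 => fun i =>
     if unlift ord0 i is Some j then (Pvar Q j)%:P : {poly (Pn Q n')} else 'X
  end.
Arguments Pvar Q {n} i.

Fixpoint Pmap (Q Q' : comNzRingType) (f : {rmorphism Q -> Q'}) (n : nat) :
    {rmorphism Pn Q n -> Pn Q' n} :=
  match n return {rmorphism Pn Q n -> Pn Q' n} with
  | 0 => f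
  | n'.+1 => map_poly (Pmap f n') : {rmorphism {poly (Pn Q n')} -> {poly (Pn Q' n')}}
  end.

Definition Palg (Q : comNzRingType) n : alg Q := @Alg Q (Pn Q n) (Pcst Q n).

Lemma Pmap_cst (Q Q' : comNzRingType) (f : {rmorphism Q -> Q'}) n q : Pmap f n (Pcst Q n q) = Pcst Q' n (f q).
Proof. by elim: n => [|n IH] //=; rewrite map_polyC /= IH. Qed.

Lemma Pmap_var (Q Q' : comNzRingType) (f : {rmorphism Q -> Q'}) n (i : 'I_n) : Pmap f n (Pvar Q i) = Pvar Q' i.
Proof.
elim: n i => [[]|n IH i] //=; case: unliftP => [j _|_].
  by rewrite map_polyC /= IH.
by rewrite map_polyX.
Qed.

Lemma Pmap_inj (Q Q' : comNzRingType) (f : {rmorphism Q -> Q'}) n : injective f -> injective (Pmap f n).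
Proof.
move=> fi; elim: n => [|n IH] //= p q /polyP e; apply/polyP => k.
by apply: IH; rewrite -!coef_map e.
Qed.

Definition Pev (Q : comNzRingType) n (e : pexpr Q n) : Pn Q n :=
  peval (R := Palg Q n) (fun i => Pvar Q i) e.

Lemma Pmap_ev (Q Q' : comNzRingType) (f : {rmorphism Q -> Q'}) n (e : pexpr Q n) :
  Pmap f n (Pev e) = Pev (pexpr_map f e).
Proof.
rewrite /Pev peval_map.
pose h : ahom (Palg Q n) (res f (Palg Q' n)) :=
  @AHom Q (Palg Q n) (res f (Palg Q' n)) (Pmap f n) (fun b => Pmap_cst f n b).
rewrite -[LHS]/(h _) peval_hom.
by apply: (@eq_peval _ _ (res f (Palg Q' n))) => i; exact: Pmap_var.
Qed.

Definition pexpr_up (B : Type) n (e : pexpr B n) : pexpr B n.+1 :=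
  psubst (fun i : 'I_n => PVar (lift ord0 i : 'I_n.+1)) e.

Lemma Pev_up (Q : comNzRingType) n (e : pexpr Q n) :
  Pev (pexpr_up e) = (Pev e)%:P :> {poly Pn Q n}.
Proof.
rewrite /Pev; elim: e => [i|b|e1 IH1 e2 IH2|e1 IH1 e2 IH2] //=.
- by rewrite liftK.
- by rewrite IH1 IH2 rmorphD.
- by rewrite IH1 IH2 rmorphM.
Qed.

Lemma pexpr_map_up (B B' : Type) (f : B -> B') n (e : pexpr B n) :
  pexpr_map f (pexpr_up e) = pexpr_up (pexpr_map f e).
Proof.
rewrite /pexpr_up; elim: e => [i|b|e1 IH1 e2 IH2|e1 IH1 e2 IH2] //=.
  by rewrite IH1 IH2.
by rewrite IH1 IH2.
Qed.

Lemma Pev_surj (Q : comNzRingType) n (x : Pn Q n) : exists e, Pev e = x.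
Proof.
elim: n x => [|n IH] x; first by exists (PCst x).
elim/poly_ind: x => [|p c [e he]]; first by exists (PCst 0); rewrite /Pev /= rmorph0.
have [f hf] := IH c.
exists (PAdd (PMul e (PVar ord0)) (pexpr_up f)).
by rewrite -hf -Pev_up -he /Pev /= unlift_none.
Qed.

Lemma pack_rmorphism (R S : comPzRingType) (f : R -> S) :
  nmod_morphism f -> monoid_morphism f ->
  exists g : {rmorphism R -> S}, forall x, g x = f x.
Proof.
move=> fn fm.
pose fA := GRing.isNmodMorphism.Build _ _ f fn.
pose fM := GRing.isMonoidMorphism.Build _ _ f fm.
by exists (HB.pack f fA fM : {rmorphism R -> S}).
Qed.

Lemma Pn_eval (Q : comNzRingType) n (R : alg Q) (v : 'I_n -> R) : (1 : R) <> 0 ->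
  exists h : ahom (Palg Q n) R, forall i, h (Pvar Q i) = v i.
Proof.
move=> /eqP nz; pose nzm := GRing.PzSemiRing_isNonZero.Build R nz.
pose S : comNzRingType :=
  HB.pack (GRing.ComPzRing.sort R) (GRing.ComPzRing.class R) nzm.
have [f fE] : exists f : {rmorphism Q -> S}, forall x, f x = str R x.
  by apply: (@pack_rmorphism Q S); split; [exact: rmorph0|exact: rmorphD|exact: rmorph1|exact: rmorphM].
have [h [hc hv]] : exists h : {rmorphism Pn Q n -> S},
    (forall q, h (Pcst Q n q) = f q) /\ forall i, h (Pvar Q i) = v i.
  elim: n v => [|n IH] v; first by exists f; split=> // -[].
  have [h [hc hv]] := IH (fun i => v (lift ord0 i)).
  have cv : commr_rmorph h (v ord0) by move=> x; exact: mulrC.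
  exists (horner_morph cv); split=> [q|i] /=; first by rewrite horner_morphC hc.
  case: unliftP => [j ->|->]; first by rewrite horner_morphC hv.
  by rewrite horner_morphX.
have [g gE] : exists g : {rmorphism Pn Q n -> R}, forall x, g x = h x.
  by apply: pack_rmorphism; split; [exact: rmorph0|exact: rmorphD|exact: rmorph1|exact: rmorphM].
have gb b : g (str (Palg Q n) b) = str R b by rewrite gE -fE -hc.
by exists (@AHom Q (Palg Q n) R g gb) => i /=; rewrite gE hv.
Qed.

Lemma zero_ring_eq (R : comPzRingType) (x y : R) : (1 : R) = 0 -> x = y.
Proof. by move=> e; rewrite -(mulr1 x) -(mulr1 y) e !mulr0. Qed.

(** A relation with polynomial coefficients is a family of relations between constants, one for each
    monomial, so a transfer of scalar relations extends to polynomials. *)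
Lemma Pn_relation (Q Q1 Q2 : comNzRingType) (i : {rmorphism Q -> Q1})
    (j : {rmorphism Q -> Q2}) (I : finType) (m : I -> Q1) (k : I -> Q2) :
  (forall q : I -> Q, \sum_s m s * i (q s) = 0 -> \sum_s k s * j (q s) = 0) ->
  forall n (c : I -> Pn Q n),
    \sum_s Pcst Q1 n (m s) * Pmap i n (c s) = 0 ->
    \sum_s Pcst Q2 n (k s) * Pmap j n (c s) = 0.
Proof.
move=> H; elim=> [|n IH] c /=; first exact: H.
move=> /polyP e; apply/polyP => l; rewrite coef0 coef_sum.
under eq_bigr do rewrite coefCM coef_map.
apply: IH; rewrite -[RHS](coef0 _ l) -e coef_sum.
by apply: eq_bigr => s _; rewrite coefCM coef_map.
Qed.

Fixpoint Pcoefs (Q : comNzRingType) (N : Q -> Prop) n : Pn Q n -> Prop :=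
  match n return Pn Q n -> Prop with
  | 0 => N
  | n'.+1 => fun p : {poly (Pn Q n')} => forall l, Pcoefs N p`_l
  end.

Lemma Pcoefs_ideal (Q : comNzRingType) (N : Q -> Prop) n :
  is_ideal N -> is_ideal (R := Pn Q n) (@Pcoefs Q N n).
Proof.
move=> hN; elim: n => [|n IH] //=; split.
- by move=> l; rewrite coef0; exact: (ideal0 IH).
- by move=> x y hx hy l; rewrite coefD; exact: (idealD IH).
- move=> a x hx l; rewrite coefM; apply: (ideal_sum _ IH) => k _.
  exact: (idealM IH).
Qed.

Lemma Pcoefs_cst (Q : comNzRingType) (N : Q -> Prop) n q : N 0 -> N q -> Pcoefs N (Pcst Q n q).
Proof.
move=> N0 Nq; elim: n => [|n IH] //= l; rewrite coefC; case: eqP => // _.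
by elim: n {IH} => [|n IH] //= k; rewrite coef0.
Qed.

Lemma Pcoefs_ann (Q : comNzRingType) (a : Q) n (p : Pn Q n) :
  Pcoefs (fun q => a * q = 0) p <-> Pcst Q n a * p = 0.
Proof.
elim: n p => [|n IH] p //=; split=> h.
  by apply/polyP => l; rewrite coefCM coef0; apply/IH.
by move=> l; apply/IH; rewrite -coefCM h coef0.
Qed.

Lemma Pcoefs_sub (Q : comNzRingType) (N1 N2 : Q -> Prop) n (p : Pn Q n) :
  (forall q, N1 q -> N2 q) -> Pcoefs N1 p -> Pcoefs N2 p.
Proof. by move=> h; elim: n p => [|n IH] p /=; [exact: h|move=> hp l; exact: IH]. Qed.

Lemma Pcoefs_map (Q Q' : comNzRingType) (f : {rmorphism Q -> Q'}) (N : Q -> Prop)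
    (N' : Q' -> Prop) n (p : Pn Q n) :
  (forall q, N q -> N' (f q)) -> Pcoefs N p -> Pcoefs N' (Pmap f n p).
Proof.
move=> h; elim: n p => [|n IH] p /=; first exact: h.
by move=> hp l; rewrite coef_map; exact: IH.
Qed.

Lemma Pcoefs_ker (Q Q' : comNzRingType) (f : {rmorphism Q -> Q'}) n (p : Pn Q n) :
  Pmap f n p = 0 -> Pcoefs (fun q => f q = 0) p.
Proof.
elim: n p => [|n IH] p //= /polyP h l; apply: IH.
by rewrite -(coef_map (Pmap f n)) h coef0.
Qed.

Lemma Pcoefs_and (Q : comNzRingType) (N1 N2 : Q -> Prop) n (p : Pn Q n) :
  Pcoefs N1 p -> Pcoefs N2 p -> Pcoefs (fun q => N1 q /\ N2 q) p.
Proof. by elim: n p => [|n IH] p //= h1 h2 l; exact: IH. Qed.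

Section Expansion.
Variables (k0 : comPzRingType) (Q : comNzRingType) (f : {rmorphism k0 -> Q}).
Variable N : Q -> Prop.

(** The coefficients, all in [N], are split off from expressions defined over the small ring [k0].
    Such expressions make sense over every ring under [k0]. *)
Definition Pexpansion n (p : Pn Q n) := exists (r : nat) (a : 'I_r -> Q)
  (m : 'I_r -> pexpr k0 n),
  (forall s, N (a s)) /\ p = \sum_s Pcst Q n (a s) * Pev (pexpr_map f (m s)).

Lemma Pexpansion_sum n (I : Type) (r : seq I) (F : I -> Pn Q n) :
  (forall i, Pexpansion (F i)) -> Pexpansion (\sum_(i <- r) F i).
Proof.
move=> hF; apply: (big_ind (@Pexpansion n)) => //.
  by exists 0, (fun=> 0), (fun=> PCst 0); split=> [[]//|]; rewrite big_ord0.
move=> _ _ [r1 [a1 [m1 [N1 ->]]]] [r2 [a2 [m2 [N2 ->]]]].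
exists (r1 + r2)%N, (fun s => match split s with inl i => a1 i | inr j => a2 j end),
  (fun s => match split s with inl i => m1 i | inr j => m2 j end); split.
  by move=> s; case: split.
rewrite big_split_ord /=; congr (_ + _); apply: eq_bigr => s _.
  by rewrite (unsplitK (inl s : 'I_r1 + 'I_r2)%type).
by rewrite (unsplitK (inr s : 'I_r1 + 'I_r2)%type).
Qed.

Lemma Pcoefs_expand n (p : Pn Q n) : Pcoefs N p -> Pexpansion p.
Proof.
elim: n p => [|n IH] p Np.
  exists 1, (fun=> p), (fun=> PCst 1); split=> //.
  by rewrite big_ord1 /Pev /= rmorph1 mulr1.
rewrite -[p]coefK poly_def; apply: Pexpansion_sum => l.
have [r [a [m [Na ->]]]] := IH _ (Np l).
pose up (d : nat) (e : pexpr k0 n) : pexpr k0 n.+1 :=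
  iter d (fun e => PMul e (PVar ord0)) (pexpr_up e).
have upE d e : Pev (pexpr_map f (up d e)) = (Pev (pexpr_map f e))%:P * 'X^d :> {poly Pn Q n}.
  elim: d => [|d IHd]; first by rewrite expr0 mulr1 /up /= pexpr_map_up Pev_up.
  by rewrite exprSr mulrA -IHd /Pev /= unlift_none.
exists r, a, (fun s => up l (m s)); split=> //.
rewrite -mul_polyC rmorph_sum mulr_suml; apply: eq_bigr => s _ /=.
by rewrite upE rmorphM -mulrA.
Qed.

End Expansion.

(** * Noetherian rings *)

(** The ascending chain condition in terms of generators: in every sequence some term lies in the
    ideal generated by its predecessors. *)
Definition noetherian (R : comPzRingType) := forall s : nat -> R,
  exists (n : nat) (c : 'I_n -> R), s n = \sum_(i < n) c i * s i.

Lemma noetherian_field (K : fieldType) : noetherian K.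
Proof.
move=> s; have [s0|s0] := eqVneq (s 0) 0.
  by exists 0, (fun=> 0); rewrite big_ord0.
by exists 1, (fun=> s 1 / s 0); rewrite big_ord1 divfK.
Qed.

Lemma noetherian_surj (R S : comPzRingType) (f : {rmorphism R -> S}) :
  (forall y, exists x, f x = y) -> noetherian R -> noetherian S.
Proof.
move=> surj hR s; have [t ht] := choice (fun n => surj (s n)).
have [n [c e]] := hR t; exists n, (fun i => f (c i)).
rewrite -ht e rmorph_sum; apply: eq_bigr => i _.
by rewrite rmorphM ht.
Qed.

(** Hilbert's basis theorem. If no [s n] depends on its predecessors, polynomials [f k] of least
    degree in [J] outside the ideal of the earlier choices can be picked forever; a relation between
    their leading coefficients contradicts minimality. *)
Lemma noetherian_poly (R : comNzRingType) : noetherian R -> noetherian {poly R}.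
Proof.
move=> hR s; apply: contrapT => no.
pose J := span (R := {poly R}) (fun x => exists i, x = s i).
pose Jn n := span (R := {poly R}) (fun x => exists2 i : nat, (i < n)%N & x = s i).
have JnE n x : Jn n x -> exists c : 'I_n -> {poly R}, x = \sum_(i < n) c i * s i.
  move=> h; apply: (@span_range _ n (fun i => s i)).
  apply: span_min h; first exact: span_ideal.
  by move=> _ [i lt ->]; apply: span_mem; exists (Ordinal lt).
have sn n : ~ Jn n (s n) by move=> /JnE [c e]; apply: no; exists n, c.
have Jmono m n x : (m <= n)%N -> Jn m x -> Jn n x.
  move=> le; apply: span_min; first exact: span_ideal.
  by move=> _ [i lt ->]; apply: span_mem; exists i => //; exact: leq_trans le.
have JJn x : J x -> exists n, Jn n x.
  elim=> [|a _ y [i ->] _ [n hn]]; first by exists 0%N; exact: span0.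
  exists (maxn i.+1 n); apply: (idealD (span_ideal _)).
    apply: (idealM (span_ideal _)); apply: span_mem; exists i => //.
    by rewrite leq_max leqnn.
  by apply: Jmono hn; rewrite leq_max leqnn orbT.
pose L (l : seq {poly R}) := span (fun x => x \in l).
(* A finite list in [J] lies in some [Jn n], and [s n] is then an element of [J] outside its ideal;
   this makes a choice of least size possible. *)
have pick (l : seq {poly R}) : exists f, (forall x, x \in l -> J x) ->
    [/\ J f, ~ L l f & forall g, J g -> ~ L l g -> (size f <= size g)%N].
  have [lJ|] := pselect (forall x, x \in l -> J x); last by exists 0.
  have [n ln] : exists n, forall x, x \in l -> Jn n x.
    elim: l lJ => [|y l IH] lJ; first by exists 0.
    have [x xl|n hn] := IH; first by apply: lJ; rewrite inE xl orbT.
    have [m hm] := JJn _ (lJ y (mem_head _ _)); exists (maxn m n) => x.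
    rewrite inE => /predU1P [->|xl]; first by apply: Jmono hm; rewrite leq_maxl.
    by apply: Jmono (hn _ xl); rewrite leq_maxr.
  have ex : exists d, `[< exists g, [/\ J g, ~ L l g & size g = d] >].
    exists (size (s n)); apply/asboolP; exists (s n); split=> //.
      by apply: span_mem; exists n.
    by move=> h; apply: (sn n); apply: span_min h => //; exact: span_ideal.
  case: (ex_minnP ex) => d /asboolP [f [Jf Lf <-]] mn; exists f => _; split=> //.
  by move=> g Jg Lg; apply: mn; apply/asboolP; exists g.
have [F hF] := choice pick.
pose l := fix l k := if k is k'.+1 then rcons (l k') (F (l k')) else [::].
pose f k : {poly R} := F (l k).
have lS k : l k.+1 = rcons (l k) (f k) by [].
have mem_l k x : x \in l k <-> exists2 i, (i < k)%N & x = f i.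
  elim: k x => [|k IH] x; first by split=> // -[].
  rewrite lS mem_rcons in_cons; split=> [/orP [/eqP ->|h]|[i]].
  - by exists k.
  - by have [i lt ->] := iffLR (IH x) h; exists i => //; exact: ltnW.
  - rewrite ltnS leq_eqVlt => /predU1P [-> ->|lt xE]; first by rewrite eqxx.
    by apply/orP; right; apply/IH; exists i.
have lJ k x : x \in l k -> J x.
  elim: k x => [|k IH] x //; rewrite lS mem_rcons in_cons => /orP [/eqP ->|]; last exact: IH.
  by have [] := hF (l k) (IH).
have fJ k : J (f k) by have [] := hF (l k) (@lJ k).
have fL k : ~ L (l k) (f k) by have [] := hF (l k) (@lJ k).
have fmin k g : J g -> ~ L (l k) g -> (size (f k) <= size g)%N.
  by have [_ _] := hF (l k) (@lJ k); apply.
have Lmono m n x : (m <= n)%N -> L (l m) x -> L (l n) x.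
  move=> le; apply: span_min; first exact: span_ideal.
  move=> y /mem_l [i lt ->]; apply: span_mem; apply/mem_l; exists i => //.
  exact: leq_trans le.
have smono m n : (m <= n)%N -> (size (f m) <= size (f n))%N.
  by move=> le; apply: fmin => // /(Lmono _ _ _ le); exact: fL.
have [n [c e]] := hR (fun k => lead_coef (f k)).
have f0 : f n != 0 by apply/eqP => f0; apply: (fL n); rewrite f0; exact: span0.
(* [h] lies in the ideal of the earlier choices and has the leading term of [f n], so that [f n - h]
   is smaller than [f n] and still outside that ideal. *)
pose h : {poly R} := \sum_(i < n) (c i *: 'X^(size (f n) - size (f i))) * f i.
have Lh : L (l n) h.
  apply: ideal_sum; first exact: span_ideal.
  move=> i _; apply: (idealM (span_ideal _)); apply: span_mem; apply/mem_l.
  by exists i.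
have : (size (f n) <= size (f n - h : {poly R})%R)%N.
  apply: fmin.
    have hJ : is_ideal J by exact: span_ideal.
    have Jh : J h by apply: span_min Lh => //; exact: lJ.
    exact: (idealD hJ (fJ n) (idealN hJ Jh)).
  move=> Lfh; apply: (fL n); rewrite -(subrK h (f n)).
  by have hL : is_ideal (L (l n)) by [exact: span_ideal]; exact: (idealD hL).
apply/negP; rewrite -ltnNge.
have fn1 : size (f n) = (size (f n)).-1.+1 by rewrite prednK // size_poly_gt0.
rewrite fn1 ltnS; apply/leq_sizeP => j le.
rewrite coefB /h coef_sum.
have E (i : 'I_n) : ((c i *: 'X^(size (f n) - size (f i))) * f i)`_j =
    c i * (f i)`_(j - (size (f n) - size (f i))).
  rewrite -scalerAl coefZ coefXnM; case: ltnP => // lt.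
  have fi : (size (f i) <= size (f n))%N by apply: smono; exact: ltnW.
  have fi0 : (0 < size (f i))%N.
    rewrite size_poly_gt0; apply/eqP => fi0; apply: (fL i); rewrite fi0; exact: span0.
  by exfalso; move: lt le fi0; lia.
under eq_bigr do rewrite E.
move: le; rewrite leq_eqVlt => /orP [/eqP <-|lt].
  rewrite -lead_coefE e; apply/eqP; rewrite subr_eq0; apply/eqP.
  apply: eq_bigr => i _.
  have fi0 : (0 < size (f i))%N.
    rewrite size_poly_gt0; apply/eqP => fi0; apply: (fL i); rewrite fi0; exact: span0.
  have fi := smono i n (ltnW (ltn_ord i)).
  have -> : ((size (f n)).-1 - (size (f n) - size (f i)))%N = (size (f i)).-1 by lia.
  by rewrite -lead_coefE.
rewrite nth_default; last by rewrite fn1.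
rewrite big1 ?subr0 // => i _; rewrite nth_default ?mulr0 //.
have jn : (size (f n) <= j)%N by rewrite fn1.
by apply: leq_trans (leq_sub2r _ jn); rewrite subKn // smono // ltnW.
Qed.

Lemma noetherian_Pn (Q : comNzRingType) n : noetherian Q -> noetherian (Pn Q n).
Proof. by move=> hQ; elim: n => [|n IH] //=; exact: noetherian_poly. Qed.

(** [S] is the subalgebra generated by the [v], realized as the polynomial ring modulo the kernel of
    evaluation. *)
Lemma ex_noetherian_subring (k : fieldType) (Q : comNzRingType) (f : {rmorphism k -> Q})
    n (v : 'I_n -> Q) :
  exists (S : comNzRingType) (i : {rmorphism S -> Q}) (g : {rmorphism k -> S}),
    [/\ noetherian S, injective i, forall x, i (g x) = f x & forall s, exists x, i x = v s].
Proof.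
have [h hv] := @Pn_eval k n (@Alg k Q f) v (elimN eqP (oner_neq0 Q)).
have [S [pi [surj ker]]] := ex_ideal_quotient (rker_ideal h).
have nz : (1 : S) != 0.
  by apply/eqP => /esym; rewrite -(rmorph1 pi) => /esym/ker/eqP; rewrite rmorph1 oner_eq0.
pose nzm := GRing.PzSemiRing_isNonZero.Build S nz.
pose T : comNzRingType := HB.pack (GRing.ComPzRing.sort S) (GRing.ComPzRing.class S) nzm.
have [s hs] := choice surj.
have piE x y : pi x = pi y <-> h x = h y.
  split=> /eqP; rewrite -subr_eq0 -rmorphB => /eqP e; apply/eqP; rewrite -subr_eq0 -rmorphB; apply/eqP.
    exact/ker.
  exact/ker.
have [i hi] : exists i : {rmorphism T -> Q}, forall x, i (pi x) = h x.
  have E x : h (s (pi x)) = h x by apply/piE; rewrite hs.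
  have [| |i hi] := @pack_rmorphism T Q (fun y => h (s y)).
  - split=> [|x y]; first by rewrite -(rmorph0 h); apply/piE; rewrite hs rmorph0.
    by rewrite -rmorphD; apply/piE; rewrite rmorphD !hs.
  - split=> [|x y]; first by rewrite -(rmorph1 h); apply/piE; rewrite hs rmorph1.
    by rewrite -rmorphM; apply/piE; rewrite rmorphM !hs.
  by exists i => x; rewrite hi E.
have [g hg] : exists g : {rmorphism k -> T}, forall x, g x = pi (Pcst k n x).
  apply: (@pack_rmorphism k T).
    by split=> [|x y]; rewrite ?rmorph0 // !rmorphD.
  by split=> [|x y]; rewrite ?rmorph1 // !rmorphM.
exists T, i, g; split.
- apply: (noetherian_surj (f := pi : {rmorphism (Pn k n : comPzRingType) -> (T : comPzRingType)})) => //.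
  exact/noetherian_Pn/noetherian_field.
- move=> x y; have [a <-] := surj x; have [b <-] := surj y.
  by rewrite !hi => /piE.
- by move=> x; rewrite hg hi (ahomE h).
- by move=> j; exists (pi (Pvar k j)); rewrite hi hv.
Qed.

(** * Newton's method and flatness of smooth algebras *)

(** The m-th power of the ideal generated by [G], in a form suited to induction. *)
Inductive ipow (R : comPzRingType) (G : R -> Prop) : nat -> R -> Prop :=
  | ipow_all x : ipow G 0 x
  | ipow0 m : ipow G m 0
  | ipow_add m x y : ipow G m x -> ipow G m y -> ipow G m (x + y)
  | ipow_mul m g x : G g -> ipow G m x -> ipow G m.+1 (g * x).

Section IdealPowers.
Variables (R : comPzRingType) (G : R -> Prop).

Lemma ipow_ideal m : is_ideal (ipow G m).
Proof.
split; [exact: ipow0|exact: ipow_add|].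
move=> a x; elim=> {m x} [x|m|m x y _ hx _ hy|m g x Gg _ hx].
- exact: ipow_all.
- by rewrite mulr0; exact: ipow0.
- by rewrite mulrDr; exact: ipow_add.
- by rewrite mulrCA; exact: ipow_mul.
Qed.

Lemma ipowM m n x y : ipow G m x -> ipow G n y -> ipow G (m + n) (x * y).
Proof.
move=> hx hy; elim: hx => {m x} [x|m|m x x' _ IH _ IH'|m g x Gg _ IH].
- exact: (idealM (ipow_ideal n)).
- by rewrite mul0r; exact: ipow0.
- by rewrite mulrDl; exact: ipow_add.
- by rewrite -mulrA; exact: ipow_mul.
Qed.

Lemma ipow_step k x : ipow G k.+1 x -> ipow G k x.
Proof.
move El: k.+1 => l h; elim: h k El => {l x} [x|m|m x y _ IHx _ IHy|m g x Gg hx _] k //.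
- by move=> _; exact: ipow0.
- by move=> e; apply: ipow_add; [exact: IHx|exact: IHy].
- by case=> ->; exact: (idealM (ipow_ideal _)).
Qed.

Lemma ipowW m n x : (n <= m)%N -> ipow G m x -> ipow G n x.
Proof.
move=> /subnK <-; elim: (m - n)%N => [//|d IH] h; exact: IH (ipow_step h).
Qed.

Lemma ipow1E x : ipow G 1 x <-> span G x.
Proof.
split; last first.
  elim=> [|a u v Gu _ IH]; first exact: ipow0.
  by apply: ipow_add => //; rewrite mulrC; apply: ipow_mul => //; exact: ipow_all.
move El: 1%N => l h; elim: h El => {l x} [x|m|m x y _ IHx _ IHy|m g x Gg _ _] //.
- by move=> _; exact: span0.
- by move=> e; apply: (idealD (span_ideal _)); [exact: IHx|exact: IHy].
- by move=> _; apply: (idealMr _ (span_ideal _)); exact: span_mem.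
Qed.

Lemma ipow_sum m (I : Type) (r : seq I) (F : I -> R) :
  (forall i, ipow G m (F i)) -> ipow G m (\sum_(i <- r) F i).
Proof. by move=> h; apply: ideal_sum => //; exact: ipow_ideal. Qed.

Lemma ipowB m x y : ipow G m x -> ipow G m y -> ipow G m (x - y).
Proof.
by move=> hx hy; apply: ipow_add => //; apply: idealN => //; exact: ipow_ideal.
Qed.

End IdealPowers.

Section Newton.
Variables (Q : comPzRingType) (R : alg Q) (G : R -> Prop) (n : nat).
Implicit Types (v d : 'I_n -> R) (e : pexpr Q n).

Lemma peval_taylor v d m e : (forall j, ipow G m (d j)) ->
  ipow G (m + m) (peval (fun j => v j + d j) e - peval v e
                  - \sum_j d j * peval v (pderiv j e)).
Proof.
move=> hd; elim: e => [i|b|e1 IH1 e2 IH2|e1 IH1 e2 IH2] /=.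
- rewrite (bigD1 i) //= eqxx rmorph1 mulr1 big1 ?addr0; last first.
    by move=> j /negbTE nij; rewrite eq_sym nij rmorph0 mulr0.
  by rewrite [v i + d i]addrC addrK subrr; exact: ipow0.
- by rewrite subrr big1 ?subr0; [exact: ipow0|move=> j _; rewrite rmorph0 mulr0].
- under eq_bigr do rewrite mulrDr.
  rewrite big_split /=; move: (ipow_add IH1 IH2); congr (ipow G _ _); ring.
- set a' := peval _ e1 in IH1 *; set b' := peval _ e2 in IH2 *.
  set a := peval _ e1 in IH1 *; set b := peval _ e2 in IH2 *.
  have -> : \sum_j d j * (peval v (pderiv j e1) * b + a * peval v (pderiv j e2)) =
    b * (\sum_j d j * peval v (pderiv j e1)) + a * (\sum_j d j * peval v (pderiv j e2)).
    by rewrite !mulr_sumr -big_split /=; apply: eq_bigr => j _; ring.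
  set A := \sum_j d j * peval v (pderiv j e1) in IH1 *.
  set C := \sum_j d j * peval v (pderiv j e2) in IH2 *.
  have hA : ipow G m A by apply: ipow_sum => j; apply: idealMr => //; exact: ipow_ideal.
  have hC : ipow G m C by apply: ipow_sum => j; apply: idealMr => //; exact: ipow_ideal.
  have ha : ipow G m (a' - a).
    rewrite -(subrK A (a' - a)); apply: ipow_add => //.
    by apply: ipowW IH1; rewrite leq_addr.
  have hb : ipow G m (b' - b).
    rewrite -(subrK C (b' - b)); apply: ipow_add => //.
    by apply: ipowW IH2; rewrite leq_addr.
  have -> : a' * b' - a * b - (b * A + a * C) =
    (a' - a) * (b' - b) + (b * (a' - a - A) + a * (b' - b - C)) by ring.
  apply: ipow_add; first exact: ipowM.
  by apply: ipow_add; apply: (idealM (ipow_ideal _ _)).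
Qed.

Lemma peval_congr v d m e : (forall j, ipow G m (d j)) ->
  ipow G m (peval (fun j => v j + d j) e - peval v e).
Proof.
move=> hd; rewrite -(subrK (\sum_j d j * peval v (pderiv j e)) (_ - _)).
apply: ipow_add; first by apply: ipowW (peval_taylor v e hd); rewrite leq_addr.
by apply: ipow_sum => j; apply: idealMr => //; exact: ipow_ideal.
Qed.

(** Each step subtracts [N] applied to the current values [E] of the equations. [N] is never updated
    and inverts the Jacobian only modulo the ideal, so a step gains one power of the ideal rather
    than doubling the order. *)
Lemma newton c (e : 'I_c -> pexpr Q n) v (N : 'I_n -> 'I_c -> R) m :
  (forall i, G (peval v (e i))) ->
  (forall i k, ipow G 1 (\sum_j peval v (pderiv j (e i)) * N j k - (i == k)%:R)) ->
  exists d, [/\ forall j, ipow G 1 (d j),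
    forall j, (forall k, N j k = 0) -> d j = 0
    & forall i, ipow G m.+1 (peval (fun j => v j + d j) (e i))].
Proof.
move=> hG hN; elim: m => [|m [d [d1 d0 dm]]].
  exists (fun=> 0); split=> // [j|i]; first exact: ipow0.
  rewrite (eq_peval (w := v)) => [|j]; last by rewrite addr0.
  by rewrite -[peval _ _]mulr1; apply: ipow_mul => //; exact: ipow_all.
pose E k := peval (fun j => v j + d j) (e k).
pose h j := - \sum_k N j k * E k.
have hm j : ipow G m.+1 (h j).
  apply: idealN; first exact: ipow_ideal.
  by apply: ipow_sum => k; apply: (idealM (ipow_ideal _ _)); exact: dm.
exists (fun j => d j + h j); split=> [j|j Nj|i].
- by apply: ipow_add => //; apply: ipowW (hm j).
- by rewrite d0 // add0r /h big1 ?oppr0 // => k _; rewrite Nj mul0r.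
rewrite (eq_peval (w := fun j => (v j + d j) + h j)); last by move=> j; rewrite addrA.
have := peval_taylor (fun j => v j + d j) (e i) hm; rewrite -/(E i).
set X := peval _ _; set D := \sum_j _ => hX.
have -> : X = (X - E i - D) + (D + E i) by ring.
apply: ipow_add; first by apply: ipowW hX; lia.
have -> : D + E i = - \sum_k (\sum_j peval (fun j => v j + d j) (pderiv j (e i)) * N j k - (i == k)%:R) * E k.
  under eq_bigr do rewrite mulrBl.
  rewrite sumrB opprB addrC; congr (_ + _).
    rewrite (bigD1 i) //= eqxx mul1r big1 ?addr0 // => k; rewrite eq_sym => /negbTE ->.
    by rewrite mul0r.
  under [X in _ = - X]eq_bigr do rewrite mulr_suml.
  rewrite exchange_big -sumrN; apply: eq_bigr => j _ /=.
  by rewrite /h mulNr mulr_suml; congr (- _); apply: eq_bigr => k _; ring.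
apply: idealN; first exact: ipow_ideal.
apply: ipow_sum => k; rewrite -add1n; apply: ipowM; last exact: dm.
rewrite -(subrK (\sum_j peval v (pderiv j (e i)) * N j k) (\sum_j _)) -addrA.
apply: ipow_add; last exact: hN.
rewrite -sumrB; apply: ipow_sum => j; rewrite -mulrBl.
apply: idealMr; first exact: ipow_ideal.
exact: peval_congr.
Qed.

End Newton.

Definition solves (Q : comPzRingType) n c (e : 'I_c -> pexpr Q n) (R : alg Q)
  (v : 'I_n -> R) := forall i, peval v (e i) = 0.

(** A right inverse of the whole Jacobian is required instead of an invertible minor. This condition
    is easily transferred when the inverse of a function is adjoined as a new coordinate. *)
Definition smooth_eqs (Q : comPzRingType) n c (e : 'I_c -> pexpr Q n) :=
  forall (R : alg Q) (v : 'I_n -> R), solves e v ->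
  exists N : 'I_n -> 'I_c -> R, forall i k,
    \sum_j peval v (pderiv j (e i)) * N j k = (i == k)%:R.

(* The Rees algebra P[e T] is Noetherian, hence so is the module generated by
   the elements z_m T^m, where z_m in I^m arises from z by Newton's method. *)
Lemma flat_noetherian (Q : comNzRingType) n c (e : 'I_c -> pexpr Q n) r
    (q : 'I_r -> Q) (u : 'I_r -> pexpr Q n) (N : 'I_n -> 'I_c -> Pn Q n) :
  noetherian Q ->
  let G (x : Pn Q n) := exists i, x = Pev (e i) in
  (forall i k, span G (\sum_j Pev (pderiv j (e i)) * N j k - (i == k)%:R)) ->
  span G (\sum_s Pcst Q n (q s) * Pev (u s)) ->
  exists w : 'I_r -> Pn Q n,
    (forall s, span G (w s - Pev (u s))) /\ \sum_s Pcst Q n (q s) * w s = 0.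
Proof.
move=> noeQ G hN hz.
have /choice [d hd] m : exists d : 'I_n -> Palg Q n, (forall j, ipow G 1 (d j)) /\
    forall i, ipow G m (peval (fun j => (Pvar Q j : Palg Q n) + d j) (e i)).
  have [|i k|d [d1 _ dm]] := @newton Q (Palg Q n) G n c e (fun j => Pvar Q j) N m.
  - by move=> i; exists i.
  - exact/ipow1E/hN.
  - by exists d; split=> // i; exact: ipowW (dm i).
pose x m j : Palg Q n := Pvar Q j + d m j.
pose z m : Pn Q n := \sum_s Pcst Q n (q s) * peval (x m) (u s).
have zm m : ipow G m (z m).
  have [h hv] := @Pn_eval Q n (Palg Q n) (x m) (elimN eqP (oner_neq0 _)).
  have hE t : h (Pev t) = peval (x m) t by rewrite /Pev peval_hom; exact: eq_peval.
  have -> : z m = h (\sum_s Pcst Q n (q s) * Pev (u s)).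
    rewrite rmorph_sum; apply: eq_bigr => s _; rewrite rmorphM hE.
    by rewrite -[Pcst Q n (q s)]/(str (Palg Q n) (q s)) ahomE.
  apply: (span_min (J := fun y => ipow G m (h y))) hz.
    split=> [|a b|a b]; first by rewrite rmorph0; exact: ipow0.
      by rewrite rmorphD; exact: ipow_add.
    by rewrite rmorphM; exact: (idealM (ipow_ideal _ _)).
  by move=> _ [i ->]; rewrite hE; have [_] := hd m; apply.
pose A : alg (Pn Q n) := @Alg (Pn Q n) {poly Pn Q n} polyC.
(* The image of [F] is the Rees algebra: coefficients in degree m lie in the m-th power of the
   ideal, and each [y] in that power gives an element [y T^m] of the image. *)
have [F Fv] := @Pn_eval (Pn Q n) c A (fun i => (Pev (e i))%:P * 'X) (elimN eqP (oner_neq0 _)).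
have lift m y : ipow G m y -> exists w, F w = y%:P * 'X^m.
  elim=> {m y} [y|m|m y y' _ [w hw] _ [w' hw']|m _ y [i ->] _ [w hw]].
  - by exists (Pcst _ _ y); rewrite (ahomE F) expr0 mulr1.
  - by exists 0; rewrite rmorph0 mul0r.
  - by exists (w + w'); rewrite rmorphD hw hw' -mulrDl -rmorphD.
  - exists (Pvar _ i * w); rewrite rmorphM Fv hw rmorphM exprS.
    by rewrite -[LHS]/(_ * _ : {poly Pn Q n}); ring.
have Fcoef w m : ipow G m (F w : {poly Pn Q n})`_m.
  have [t <-] := Pev_surj w; rewrite /Pev peval_hom.
  elim: t m => [i|b|e1 IH1 e2 IH2|e1 IH1 e2 IH2] m /=.
  - rewrite Fv coefMX coefC; case: m => [|[|m]] /=; [exact: ipow0| |exact: ipow0].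
    by apply/ipow1E/span_mem; exists i.
  - by rewrite coefC; case: m => [|m]; [exact: ipow_all|exact: ipow0].
  - by rewrite coefD; exact: ipow_add.
  - rewrite coefM; apply: ipow_sum => i.
    have := ipowM (IH1 i) (IH2 (m - i)%N); rewrite subnKC //.
    by rewrite -ltnS.
have [w hw] := choice (fun m => lift m _ (zm m)).
have [M [a ea]] := @noetherian_Pn _ c (@noetherian_Pn _ n noeQ) w.
(* Comparing coefficients of [T^M] in the relation between the [z i T^i], only degree [M - i] of
   [a i] contributes. It is positive, so [b i] lies in the ideal. *)
pose b (i : 'I_M) : Pn Q n := (F (a i) : {poly Pn Q n})`_(M - i).
have b1 i : ipow G 1 (b i) by apply: ipowW (Fcoef (a i) _); rewrite subn_gt0.
have zM : z M = \sum_(i < M) b i * z i.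
  have := congr1 (fun p : {poly Pn Q n} => p`_M) (congr1 F ea).
  rewrite hw coefCM coefXn eqxx mulr1 => ->; rewrite rmorph_sum coef_sum.
  apply: eq_bigr => i _; rewrite rmorphM hw.
  rewrite [_%:P * _]mulrC mulrA coefMC coefMXn ltnNge leq_eqVlt ltn_ord orbT /=.
  by [].
(* The subtracted terms lie in the ideal, and the weighted sum becomes [z M] minus the combination
   of the [z i] that equals it. *)
exists (fun s => peval (x M) (u s) - \sum_(i < M) b i * peval (x i) (u s)); split.
  move=> s; apply/ipow1E.
  have -> : peval (x M) (u s) - \sum_(i < M) b i * peval (x i) (u s) - Pev (u s) =
    (peval (x M) (u s) - Pev (u s)) - \sum_(i < M) b i * peval (x i) (u s) by rewrite addrAC.
  apply: ipowB; last by apply: ipow_sum => i; apply: (idealMr _ (ipow_ideal _ _)).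
  exact: (@peval_congr Q (Palg Q n) G n (fun j => Pvar Q j) (d M) 1 (u s) (proj1 (hd M))).
under eq_bigr do rewrite mulrBr.
rewrite sumrB -/(z M) zM; apply/eqP; rewrite subr_eq0; apply/eqP.
under eq_bigr do rewrite mulr_sumr.
rewrite exchange_big; apply: eq_bigr => s _ /=; rewrite mulr_sumr.
by apply: eq_bigr => i _; exact: mulrCA.
Qed.

Fixpoint pconsts (B : Type) n (e : pexpr B n) : seq B :=
  match e with
  | PVar _ => [::]
  | PCst b => [:: b]
  | PAdd e1 e2 | PMul e1 e2 => pconsts e1 ++ pconsts e2
  end.

Lemma pexpr_lift (S Q : Type) (i : S -> Q) n (t : pexpr Q n) :
  (forall b, List.In b (pconsts t) -> exists x, i x = b) -> exists u, pexpr_map i u = t.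
Proof.
elim: t => [j|b|e1 IH1 e2 IH2|e1 IH1 e2 IH2] /= h.
- by exists (PVar j).
- by have [|x <-] := h b; [left|exists (PCst x)].
- have [x hx|u1 <-] := IH1; first by apply: h; apply/List.in_or_app; left.
  have [x hx|u2 <-] := IH2; first by apply: h; apply/List.in_or_app; right.
  by exists (PAdd u1 u2).
- have [x hx|u1 <-] := IH1; first by apply: h; apply/List.in_or_app; left.
  have [x hx|u2 <-] := IH2; first by apply: h; apply/List.in_or_app; right.
  by exists (PMul u1 u2).
Qed.

Lemma mem_In (T : eqType) (x : T) s : List.In x s <-> x \in s.
Proof.
elim: s => [|y s IH] //=; rewrite inE; split=> [[->|/IH ->]|/orP [/eqP ->|/IH]].
- by rewrite eqxx.
- by rewrite orbT.
- by left.
- by right.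
Qed.

Lemma ex_noetherian_pexprs (k : fieldType) (Q : comNzRingType) (f : {rmorphism k -> Q})
    n (T : finType) (t : T -> pexpr Q n) :
  exists (S : comNzRingType) (i : {rmorphism S -> Q}) (g : {rmorphism k -> S}),
    [/\ noetherian S, injective i, forall x, i (g x) = f x
      & forall a, exists u, pexpr_map i u = t a].
Proof.
pose cs := flatten [seq pconsts (t a) | a <- enum T].
have [S [i [g [noeS inji ig im]]]] :=
  ex_noetherian_subring f (fun j : 'I_(size cs) => cs`_j).
exists S, i, g; split=> // a; apply: pexpr_lift => b /mem_In hb.
have /(nthP 0) [j lt <-] : b \in cs.
  by apply/flattenP; exists (pconsts (t a)) => //; apply: map_f; rewrite mem_enum.
exact: (im (Ordinal lt)).
Qed.

Definition peqs (Q : comNzRingType) n c (e : 'I_c -> pexpr Q n) (x : Pn Q n) :=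
  exists i, x = Pev (e i).

Lemma span_peqs_eval (Q : comNzRingType) n c (e : 'I_c -> pexpr Q n) t (R : alg Q)
    (v : 'I_n -> R) :
  span (peqs e) (Pev t) -> solves e v -> peval v t = 0.
Proof.
move=> ht sv; have [e1|nz] := pselect ((1 : R) = 0); first exact: zero_ring_eq.
have [h hv] := Pn_eval v nz.
have hE u : h (Pev u) = peval v u by rewrite /Pev peval_hom; exact: eq_peval.
rewrite -hE; apply: (span_min (J := fun y => h y = 0)) ht; first exact: rker_ideal.
by move=> _ [i ->]; rewrite hE.
Qed.

Lemma ex_universal_solution (Q : comNzRingType) n c (e : 'I_c -> pexpr Q n) :
  exists (R : alg Q) (h : ahom (Palg Q n) R),
    [/\ forall y, exists x, h x = y, forall x, h x = 0 <-> span (peqs e) x,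
        forall t, peval (fun i => h (Pvar Q i)) t = h (Pev t)
      & solves e (fun i => h (Pvar Q i))].
Proof.
have [C [pi [surj ker]]] := ex_ideal_quotient (span_ideal (peqs e)).
exists (@push Q (Palg Q n) C pi), (@to_push Q (Palg Q n) C pi).
have E t : peval (fun i => to_push (R := Palg Q n) pi (Pvar Q i)) t =
    to_push (R := Palg Q n) pi (Pev t) by rewrite /Pev peval_hom.
split=> // i; rewrite E; apply/ker/span_mem; by exists i.
Qed.

(** All hypotheses amount to finitely many polynomial identities, namely certificates of ideal
    membership. They descend to the Noetherian subring generated by the coefficients involved, where
    [flat_noetherian] applies. *)
Lemma flat_smooth (k : fieldType) (Q : comNzRingType) (f : {rmorphism k -> Q}) n c
    (e : 'I_c -> pexpr Q n) r (q : 'I_r -> Q) (u : 'I_r -> pexpr Q n) :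
  smooth_eqs e ->
  (forall (R : alg Q) (v : 'I_n -> R), solves e v ->
     \sum_s str R (q s) * peval v (u s) = 0) ->
  exists w : 'I_r -> Pn Q n,
    (forall s, span (peqs e) (w s - Pev (u s))) /\ \sum_s Pcst Q n (q s) * w s = 0.
Proof.
move=> sm van.
have [R [pi [surj ker E sol]]] := ex_universal_solution e.
have [N0 hN0] := sm _ _ sol.
have [N hN] := choice (fun x : 'I_n * 'I_c => surj (N0 x.1 x.2)).
have spN i k' : span (peqs e) (\sum_j Pev (pderiv j (e i)) * N (j, k') - (i == k')%:R).
  apply/ker; rewrite rmorphB rmorph_sum rmorph_nat -hN0; apply/eqP; rewrite subr_eq0.
  by apply/eqP/eq_bigr => j _; rewrite rmorphM hN E.
have spz : span (peqs e) (\sum_s Pcst Q n (q s) * Pev (u s)).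
  apply/ker; rewrite rmorph_sum -[RHS](van _ _ sol); apply: eq_bigr => s _.
  by rewrite rmorphM E -[Pcst Q n (q s)]/(str (Palg Q n) (q s)) ahomE.
have [h hz] := span_range spz.
have [M hM] := choice (fun x : 'I_c * 'I_c => span_range (spN x.1 x.2)).
have [N1 hN1] := choice (fun x => Pev_surj (N x)).
have [h1 hh1] := choice (fun x => Pev_surj (h x)).
have [M1 hM1] := choice (fun x : 'I_c * 'I_c * 'I_c => Pev_surj (M x.1 x.2)).
(* Everything that must descend: the equations, the functions [u], the coefficients [q], the
   certificate [h], the right inverse [N] of the Jacobian, and the certificates [M] that it is
   one. *)
pose T := ('I_c + 'I_r + 'I_r + 'I_c + 'I_n * 'I_c + 'I_c * 'I_c * 'I_c)%type.
pose t (x : T) : pexpr Q n := match x with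
  | inl (inl (inl (inl (inl i)))) => e i
  | inl (inl (inl (inl (inr s)))) => u s
  | inl (inl (inl (inr s))) => PCst (q s)
  | inl (inl (inr i)) => h1 i
  | inl (inr x) => N1 x
  | inr x => M1 x end.
have [S [i [g [noeS inji ig /choice [l hl]]]]] := ex_noetherian_pexprs f t.
pose e' a := l (inl (inl (inl (inl (inl a))))).
pose u' s := l (inl (inl (inl (inl (inr s))))).
pose q0 s := l (inl (inl (inl (inr s)))).
pose h' a := l (inl (inl (inr a))).
pose N' x := l (inl (inr x)).
pose M' x := l (inr x).
have he a : pexpr_map i (e' a) = e a by exact: hl.
have hu s : pexpr_map i (u' s) = u s by exact: hl.
have hq s : exists b, i b = q s.
  have := hl (inl (inl (inl (inr s)))); rewrite /= -/(q0 s).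
  by case: (q0 s) => //= b [<-]; exists b.
have [q' hq'] := choice hq.
have hh a : pexpr_map i (h' a) = h1 a by exact: hl.
have hN' x : pexpr_map i (N' x) = N1 x by exact: hl.
have hM' x : pexpr_map i (M' x) = M1 x by exact: hl.
have injP := @Pmap_inj S Q i n inji.
have spe a : span (peqs e') (Pev (e' a)) by apply: span_mem; exists a.
have [w [w1 w2]] : exists w : 'I_r -> Pn S n,
    (forall s, span (peqs e') (w s - Pev (u' s))) /\ \sum_s Pcst S n (q' s) * w s = 0.
  apply: (@flat_noetherian S n c e' r q' u' (fun j b => Pev (N' (j, b)))) => // [a b|].
    have -> : \sum_j Pev (pderiv j (e' a)) * Pev (N' (j, b)) - (a == b)%:R =
       \sum_x Pev (M' (a, b, x)) * Pev (e' x).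
      apply: injP; rewrite rmorphB !rmorph_sum rmorph_nat /=.
      rewrite [RHS](eq_bigr (fun x => M (a, b) x * Pev (e x))).
        rewrite -hM; congr (_ - _); apply: eq_bigr => j _.
        by rewrite rmorphM !Pmap_ev hN' hN1 -pderiv_map he.
      by move=> x _; rewrite rmorphM !Pmap_ev hM' hM1 he.
    by apply: ideal_sum => [|x _]; [exact: span_ideal|exact: (idealM (span_ideal _))].
  have -> : \sum_s Pcst S n (q' s) * Pev (u' s) = \sum_x Pev (h' x) * Pev (e' x).
    apply: injP; rewrite !rmorph_sum [RHS](eq_bigr (fun x => h x * Pev (e x))).
      rewrite -hz; apply: eq_bigr => s _.
      by rewrite rmorphM Pmap_cst Pmap_ev hu hq'.
    by move=> x _; rewrite rmorphM !Pmap_ev hh hh1 he.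
  by apply: ideal_sum => [|x _]; [exact: span_ideal|exact: (idealM (span_ideal _))].
exists (fun s => Pmap i n (w s)); split=> [s|].
  rewrite -hu -Pmap_ev -rmorphB; move: (span_map (Pmap i n) (w1 s)).
  apply: span_min; first exact: span_ideal.
  by move=> _ [_ [a ->] ->]; apply: span_mem; exists a; rewrite Pmap_ev he.
rewrite -[RHS](rmorph0 (Pmap i n)) -w2 rmorph_sum; apply: eq_bigr => s _.
by rewrite rmorphM Pmap_cst hq'.
Qed.

Section FlatConsequences.
Variables (k : fieldType) (Q : comNzRingType) (f : {rmorphism k -> Q}).
Variables (n c : nat) (e : 'I_c -> pexpr Q n).
Hypothesis sm : smooth_eqs e.

(* The premise says that q s |-> b s is a Q-linear map from the ideal generated by
   the q s to K. *)
Lemma flat_relation (K : comNzRingType) (j : {rmorphism Q -> K}) r (q : 'I_r -> Q)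
    (b : 'I_r -> K) (u : 'I_r -> pexpr Q n) :
  (forall a : 'I_r -> Q, \sum_s q s * a s = 0 -> \sum_s b s * j (a s) = 0) ->
  (forall (R : alg Q) (v : 'I_n -> R), solves e v ->
     \sum_s str R (q s) * peval v (u s) = 0) ->
  forall (R : alg K) (v : 'I_n -> R), solves (R := res j R) e v ->
    \sum_s str R (b s) * peval (R := res j R) v (u s) = 0.
Proof.
move=> rel van R v sol; have [w [w1 w2]] := flat_smooth f sm van.
have [e1|nz] := pselect ((1 : R) = 0); first exact: (@zero_ring_eq R).
have := @Pn_relation Q Q K idfun j 'I_r q b rel n w.
have Pid (x : Pn Q n) : Pmap idfun n x = x.
  by have [t <-] := Pev_surj x; rewrite Pmap_ev; congr Pev; elim: t => //= [e1 -> e2 ->|e1 -> e2 ->].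
under eq_bigr do rewrite Pid.
move=> /(_ w2) e0.
have [h hv] := Pn_eval v nz.
have hE (t : pexpr Q n) : h (Pmap j n (Pev t)) = peval (R := res j R) v t.
  by rewrite Pmap_ev /Pev peval_hom peval_map; apply: (@eq_peval _ _ (res j R)) => i; exact: hv.
rewrite -[RHS](rmorph0 h) -e0 rmorph_sum; apply: eq_bigr => s _.
rewrite rmorphM; congr (_ * _); first by rewrite -[Pcst K n (b s)]/(str (Palg K n) (b s)) ahomE.
have [t ht] := Pev_surj (w s - Pev (u s)).
have h1 : span (peqs e) (Pev t) by rewrite ht.
have := span_peqs_eval h1 sol; rewrite -hE ht rmorphB rmorphB /= => /eqP; rewrite subr_eq0 => /eqP ->.
by rewrite hE.
Qed.

(** Flatness in the form that annihilators commute with it: a function on the chart killed by all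
    the [a i] is a combination of elements of [Q] killed by all the [a i]. *)
Lemma chart_torsion (F : pexpr Q n) m (a : 'I_m -> Q) :
  (forall (R : alg Q) (v : 'I_n -> R), solves e v ->
     forall i, str R (a i) * peval v F = 0) ->
  exists (r : nat) (q : 'I_r -> Q) (u : 'I_r -> pexpr k n),
    (forall i s, a i * q s = 0) /\
    forall (R : alg Q) (v : 'I_n -> R), solves e v ->
      peval v F = \sum_s str R (q s) * peval v (pexpr_map f (u s)).
Proof.
move=> van.
suff [G [cG hG]] : exists G : Pn Q n,
    Pcoefs (fun x => forall i, a i * x = 0) G /\ span (peqs e) (G - Pev F).
  have [r [q [u [hq eG]]]] := Pcoefs_expand f cG.
  exists r, q, u; split=> [i s|R v sol]; first exact: hq.
  have [t ht] := Pev_surj G; apply/eqP; rewrite eq_sym -subr_eq0; apply/eqP.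
  have -> : \sum_s str R (q s) * peval v (pexpr_map f (u s)) =
      peval v (psum (enum 'I_r) (fun s => PMul (PCst (q s)) (pexpr_map f (u s)))).
    by rewrite peval_sum big_enum.
  rewrite -peval_opp.
  apply: (@span_peqs_eval _ _ _ _ (PAdd _ (popp F))) sol.
  rewrite /Pev /= -/(Pev F) rmorphN rmorph1 mulN1r.
  by move: hG; rewrite eG peval_sum big_enum.
(* One [a i] is treated at a time. With coefficients [q s] already killed by the earlier ones,
   flatness for the relation with coefficients [a i * q s] replaces the functions and keeps the
   [q s], so the earlier conditions persist. *)
suff H (l : seq 'I_m) : exists G : Pn Q n,
    Pcoefs (fun x => forall i, i \in l -> a i * x = 0) G /\ span (peqs e) (G - Pev F).
  have [G [cG hG]] := H (enum 'I_m); exists G; split=> //.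
  by apply: Pcoefs_sub cG => x h i; apply: h; rewrite mem_enum.
elim: l => [|i l [G [cG hG]]].
  exists (Pev F); rewrite subrr; split; last exact: span0.
  by elim: (n) (Pev F) => //=.
have [r [q [u [hq eG]]]] := Pcoefs_expand f cG.
have [R v sol|w [w1 w2]] := @flat_smooth k Q f n c e r (fun s => a i * q s)
    (fun s => pexpr_map f (u s)) sm.
  transitivity (str R (a i) * \sum_s str R (q s) * peval v (pexpr_map f (u s))).
    by rewrite mulr_sumr; apply: eq_bigr => s _; rewrite rmorphM mulrA.
  rewrite -[RHS](van R v sol i); congr (_ * _); apply/eqP; rewrite -subr_eq0; apply/eqP.
  have -> : \sum_s str R (q s) * peval v (pexpr_map f (u s)) =
      peval v (psum (enum 'I_r) (fun s => PMul (PCst (q s)) (pexpr_map f (u s)))).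
    by rewrite peval_sum big_enum.
  rewrite -peval_opp.
  apply: (@span_peqs_eval _ _ _ _ (PAdd _ (popp F))) sol.
  rewrite /Pev /= -/(Pev F) rmorphN rmorph1 mulN1r.
  by move: hG; rewrite eG peval_sum big_enum.
pose N x := forall i0, i0 \in l -> a i0 * x = 0.
have hN : is_ideal N.
  split=> [b _|x y hx hy b hb|y x hx b hb]; first by rewrite mulr0.
    by rewrite mulrDr hx // hy // addr0.
  by rewrite mulrCA hx // mulr0.
exists (\sum_s Pcst Q n (q s) * w s); split.
  have c1 : Pcoefs N (\sum_s Pcst Q n (q s) * w s).
    apply: ideal_sum => [|s _]; first exact: Pcoefs_ideal.
    apply: idealMr; first exact: Pcoefs_ideal.
    by apply: Pcoefs_cst; [exact: (ideal0 hN)|exact: hq].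
  have c2 : Pcoefs (fun x => a i * x = 0) (\sum_s Pcst Q n (q s) * w s).
    apply/Pcoefs_ann; rewrite -[RHS]w2 mulr_sumr; apply: eq_bigr => s _.
    by rewrite rmorphM mulrA.
  apply: Pcoefs_sub (Pcoefs_and c1 c2) => x [h1 h2] b.
  by rewrite inE => /predU1P [->|/h1].
rewrite (_ : _ - _ = \sum_s Pcst Q n (q s) * (w s - Pev (pexpr_map f (u s))) + (G - Pev F)).
  apply: (idealD (span_ideal _)) => //; apply: ideal_sum => [|s _]; first exact: span_ideal.
  exact: (idealM (span_ideal _)).
rewrite eG addrA; congr (_ - _); rewrite -big_split /=; apply: eq_bigr => s _.
by rewrite mulrBr subrK.
Qed.

End FlatConsequences.

(** * The relative Frobenius of a smooth scheme is an epimorphism *)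

Lemma nz_pack (R : comPzRingType) : (1 : R) <> 0 ->
  exists (S : comNzRingType) (f : {rmorphism R -> S}) (g : {rmorphism S -> R}),
    cancel f g /\ cancel g f.
Proof.
move=> /eqP nz; pose nzm := GRing.PzSemiRing_isNonZero.Build R nz.
pose S : comNzRingType :=
  HB.pack (GRing.ComPzRing.sort R) (GRing.ComPzRing.class R) nzm.
have [f fE] : exists f : {rmorphism R -> S}, forall x, f x = x.
  by apply: (@pack_rmorphism R S).
have [g gE] : exists g : {rmorphism S -> R}, forall x, g x = x.
  by apply: (@pack_rmorphism S R).
by exists S, f, g; split=> x; rewrite ?fE ?gE // fE.
Qed.

(** The ring R[X]/(X^p - a) contains R, because a nonzero multiple of a monic polynomial of degree p
    is not constant. *)
Lemma ex_pth_root (p : nat) (R : comPzRingType) (a : R) : (0 < p)%N ->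
  exists (S : comPzRingType) (f : {rmorphism R -> S}) (t : S),
    injective f /\ t ^+ p = f a.
Proof.
move=> p0; have [e1|nz] := pselect ((1 : R) = 0).
  by exists R, idfun, a; split=> //; exact: zero_ring_eq.
have [N [f [g [fK gK]]]] := nz_pack nz.
pose h : {poly N} := 'X^p - (f a)%:P.
have mh : h \is monic by exact: monicXnsubC.
have sh : size h = p.+1 by exact: size_XnsubC.
have [S [pi [surj ker]]] := ex_ideal_quotient (span_ideal (R := {poly N}) (fun x => x = h)).
have kerE x : pi x = 0 -> exists q, x = q * h.
  move=> /ker; elim=> [|b _ y -> _ [q ->]]; first by exists 0; rewrite mul0r.
  by exists (b + q); rewrite mulrDl.
exists S, (pi \o (polyC \o f)), (pi 'X); split.
  move=> x y /eqP; rewrite -subr_eq0 -rmorphB => /eqP /kerE [q /= e].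
  apply: (can_inj fK); apply/eqP; rewrite -subr_eq0 -rmorphB; apply/eqP.
  have [q0|q0] := eqVneq q 0; first by move: e; rewrite q0 mul0r => /polyC_inj.
  have := congr1 (fun r : {poly N} => size r) e; rewrite size_Mmonic // sh size_polyC.
  by move: q0; rewrite -size_poly_gt0; case: (_ != _) => /=; lia.
apply/eqP; rewrite -subr_eq0 -rmorphXn -rmorphB; apply/eqP/ker.
exact: span_mem.
Qed.

Lemma ex_pth_roots (p : nat) (R : comPzRingType) n (a : 'I_n -> R) : (0 < p)%N ->
  exists (S : comPzRingType) (f : {rmorphism R -> S}) (t : 'I_n -> S),
    injective f /\ forall i, t i ^+ p = f (a i).
Proof.
move=> p0; elim: n R a => [|n IH] R a; first by exists R, idfun, a; split=> // -[].
have [S [f [t [fi ht]]]] := IH R (fun i => a (lift ord0 i)).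
have [S' [f' [t' [fi' ht']]]] := ex_pth_root (f (a ord0)) p0.
exists S', (f' \o f), (fun i => if unlift ord0 i is Some j then f' (t j) else t').
split; first exact: inj_comp.
move=> i; case: unliftP => [j ->|->] //=.
by rewrite -ht rmorphXn.
Qed.

(** Pigeonhole: a product of more than [c * p] factors among [c] generators contains the p-th power
    of one of them. The exponents [a] in the induction record the factors already split off. *)
Lemma ipow_nilpotent (R : comPzRingType) c (g : 'I_c -> R) p m x :
  (forall i, g i ^+ p = 0) -> ipow (fun y => exists i, y = g i) m x ->
  (c * p < m)%N -> x = 0.
Proof.
move=> hg hx lt.
suff H : forall a : 'I_c -> nat, (c * p < (\sum_i a i + m)%N)%N ->
    (\prod_i g i ^+ a i) * x = 0.
  have := H (fun=> 0%N); rewrite big1 // => /(_ lt).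
  by rewrite big1 ?mul1r // => i _; rewrite expr0.
elim: hx {lt} => {m x} [x|m|m x y _ IHx _ IHy|m _ x [i ->] _ IH] a lt.
- have [i hi] : exists i, (p <= a i)%N.
    apply: contrapT => no; have : (\sum_i a i <= \sum_(i < c) p)%N.
      apply: leq_sum => i _; rewrite leqNgt; apply/negP => lt'; apply: no.
      by exists i; exact: ltnW.
    by rewrite sum_nat_const card_ord leqNgt -(addn0 (\sum_i _)%N) lt.
  by rewrite (bigD1 i) //= -(subnK hi) exprD hg !(mulr0, mul0r).
- by rewrite mulr0.
- by rewrite mulrDr IHx // IHy // addr0.
- have := IH (fun j => (a j + (j == i))%N).
  have e1 : (\sum_(j < c) (j == i) = 1)%N.
    by rewrite (bigD1 i) //= eqxx big1 // => j /negbTE ->.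
  rewrite big_split /= e1 -addnA add1n => /(_ lt).
  under eq_bigr do rewrite exprD.
  rewrite big_split /= [X in _ * X * _](bigD1 i) //= eqxx expr1.
  rewrite [\prod_(_ < _ | _ != _) _]big1 ?mulr1 ?mulrA // => j /negbTE ->.
  exact: expr0.
Qed.

Section BaseChange.
Variables (B B' : comPzRingType) (phi : {rmorphism B -> B'}).

Lemma functorial_bc (X : pre B) : functorial X -> functorial (pre_bc phi X).
Proof.
by move=> hX; split=> [R f x e|R S T f g h x e] /=; [exact: pmap_id|exact: pmap_comp].
Qed.

Definition sub_bc (X : pre B) (U : sub X) : sub (pre_bc phi X) :=
  fun R x => U (res phi R) x.

Lemma open_bc (X : pre B) (U : sub X) : is_open U -> is_open (sub_bc U).
Proof.
by move=> oU R x; have [I hI] := oU _ x; exists I => S f; exact: hI.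
Qed.

Lemma covers_bc (X : pre B) (J : Type) (U : J -> sub X) :
  covers U -> covers (fun j => sub_bc (U j)).
Proof. by move=> cU K j x; have [i Ui] := cU K (j \o phi) x; exists i. Qed.

End BaseChange.

Section Frobenius.
Variables (k : fieldType) (p : nat) (kp : p \in [pchar k]).

Definition frob_alg (B : alg k) (R : alg B) : {rmorphism R -> R} :=
  frob kp (res (str B) R).

Lemma frob_algE (B : alg k) (R : alg B) (r : R) : frob_alg R r = r ^+ p.
Proof. by []. Qed.

Fact frob_ahom_subproof (B : alg k) (R : alg B) (b : B) :
  frob_alg R (str R b) = str (res (frob kp B) R) b.
Proof. by rewrite frob_algE -rmorphXn. Qed.

(** The p-th power map is linear over [B] once the structure of its target is restricted along the
    Frobenius of [B]. On points of [X] it induces the relative Frobenius from X to X^(p). *)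
Definition frob_ahom (B : alg k) (R : alg B) : ahom R (res (frob kp B) R) :=
  @AHom B R (res (frob kp B) R) (frob_alg R) (@frob_ahom_subproof B R).

(** Adjoin p-th roots [t] of the coordinates of [x]. At [t] the equations take values with p-th
    power 0, and Newton's method corrects [t] to a solution. The correction also has p-th power 0,
    so Frobenius still sends the new point to [x]. *)
Lemma frobenius_lift (B : alg k) d (X : pre B) (U : sub X) (R : alg B)
    (x : X (res (frob kp B) R)) :
  functorial X -> std_smooth_open d U -> U _ x ->
  exists (S : alg B) (l : ahom R S) (a : X S), injective l /\
    pmap X (frob_ahom S) a = pmap X (ahom_res (frob kp B) l) x.
Proof.
move=> fX [oU [c [e [y [ynat ysol yinj ysm]]]]] Ux.
have p0 : (0 < p)%N by exact: prime_gt0 (pcharf_prime kp).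
set fr := frob kp B in x Ux *.
pose v : 'I_(c + d) -> res fr R := y (res fr R) x.
have solv : forall i, peval v (e i) = 0 by apply/ysol; exists x.
have [S0 [f [t [fi ht]]]] := ex_pth_roots v p0.
pose S : alg B := push (R := R) f; pose l : ahom R S := to_push (R := R) f.
pose tS : 'I_(c + d) -> S := t.
have frE (a : pexpr B (c + d)) :
    peval tS a ^+ p = f (peval v a).
  rewrite -frob_algE -[LHS]/(frob_ahom S (peval tS a)) peval_hom.
  rewrite -[f _]/(ahom_res fr l _) peval_hom.
  by apply: (@eq_peval _ _ (res fr S)) => i; rewrite -[LHS]/(t i ^+ p) ht.
pose J : 'M[S]_c := \matrix_(i < c, j < c) peval tS (pderiv (lshift d j) (e i)).
have [M hM] := ysm _ v solv.
(* Frobenius carries the Jacobian minor at [t] to that at [v], which is invertible; hence [\det J]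
   is a unit. *)
have detJ : \det J ^+ p * f (\det M) = 1.
  rewrite -frob_algE -det_map_mx -det_map_mx -det_mulmx.
  have -> : map_mx (frob_alg S) J = map_mx f (\matrix_(i < c, j < c) peval v (pderiv (lshift d j) (e i))).
    by apply/matrixP => i j; rewrite !mxE; exact: frE.
  by rewrite -map_mxM hM map_mx1 det1.
pose w := \det J ^+ p.-1 * f (\det M).
have hw : \det J * w = 1 by rewrite mulrA -exprS prednK.
pose N (j : 'I_(c + d)) (i : 'I_c) : S :=
  if split j is inl j0 then (w *: \adj J) j0 i else 0.
have hN i i' : \sum_j peval tS (pderiv j (e i)) * N j i' = (i == i')%:R.
  rewrite big_split_ord /= [X in _ + X]big1 ?addr0 => [|j _]; last first.
    by rewrite /N (unsplitK (inr j : 'I_c + 'I_d)%type) mulr0.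
  have <- : (J *m (w *: \adj J)) i i' = (i == i')%:R.
    by rewrite -scalemxAr mul_mx_adj scale_scalar_mx mulrC hw mxE.
  rewrite mxE; apply: eq_bigr => j _.
  by rewrite /N (unsplitK (inl j : 'I_c + 'I_d)%type) !mxE.
pose G (a : S) := exists i, a = peval tS (e i).
(* With this number of steps the values lie in the power [c * p + 1] of the ideal, which is zero by
   [ipow_nilpotent]. *)
have [||dl [dl1 dl0 dlm]] := @newton B S G (c + d) c e tS N (c * p).
- by move=> i; exists i.
- by move=> i i'; rewrite hN subrr; exact: ipow0.
have solS : forall i, peval (fun j => tS j + dl j) (e i) = 0.
  move=> i; apply: (ipow_nilpotent _ (dlm i)) => // i'.
  by rewrite frE solv rmorph0.
have [a Ua ya] := iffLR (ysol S _) solS.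
exists S, l, a; split=> //.
apply: yinj; [exact: open_stable|exact: open_stable|].
move=> i; rewrite !ynat // ya -[RHS]/(f (v i)) -ht.
rewrite -[LHS]/(frob_alg S (t i + dl i)) rmorphD /= frob_algE.
have -> : frob_alg S (dl i) = 0; last by rewrite addr0.
have /ipow1E := dl1 i; apply: (span_min (J := fun z => frob_alg S z = 0)).
  exact: rker_ideal.
by move=> _ [i' ->]; rewrite frob_algE frE solv rmorph0.
Qed.

(** Locally every point of X^(p) is a Frobenius image after an injective extension of rings, and
    injectivity brings the vanishing back. *)
Lemma frobenius_epi (B : alg k) d (X : pre B)
    (h : forall R : alg B, X (res (frob kp B) R) -> R) :
  smooth_qc_scheme d X ->
  (forall (R S : alg B) (l : ahom R S) x,
     h S (pmap X (ahom_res (frob kp B) l) x) = l (h R x)) ->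
  (forall (R : alg B) (a : X R), h R (pmap X (frob_ahom R) a) = 0) ->
  forall (R : alg B) x, h R x = 0.
Proof.
move=> [fX _ [m [U [sU cU]]]] hnat h0 R x.
have oU i : is_open (U i) by have [] := sU i.
have [n [S [l [j [[r [r1 rl]] hj]]]]] :=
  @open_cover _ (pre_bc (frob kp B) X) _ _ R x (fun i => open_bc (oU i))
    (covers_bc cU).
apply: (cover_inj r1 rl) => i; rewrite -hnat rmorph0.
have [T [l' [a [li' e]]]] := frobenius_lift fX (sU (j i)) (hj i).
by apply: li'; rewrite -hnat -e h0 rmorph0.
Qed.

End Frobenius.

(** * Functions on proper smooth connected schemes *)

Lemma rmorphism_factor (P R S : comPzRingType) (h : {rmorphism P -> R}) (f : {rmorphism P -> S}) :
  (forall y, exists x, h x = y) -> (forall x, h x = 0 -> f x = 0) ->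
  exists u : {rmorphism R -> S}, forall x, u (h x) = f x.
Proof.
move=> surj ker; have [s hs] := choice surj.
have E x y : h x = h y -> f x = f y.
  move=> e; apply/eqP; rewrite -subr_eq0 -rmorphB; apply/eqP/ker.
  by rewrite rmorphB e subrr.
have [| |u hu] := @pack_rmorphism R S (fun y => f (s y)).
- split=> [|x y]; first by rewrite -(rmorph0 f); apply: E; rewrite hs rmorph0.
  by rewrite -rmorphD; apply: E; rewrite rmorphD !hs.
- split=> [|x y]; first by rewrite -(rmorph1 f); apply: E; rewrite hs rmorph1.
  by rewrite -rmorphM; apply: E; rewrite rmorphM !hs.
by exists u => x; rewrite hu; apply: E; rewrite hs.
Qed.

Lemma universal_solution_lift (Q : comNzRingType) n c (e : 'I_c -> pexpr Q n) (R : alg Q)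
    (h : ahom (Palg Q n) R) :
  (forall y, exists x, h x = y) -> (forall x, h x = 0 <-> span (peqs e) x) ->
  forall (S : alg Q) (v : 'I_n -> S), solves e v ->
  exists u : ahom R S, forall i, u (h (Pvar Q i)) = v i.
Proof.
move=> surj ker S v sol.
have [e1|nz] := pselect ((1 : S) = 0).
  have [| |u hu] := @pack_rmorphism R S (fun=> 0).
  - by split=> [//|x y]; rewrite addr0.
  - by split=> [|x y]; apply: zero_ring_eq.
  exists (@AHom Q R S u (fun b => zero_ring_eq _ _ e1)) => i; exact: zero_ring_eq.
have [f hf] := Pn_eval v nz.
have [||u hu] := @rmorphism_factor (Pn Q n) R S h f.
- exact: surj.
- move=> x /ker; have [t <-] := Pev_surj x => /span_peqs_eval /(_ sol).
  by rewrite /Pev peval_hom => <-; apply: eq_peval.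
have ub b : u (str R b) = str S b.
  by rewrite -(ahomE h) -(ahomE f); exact: hu.
by exists (@AHom Q R S u ub) => i /=; rewrite hu hf.
Qed.

Section NaturalFunctions.
Variables (B : comPzRingType) (X : pre B).
Definition natural_fun (f : forall R : alg B, X R -> R) :=
  forall (R S : alg B) (l : ahom R S) x, f S (pmap X l x) = l (f R x).

Lemma open_unit_locus (f : forall R : alg B, X R -> R) :
  natural_fun f -> is_open (fun R (x : X R) => is_unit (f R x)).
Proof.
move=> fnat R x; exists (fun r => r = f R x) => S l.
rewrite fnat unit_unit_ideal; rewrite !unit_idealE.
split; (apply: span_min; first exact: span_ideal).
  by move=> _ ->; apply: span_mem; exists (f R x).
by move=> _ [_ -> ->]; exact: span_mem.
Qed.

End NaturalFunctions.

Section ClosedField.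
Variables (k : fieldType) (p : nat) (kp : p \in [pchar k]).
Variables (K : closedFieldType) (i : {rmorphism k -> K}).
Variables (d : nat) (X : pre K).
Hypotheses (X_smooth : smooth_qc_scheme d X) (X_closed : universally_closed X)
  (X_conn : is_connected X).
Variable g : forall R : alg K, X R -> R.
Hypothesis g_nat : natural_fun g.

Let fX : functorial X. Proof. by case: X_smooth. Qed.

(* The image of the hyperbola t g = 1 in the affine line is closed and does not
   contain 0. *)
Lemma closed_field_values : exists cs : seq K, 0 \notin cs /\
  forall (F : fieldType) (j : {rmorphism K -> F}) (x : X (Alg j)),
    g x != 0 -> exists2 c, c \in cs & g x = j c.
Proof.
pose P : comPzRingType := {poly K}.
pose pc : {rmorphism K -> P} := polyC.
pose hyp (R : alg P) (x : pre_bc pc X R) : R := 1 - str R ('X : {poly K}) * g x.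
have hyp_nat : natural_fun hyp.
  move=> R S l x; rewrite /hyp rmorphB rmorph1 rmorphM ahomE; congr (_ - _ * _).
  exact: (g_nat (ahom_res pc l)).
(* The open set is the locus where 1 - T g is a unit. Its complement is the hyperbola, so [I] cuts
   out the image of the hyperbola in the affine line. *)
have [I hI] := @X_closed P pc _ (open_unit_locus hyp_nat).
(* Above T = 0 the function 1 - T g is 1, so 0 is not in the image and some [b] in [I] does not
   vanish there. The inverse of every nonzero value of [g] is a root of [b]. *)
have [b [Ib b0]] : exists b : {poly K}, I b /\ b.[0] != 0.
  apply: contrapT => no.
  pose e0 : {rmorphism P -> K} := horner_eval (0 : K).
  have [_] := hI K e0; case.
    by move=> b Ib; apply/eqP; apply: contrapT => /negP h; apply: no; exists b.
  move=> F [e [x]]; apply; exists 1.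
  rewrite mulr1 /hyp -[str _ _]/(e (e0 'X)) /e0 /= /horner_eval hornerX rmorph0.
  by rewrite mul0r subr0.
have [rs hrs] := closed_field_poly_normal b.
exists [seq z^-1 | z <- rs & z != 0]; split.
  apply/negP => /mapP [z]; rewrite mem_filter => /andP [z0 _] /eqP.
  by rewrite eq_sym invr_eq0 (negbTE z0).
move=> F j x gx0.
have cj : commr_rmorph j (g x)^-1 by move=> y; exact: mulrC.
pose ev : {rmorphism P -> F} := horner_morph cj.
have evc y : ev (pc y) = j y by exact: horner_morphC.
pose F' : alg K := res pc (@Alg P F (idfun \o ev)).
pose l : ahom (Alg j) F' := @AHom K (Alg j) F' idfun (fun y => esym (evc y)).
have eX : ev 'X = (g x)^-1 by exact: horner_morphX.
have jb : ev b = 0.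
  have [h _] := hI F ev; apply: h => //; exists F, idfun.
  exists (pmap X l x) => -[w].
  rewrite /hyp -[str _ _]/(ev 'X) eX.
  have e : @g F' (pmap X l x) = g x by rewrite g_nat.
  rewrite e.
  by rewrite mulVf // subrr mul0r => /esym/eqP; rewrite oner_eq0.
have : root (map_poly j b) (g x)^-1 by rewrite rootE; apply/eqP.
have b_neq0 : b != 0 by apply: contraNneq b0 => ->; rewrite horner0.
rewrite hrs map_polyZ rootZ ?fmorph_eq0 ?lead_coef_eq0 // rmorph_prod /=.
under eq_bigr do rewrite map_polyXsubC.
rewrite -(big_map j xpredT (fun y => 'X - y%:P)) root_prod_XsubC => /mapP [z zr ez].
have z0 : z != 0.
  by apply: contraNneq gx0 => z0; rewrite -invr_eq0 ez z0 rmorph0.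
exists z^-1; last by rewrite fmorphV -ez invrK.
by apply: map_f; rewrite mem_filter z0.
Qed.

(** The locus g = 0 is open too: on it the product of the g - c over the finitely many nonzero
    values c is invertible, and elsewhere the product is 0. So X is a disjoint union of two open
    sets, and [z] lies in the first. *)
Lemma natural_fun_field_zero (z : X (base K)) : g z = 0 ->
  forall (F : fieldType) (j : {rmorphism K -> F}) (x : X (Alg j)), g x = 0.
Proof.
move=> gz; have [cs [cs0 hcs]] := closed_field_values.
pose u (R : alg K) (x : X R) : R := \prod_(c <- cs) (g x - str R c).
have u_nat : natural_fun u.
  move=> R S l x; rewrite /u rmorph_prod; apply: eq_bigr => c _.
  by rewrite rmorphB g_nat ahomE.
pose U (b : bool) : sub X := fun R x => is_unit (if b then u R x else g x).
have oU1 : is_open (U true) by exact: open_unit_locus.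
have oU2 : is_open (U false) by exact: open_unit_locus.
have u0 (F : fieldType) (j : {rmorphism K -> F}) (x : X (Alg j)) : (u _ x == 0) = (g x != 0).
  have [e|e] := eqVneq (g x) 0.
    rewrite /u /= prodf_seq_eq0; apply/hasPn => c hc /=.
    rewrite e sub0r oppr_eq0 fmorph_eq0; apply: contraNneq cs0 => <-.
    by [].
  have [c hc gc] := hcs F j x e.
  rewrite /u prodf_seq_eq0; apply/hasP; exists c => //=.
  by rewrite gc subrr.
have [_ conn] := X_conn.
have [||E|E] := conn U oU1 oU2.
- move=> F j x; have [e|e] := eqVneq (g x) 0.
    by exists true; apply/(@field_is_unit F); rewrite u0 e eqxx.
  by exists false; apply/(@field_is_unit F).
- by move=> F j x [/(@field_is_unit F) h1 /(@field_is_unit F) h2]; move: h1; rewrite u0 h2.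
- have /E [] : U true (Alg (idfun : {rmorphism K -> K})) z.
  by apply/(@field_is_unit K); rewrite u0 gz eqxx.
- move=> F j x; apply/eqP; apply: contrapT => /negP h; apply: (E F j x).
  exact/(@field_is_unit F).
Qed.

(** On each chart the value of [g] at the universal point vanishes in every field, hence is
    nilpotent; there are finitely many charts. *)
Lemma natural_fun_nilpotent :
  (forall (F : fieldType) (j : {rmorphism K -> F}) (x : X (Alg j)), g x = 0) ->
  exists n : nat, forall m, (n <= m)%N -> forall R (x : X R), g x ^+ m = 0.
Proof.
move=> g0; have [_ _ [m [U [sU cU]]]] := X_smooth.
have oU i' : is_open (U i') by have [] := sU i'.
have ch (a : 'I_m) : exists n : nat, forall R (x : X R), U a R x -> g x ^+ n = 0.
  have [_ [c [e [y [ynat ysol yinj ysm]]]]] := sU a.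
  have [R0 [h [surj ker E sol]]] := ex_universal_solution e.
  have [x0 Ux0 yx0] := iffLR (ysol R0 _) sol.
  have [n gn] : exists n, g x0 ^+ n = 0.
    apply: contrapT => no; have [|F [j]] := @not_nilpotent_field R0 (g x0).
      by move=> n gn; apply: no; exists n.
    have := g0 F (j \o str R0) (pmap X (to_push j) x0).
    by rewrite g_nat => ->; rewrite eqxx.
  exists n => R x Ux.
  have solx : solves e (y R x) by apply/ysol; exists x.
  have [l hl] := universal_solution_lift surj ker solx.
  have <- : pmap X l x0 = x.
    by apply: yinj => [||b] //; [exact: open_stable|rewrite ynat // yx0 hl].
  by rewrite g_nat -rmorphXn gn rmorph0.
have [n hn] := choice ch.
exists (\max_a n a) => q le R x.
have [r [S [l [a [[t [t1 tl]] ha]]]]] := open_cover x oU cU.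
apply: (cover_inj t1 tl) => b; rewrite rmorphXn rmorph0 -g_nat.
have le' : (n (a b) <= q)%N by apply: leq_trans le; exact: leq_bigmax.
by rewrite -(subnK le') exprD hn // mulr0.
Qed.

Lemma closed_frob_inverse : exists s : {rmorphism K -> K}, forall x, s x ^+ p = x.
Proof.
have p0 : (0 < p)%N by exact: prime_gt0 (pcharf_prime kp).
have ex (x : K) : exists y, y ^+ p = x.
  have [y hy] := @solve_monicpoly K p (fun n => if n is 0 then x else 0) p0.
  exists y; rewrite hy -(prednK p0) big_ord_recl /= expr0 mulr1 big1 ?addr0 // => a _.
  by rewrite mul0r.
have [s hs] := choice ex.
pose B : alg k := Alg i.
have fE (x : K) : frob kp B x = x ^+ p by [].
have fD (x y : K) : (x + y) ^+ p = x ^+ p + y ^+ p by exact: (rmorphD (frob kp B) x y).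
have inj : injective (fun x : K => x ^+ p) by move=> x y; rewrite -!fE => /fmorph_inj.
have [| |f hf] := @pack_rmorphism K K s.
- split=> [|x y]; apply: inj; rewrite /= hs ?expr0n ?gtn_eqF //.
  by rewrite fD !hs.
- split=> [|x y]; apply: inj; rewrite /= hs ?expr1n //.
  by rewrite exprMn !hs.
by exists f => x; rewrite hf.
Qed.

(** Descending induction on m for the vanishing of g^(p^m). If the next power vanishes, then g^(p^m)
    vanishes after the relative Frobenius, which is an epimorphism. *)
Lemma natural_fun_zero (z : X (base K)) : g z = 0 -> forall R (x : X R), g x = 0.
Proof.
move=> gz; have [n hn] := natural_fun_nilpotent (natural_fun_field_zero gz).
have p1 : (1 < p)%N by exact: prime_gt1 (pcharf_prime kp).
have [s hs] := closed_frob_inverse.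
pose B : alg k := Alg i.
have H m : forall R (x : X R), g x ^+ (p ^ m) = 0.
  have [m0 le0] : exists m0, (n <= p ^ m0)%N by exists n; exact: ltnW (ltn_expl _ p1).
  have [le|lt] := leqP m0 m.
    by apply: hn; apply: leq_trans le0 _; rewrite leq_exp2l.
  move: lt => /ltnW /subnK; move: (m0 - m)%N => q; elim: q m => [|q IH] m e R x.
    by apply: hn; rewrite -[m]add0n e.
  have {}IH := IH m.+1 (etrans (addnS q m) e).
  pose f (R : alg K) (x : X R) : R := g x ^+ (p ^ m).
  have f_nat : natural_fun f by move=> R1 S l a; rewrite /f g_nat rmorphXn.
  (* As [K] is perfect, [R] is the Frobenius restriction of [R0], whose structure map is twisted by
     the inverse of Frobenius. So points of X in [R] are points of X^(p) in [R0]. *)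
  pose R0 : alg B := @Alg K R (str R \o s).
  have l_ok b : (idfun : {rmorphism R -> R}) (str R b) = str (res (frob kp B) R0) b.
    by rewrite /= rmorphXn hs.
  pose l : ahom R (res (frob kp B) R0) := @AHom K R (res (frob kp B) R0) idfun l_ok.
  have -> : g x ^+ (p ^ m) = f _ (pmap X l x) by rewrite f_nat.
  pose h (S : alg B) (y : X (res (frob kp B) S)) : S := f (res (frob kp B) S) y.
  apply: (@frobenius_epi k p kp B d X h X_smooth _ _ R0 (pmap X l x)).
    move=> S T l' y.
    exact: (@f_nat (res (frob kp B) S) (res (frob kp B) T) (ahom_res (frob kp B) l') y).
  move=> S a; rewrite /h (@f_nat S (res (frob kp B) S) (frob_ahom kp S) a).
  by rewrite -[LHS]/((f S a) ^+ p) /f -exprM -expnSr; exact: IH.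
by move=> R x; have := H 0%N R x; rewrite expn0 expr1.
Qed.
End ClosedField.

(** An equality rather than an isomorphism, so that functors over [R] can be transported to a ring
    known to be nonzero. *)
Lemma comNz_eq (R : comPzRingType) : (1 : R) <> 0 ->
  exists S : comNzRingType, (S : comPzRingType) = R.
Proof.
case: R => T c /eqP nz.
pose R := GRing.ComPzRing.Pack c.
pose nzm := GRing.PzSemiRing_isNonZero.Build R nz.
exists (HB.pack (GRing.ComPzRing.sort R) (GRing.ComPzRing.class R) nzm : comNzRingType).
rewrite /=.
case: c @R nz nzm => *.
reflexivity.
Qed.

(** * Chain conditions and linear functionals *)

Section Noetherian.
Variables (S : comPzRingType).
Hypothesis noeS : noetherian S.

Lemma noetherian_max (Fam : (S -> Prop) -> Prop) :
  (exists I, Fam I) -> (forall I, Fam I -> is_ideal I) ->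
  exists I, Fam I /\ forall J, Fam J -> (forall x, I x -> J x) -> forall x, J x -> I x.
Proof.
move=> [I0 F0] idl; apply: contrapT => no.
pose T := {I : S -> Prop | Fam I}.
have step (I : T) : exists Jx : T * S,
    [/\ forall x, sval I x -> sval Jx.1 x, sval Jx.1 Jx.2 & ~ sval I Jx.2].
  apply: contrapT => no'; apply: no; exists (sval I); split; first exact: (proj2_sig I).
  move=> J FJ IJ x Jx; apply: contrapT => nx; apply: no'.
  by exists (exist _ J FJ, x).
have [nxt hn] := choice step.
pose I := fix I n : T := if n is n'.+1 then (nxt (I n')).1 else exist _ I0 F0.
pose s n := (nxt (I n)).2.
have mono m n : (m <= n)%N -> forall x, sval (I m) x -> sval (I n) x.
  move=> /subnK <-; elim: (n - m)%N => [//|q IH] x /IH h /=.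
  by have [h1 _ _] := hn (I (q + m)%N); exact: h1.
have [n [c e]] := noeS s.
have [_ _ []] := hn (I n).
rewrite -/(s n) e; apply: ideal_sum; first exact: idl (proj2_sig (I n)).
move=> i _; apply: (idealM (idl _ (proj2_sig (I n)))).
apply: (mono i.+1) => //.
by have [] := hn (I i).
Qed.

Lemma noetherian_fg (I : S -> Prop) : is_ideal I ->
  exists (n : nat) (a : 'I_n -> S), forall x, I x <-> span (fun y => exists i, y = a i) x.
Proof.
move=> hI.
pose Fam J := exists n (a : 'I_n -> S), (forall i, I (a i)) /\ J = span (fun y => exists i, y = a i).
have [||J [[n [a [Ia ->]]] mx]] := @noetherian_max Fam.
- by exists (span (fun y => exists i : 'I_0, y = 0)); exists 0, (fun=> 0); split=> // -[].
- by move=> J [n [a [_ ->]]]; exact: span_ideal.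
exists n, a => x; split; last by apply: span_min => // _ [i ->].
move=> Ix; pose a' (i : 'I_n.+1) := if unlift ord0 i is Some j then a j else x.
apply: (mx (span (fun y => exists i, y = a' i))).
- by exists n.+1, a'; split=> // i; rewrite /a'; case: unliftP.
- move=> y; apply: span_min; first exact: span_ideal.
  by move=> _ [i ->]; apply: span_mem; exists (lift ord0 i); rewrite /a' liftK.
- by apply: span_mem; exists ord0; rewrite /a' unlift_none.
Qed.

End Noetherian.

(** A nonzero finitely generated module has a residue field as a quotient, here for the ideal of the
    [q s]. A redundant first generator is dropped by induction; otherwise the quotient by the other
    generators is a nonzero cyclic module Q/J. *)
Lemma relation_field (Q : comPzRingType) r (q : 'I_r -> Q) : (exists s, q s <> 0) ->
  exists (K : fieldType) (j : {rmorphism Q -> K}) (b : 'I_r -> K),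
    (exists s, b s != 0) /\
    forall a : 'I_r -> Q, \sum_s q s * a s = 0 -> \sum_s b s * j (a s) = 0.
Proof.
elim: r q => [|r IH] q; first by case=> -[].
move=> [s0 qs0].
pose q' i := q (lift ord0 i).
have [/span_range [c hc]|no] := pselect (span (fun y => exists i, y = q' i) (q ord0)).
  have [s1 qs1] : exists s, q' s <> 0.
    apply: contrapT => no; apply: qs0; have z i : q' i = 0.
      by apply: contrapT => h; apply: no; exists i.
    have [i ->|->] := unliftP ord0 s0; first exact: z.
    by rewrite hc big1 // => i _; rewrite z mulr0.
  have [K [j [b [[s bs] rel]]]] := IH q' (ex_intro _ s1 qs1).
  exists K, j, (fun i => if unlift ord0 i is Some i' then b i' else \sum_i' j (c i') * b i').
  split; first by exists (lift ord0 s); rewrite liftK.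
  move=> a; rewrite !big_ord_recl hc unlift_none mulr_suml -big_split /= => e.
  rewrite mulr_suml -big_split /=.
  rewrite -[RHS](rel (fun i => a (lift ord0 i) + c i * a ord0)).
    apply: eq_bigr => i _; rewrite liftK rmorphD rmorphM; ring.
  by rewrite -[RHS]e; apply: eq_bigr => i _; rewrite -/(q' i); ring.
pose J x := span (fun y => exists i, y = q' i) (x * q ord0).
have [| |K [j [j0 _]]] := @ex_residue_field Q J.
- have hs := span_ideal (fun y => exists i, y = q' i); split; rewrite /J.
  + by rewrite mul0r; exact: span0.
  + by move=> x y hx hy; rewrite mulrDl; exact: (idealD hs).
  + by move=> a x hx; rewrite -mulrA; exact: (idealM hs).
- by rewrite /J mul1r.
exists K, j, (fun i => if unlift ord0 i is Some i' then 0 else 1).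
split; first by exists ord0; rewrite unlift_none oner_neq0.
move=> a; rewrite !big_ord_recl unlift_none mul1r => /eqP; rewrite addrC addr_eq0 => /eqP e.
rewrite j0 ?add0r.
  by rewrite big1 // => i _; rewrite liftK mul0r.
rewrite /J mulrC -[_ * _]opprK -e; apply: idealN; first exact: span_ideal.
apply: ideal_sum; first exact: span_ideal.
by move=> i _; apply: idealMr; [exact: span_ideal|apply: span_mem; exists i].
Qed.

(** Localizing first makes the elements of [M] invertible in the field, and the hypothesis says that
    the [q s] do not all die in the localization. *)
Lemma relation_closed_field (Q : comPzRingType) (M : Q -> Prop) r (q : 'I_r -> Q) :
  multiplicative_set M -> ~ (forall s, exists m, M m /\ m * q s = 0) ->
  exists (K : closedFieldType) (j : {rmorphism Q -> K}) (b : 'I_r -> K),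
    [/\ forall m, M m -> j m != 0, exists s, b s != 0 &
    forall a : 'I_r -> Q, \sum_s q s * a s = 0 -> \sum_s b s * j (a s) = 0].
Proof.
move=> hM nz; have [Q' [f [fu ff fk]]] := ex_localization hM.
have [|K0 [j [b [[s bs] rel]]]] := @relation_field Q' r (fun s => f (q s)).
  by apply: contrapT => no; apply: nz => s; apply: fk; apply: contrapT => h; apply: no; exists s.
have [K [i _]] := ex_closed_field K0.
exists K, (i \o (j \o f)), (fun s => i (b s)); split=> [m Mm||a e].
- by rewrite /= fmorph_eq0; apply/field_is_unit/is_unit_map/fu.
- by exists s; rewrite fmorph_eq0.
have e' : \sum_t f (q t) * f (a t) = 0.
  transitivity (f (\sum_t q t * a t)); last by rewrite e rmorph0.
  by rewrite rmorph_sum; apply: eq_bigr => t _; rewrite rmorphM.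
transitivity (i (\sum_t b t * j (f (a t)))); last by rewrite rel ?rmorph0.
by rewrite rmorph_sum; apply: eq_bigr => t _; rewrite rmorphM.
Qed.

(* A substitute for a linear functional from K to the fraction field of the image of S:
   finitely many elements of K are sent to S compatibly with the S-linear relations. *)
Lemma ex_functional (S : comPzRingType) (K : fieldType) (phi : {rmorphism S -> K}) (w0 : K)
    (L : seq K) : w0 != 0 ->
  exists F : K -> S, phi (F w0) != 0 /\
    forall s : seq (K * S), (forall x, x \in s -> x.1 \in w0 :: L) ->
      \sum_(x <- s) x.1 * phi x.2 = 0 -> phi (\sum_(x <- s) F x.1 * x.2) = 0.
Proof.
move=> w00; elim: L => [|w L [F [F0 hF]]].
  exists (fun=> 1); rewrite rmorph1 oner_neq0; split=> // s hs e.
  apply: (mulfI w00); rewrite mulr0 -e rmorph_sum mulr_sumr [LHS]big_seq [RHS]big_seq.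
  by apply: eq_bigr => x /hs; rewrite mem_seq1 mul1r => /eqP ->.
have [wL|wL] := boolP (w \in w0 :: L).
  exists F; split=> // s hs; apply: hF => x /hs; rewrite !inE => /or3P [->//|/eqP ->|->].
    by move: wL; rewrite inE.
  by rewrite orbT.
have [[a [t [a0 [tL e]]]]|no] := pselect (exists a (t : seq (K * S)),
    phi a != 0 /\ (forall x, x \in t -> x.1 \in w0 :: L) /\ phi a * w = \sum_(x <- t) x.1 * phi x.2).
  (* [w] depends on the earlier elements up to the denominator [a]. Since [S] has no division, the
     old values are multiplied by [a] instead. *)
  pose F' v := if v == w then \sum_(x <- t) F x.1 * x.2 else a * F v.
  exists F'; split.
    rewrite /F' ifN; first by rewrite rmorphM mulf_neq0.
    by apply: contraNneq wL => <-; rewrite mem_head.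
  move=> s hs es.
  pose c := \sum_(x <- s | x.1 == w) x.2.
  pose s' := [seq (x.1, a * x.2) | x <- s & x.1 != w] ++ [seq (x.1, x.2 * c) | x <- t].
  have -> : \sum_(x <- s) F' x.1 * x.2 = \sum_(x <- s') F x.1 * x.2.
    rewrite big_cat !big_map big_filter /= (bigID (fun x => x.1 == w)) /= addrC; congr (_ + _).
      by apply: eq_bigr => x /negbTE xw; rewrite /F' xw; ring.
    rewrite (eq_bigr (fun x => (\sum_(x <- t) F x.1 * x.2) * x.2)) => [|x /eqP ->]; last by rewrite /F' eqxx.
    by rewrite -mulr_sumr -/c mulr_suml; apply: eq_bigr => x _; rewrite mulrA.
  apply: hF.
    move=> x; rewrite mem_cat => /orP [/mapP [y]|/mapP [y /tL h ->]//].
    rewrite mem_filter => /andP [yw /hs] h -> /=; move: h; rewrite !inE => /or3P [->//|/eqP h|->].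
      by rewrite h eqxx in yw.
    by rewrite orbT.
  rewrite big_cat !big_map big_filter /=.
  have -> : \sum_(x <- t) x.1 * phi (x.2 * c) = phi a * (w * phi c).
    by rewrite mulrA e mulr_suml; apply: eq_bigr => x _; rewrite rmorphM mulrA.
  have -> : w * phi c = \sum_(x <- s | x.1 == w) x.1 * phi x.2.
    by rewrite /c rmorph_sum mulr_sumr; apply: eq_bigr => x /eqP ->.
  transitivity (phi a * \sum_(x <- s) x.1 * phi x.2); last by rewrite es mulr0.
  rewrite [in RHS](bigID (fun x => x.1 == w)) /= mulrDr addrC.
  congr (_ + _); rewrite mulr_sumr; apply: eq_bigr => x _; rewrite rmorphM; ring.
(* Here [w] is independent of the earlier elements over the image of [S], so its value is free and 0
   will do. *)
pose F' v := if v == w then 0 else F v.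
exists F'; split.
  by rewrite /F' ifN //; apply: contraNneq wL => <-; rewrite mem_head.
move=> s hs es; pose c := \sum_(x <- s | x.1 == w) x.2.
pose s' := [seq x <- s | x.1 != w].
have s'L x : x \in s' -> x.1 \in w0 :: L.
  rewrite mem_filter => /andP [xw /hs]; rewrite !inE => /or3P [->//|/eqP h|->].
    by rewrite h eqxx in xw.
  by rewrite orbT.
have es' : phi c * w = - \sum_(x <- s') x.1 * phi x.2.
  apply/eqP; rewrite -addr_eq0; apply/eqP.
  transitivity (\sum_(x <- s) x.1 * phi x.2) => //.
  rewrite [in RHS](bigID (fun x => x.1 == w)) /= big_filter.
  congr (_ + _); rewrite mulrC /c rmorph_sum mulr_sumr.
  by apply: eq_bigr => x /eqP ->.
have c0 : phi c = 0.
  apply/eqP; apply: contrapT => /negP c0; apply: no.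
  exists c, [seq (x.1, - x.2) | x <- s']; split=> //; split.
    by move=> x /mapP [y /s'L h ->].
  by rewrite es' big_map -sumrN; apply: eq_bigr => x _; rewrite rmorphN mulrN.
have -> : \sum_(x <- s) F' x.1 * x.2 = \sum_(x <- s') F x.1 * x.2.
  rewrite big_filter (bigID (fun x => x.1 == w)) /= big1 ?add0r; last first.
    by move=> x xw; rewrite /F' xw mul0r.
  by apply: eq_bigr => x /negbTE xw; rewrite /F' xw.
apply: hF => //; apply/eqP; rewrite -oppr_eq0 -es' c0 mul0r.
by [].
Qed.

(** * Smooth charts and base change of schemes *)

Record is_chart (B : comPzRingType) (X : pre B) (U : sub X) n c (e : 'I_c -> pexpr B n)
    (y : forall R : alg B, X R -> 'I_n -> R) : Prop := IsChart {
  chart_nat : forall (R S : alg B) (f : ahom R S) (x : X R), U R x ->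
    forall i, y S (pmap X f x) i = f (y R x i);
  chart_sol : forall (R : alg B) (v : 'I_n -> R),
    solves e v <-> exists2 x, U R x & forall i, y R x i = v i;
  chart_inj : forall (R : alg B) (x x' : X R), U R x -> U R x' ->
    (forall i, y R x i = y R x' i) -> x = x';
  chart_smooth : smooth_eqs e }.

Lemma std_smooth_chart (B : comPzRingType) d (X : pre B) (U : sub X) :
  std_smooth_open d U -> is_open U /\
  exists n c (e : 'I_c -> pexpr B n) (y : forall R : alg B, X R -> 'I_n -> R),
    is_chart U e y.
Proof.
move=> [oU [c [e [y [h1 h2 h3 h4]]]]]; split=> //.
exists (c + d)%N, c, e, y; split=> // R v sol.
have [N hN] := h4 R v sol.
(* Zero rows for the last d variables extend the inverse of the square minor to a right inverse of
   the whole Jacobian. *)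
exists (fun j i => if split j is inl j0 then N j0 i else 0) => i i'.
rewrite big_split_ord /= [X in _ + X]big1 ?addr0 => [|j _]; last first.
  by rewrite (unsplitK (inr j : 'I_c + 'I_d)%type) mulr0.
have := congr1 (fun M : 'M_c => M i i') hN; rewrite !mxE => <-.
apply: eq_bigr => j _.
by rewrite (unsplitK (inl j : 'I_c + 'I_d)%type) !mxE.
Qed.

Lemma std_smooth_bc (B B' : comPzRingType) (phi : {rmorphism B -> B'}) d (X : pre B)
    (U : sub X) : std_smooth_open d U -> std_smooth_open d (@sub_bc B B' phi X U).
Proof.
move=> [oU [c [e [y [h1 h2 h3 h4]]]]]; split; first exact: open_bc.
exists c, (fun i => pexpr_map phi (e i)), (fun R x => y (res phi R) x); split.
- by move=> R S f x Ux i; rewrite -(h1 _ _ (ahom_res phi f) x Ux).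
- move=> R v; rewrite -(h2 (res phi R)); split=> h i.
    by rewrite -peval_map h.
  by rewrite peval_map h.
- by move=> R x x' Ux Ux'; exact: (h3 (res phi R)).
- move=> R v sol; have [|N hN] := h4 (res phi R) v.
    by move=> i; rewrite -peval_map sol.
  exists N; rewrite -hN; congr (_ *m _); apply/matrixP => i j; rewrite !mxE.
  by rewrite pderiv_map peval_map.
Qed.

Lemma zariski_cover_bc (B B' : comPzRingType) (phi : {rmorphism B -> B'}) (R : alg B') n
    (S : 'I_n -> alg B') (l : forall i, ahom R (S i)) :
  zariski_cover l -> zariski_cover (fun i => ahom_res phi (l i)).
Proof. by move=> [r h]; exists r. Qed.

Lemma sheaf_bc (B B' : comPzRingType) (phi : {rmorphism B -> B'}) (X : pre B) :
  functorial X -> zariski_sheaf X -> zariski_sheaf (pre_bc phi X).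
Proof.
move=> fX sX R n S l x cov compat.
apply: (sX (res phi R) n (fun i => res phi (S i)) (fun i => ahom_res phi (l i)) x).
  exact: zariski_cover_bc.
move=> i j T g g' gg'.
(* The test ring [T] is only a B-algebra; [g] equips it with the structure of a B'-algebra, for
   which compatibility is known. *)
pose T' : alg B' := @Alg B' T (g \o str (S i)).
pose h : ahom (S i) T' := @AHom B' (S i) T' g (fun b => erefl).
have h'b b : g' (str (S j) b) = str T' b.
  by rewrite -(ahomE (l j)) -gg' (ahomE (l i)).
pose h' : ahom (S j) T' := @AHom B' (S j) T' g' h'b.
have tb b : (idfun : {rmorphism T -> T}) (str (res phi T') b) = str T b.
  by rewrite /= -(ahomE g).
pose t : ahom (res phi T') T := @AHom B (res phi T') T idfun tb.
have := compat i j T' h h' gg' => /(congr1 (pmap X t)).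
by rewrite !(pmap_comp fX (h := g)) // !(pmap_comp fX (h := g')).
Qed.

Lemma smooth_qc_bc (B B' : comPzRingType) (phi : {rmorphism B -> B'}) d (X : pre B) :
  smooth_qc_scheme d X -> smooth_qc_scheme d (pre_bc phi X).
Proof.
move=> [fX sX [m [U [sU cU]]]]; split; first exact: functorial_bc.
  exact: sheaf_bc.
exists m, (fun i => @sub_bc B B' phi X (U i)); split=> [i|]; first exact: std_smooth_bc.
exact: covers_bc.
Qed.

Lemma rmorphism_ext (R S : pzSemiRingType) (f g : {rmorphism R -> S}) :
  (forall x, f x = g x) -> f = g.
Proof.
case: f => f [[f1] [f2]]; case: g => g [[g1] [g2]] /= e.
have {}e : f = g by apply/funext.
by subst g; rewrite (Prop_irrelevance f1 g1) (Prop_irrelevance f2 g2).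
Qed.

(** Both sides of [pre_bc_comp] have this shape and differ only in the family [h]. Equality thus
    reduces to pointwise equality of ring morphisms. *)
Definition pre_along (B B' : comPzRingType) (h : forall R : alg B', {rmorphism B -> R})
    (hN : forall (R S : alg B') (f : ahom R S) b, f (h R b) = h S b) (X : pre B) : pre B' :=
  @Pre B' (fun R => X (@Alg B R (h R)))
    (fun R S f x => pmap X (@AHom B (@Alg B R (h R)) (@Alg B S (h S)) f (hN R S f)) x).

Lemma pre_bc_comp (B B' B'' : comPzRingType) (phi : {rmorphism B -> B'})
    (psi : {rmorphism B' -> B''}) (X : pre B) :
  pre_bc psi (pre_bc phi X) = pre_bc (psi \o phi) X.
Proof.
have E (h h' : forall R : alg B'', {rmorphism B -> R}) hN h'N : (forall R, h R = h' R) ->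
    pre_along (h := h) hN X = pre_along (h := h') h'N X.
  move=> e; have {}e : h = h' by apply: functional_extensionality_dep.
  by subst h'; rewrite (Prop_irrelevance hN h'N).
pose h1 (R : alg B'') : {rmorphism B -> R} := (str R \o psi) \o phi.
pose h2 (R : alg B'') : {rmorphism B -> R} := str R \o (psi \o phi).
have h1N (R S : alg B'') (f : ahom R S) b : f (h1 R b) = h1 S b by exact: ahomE.
have h2N (R S : alg B'') (f : ahom R S) b : f (h2 R b) = h2 S b by exact: ahomE.
transitivity (pre_along h1N X).
  rewrite /pre_bc /pre_along /=; congr (Pre _).
  apply: functional_extensionality_dep => R; apply: functional_extensionality_dep => S.
  apply: functional_extensionality_dep => f; apply: funext => x; congr (pmap X _ x).
  by rewrite /ahom_res; congr (AHom _); exact: Prop_irrelevance.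
rewrite (E h1 h2 h1N h2N); last by move=> R; exact: rmorphism_ext.
rewrite /pre_bc /pre_along /=; congr (Pre _).
apply: functional_extensionality_dep => R; apply: functional_extensionality_dep => S.
apply: functional_extensionality_dep => f; apply: funext => x; congr (pmap X _ x).
by rewrite /ahom_res; congr (AHom _); exact: Prop_irrelevance.
Qed.

Lemma universally_closed_bc (B B' : comPzRingType) (phi : {rmorphism B -> B'}) (X : pre B) :
  universally_closed X -> universally_closed (pre_bc phi X).
Proof. by move=> uX B'' psi; rewrite pre_bc_comp; exact: uX. Qed.

Lemma geometrically_connected_bc (B B' : comPzRingType) (phi : {rmorphism B -> B'}) (X : pre B) :
  geometrically_connected_fibres X -> geometrically_connected_fibres (pre_bc phi X).
Proof. by move=> gX K psi; rewrite pre_bc_comp; exact: gX. Qed.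

Section Charts.
Variables (Q : comNzRingType) (X : pre Q).
Hypothesis fX : functorial X.

Section OneChart.
Variables (U : sub X) (n c : nat) (e : 'I_c -> pexpr Q n)
  (y : forall R : alg Q, X R -> 'I_n -> R).
Hypotheses (oU : is_open U) (ch : is_chart U e y).

Lemma ex_universal_point : exists (R0 : alg Q) (h : ahom (Palg Q n) R0) (x0 : X R0),
  [/\ U x0, forall i, y x0 i = h (Pvar Q i), forall r, exists t, h (Pev t) = r
    & forall (S : alg Q) (x : X S), U x -> exists l : ahom R0 S, pmap X l x0 = x].
Proof.
have [R0 [h [surj ker E sol]]] := ex_universal_solution e.
have [x0 Ux0 yx0] := iffLR (chart_sol ch _) sol.
exists R0, h, x0; split=> // [r|S x Ux].
  by have [z <-] := surj r; have [t <-] := Pev_surj z; exists t.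
have solx : solves e (y x) by apply/(chart_sol ch); exists x.
have [l hl] := universal_solution_lift surj ker solx; exists l.
apply: (chart_inj ch) => // [|i]; first exact: open_stable.
by rewrite (chart_nat ch) // yx0 hl.
Qed.

Lemma chart_function (f : forall R : alg Q, X R -> R) : natural_fun f ->
  exists F : pexpr Q n, forall R (x : X R), U x -> f R x = peval (y x) F.
Proof.
move=> fnat; have [R0 [h [x0 [Ux0 yx0 surj lift]]]] := ex_universal_point.
have [F hF] := surj (f _ x0); exists F => R x Ux.
have [l <-] := lift R x Ux; rewrite fnat -hF /Pev peval_hom peval_hom.
by apply: eq_peval => i; rewrite (chart_nat ch) // yx0.
Qed.

End OneChart.

Lemma eq_lift0 n (i j : 'I_n) : (lift ord0 i == lift ord0 j :> 'I_n.+1) = (i == j).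
Proof. exact: (inj_eq (@lift_inj n.+1 ord0)). Qed.

Lemma eq_lift0F n (i : 'I_n) : (lift ord0 i == ord0 :> 'I_n.+1) = false.
Proof. by []. Qed.

Lemma eq_0liftF n (i : 'I_n) : (ord0 == lift ord0 i :> 'I_n.+1) = false.
Proof. by []. Qed.

Section Localized.
Variables (n c : nat) (e : 'I_c -> pexpr Q n) (H : pexpr Q n).

(** Rabinowitsch's trick: the new variable [ord0] is an inverse of [H], so these equations describe
    the locus of the chart where [H] is invertible. *)
Definition ext_eqs (i : 'I_c.+1) : pexpr Q n.+1 :=
  if unlift ord0 i is Some i' then pexpr_up (e i')
  else PAdd (PMul (PVar ord0) (pexpr_up H)) (PCst (-1)).

Lemma peval_up (R : alg Q) (v : 'I_n.+1 -> R) t :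
  peval v (pexpr_up t) = peval (fun i => v (lift ord0 i)) t.
Proof. exact: peval_subst. Qed.

Lemma solves_ext (R : alg Q) (v : 'I_n.+1 -> R) : solves ext_eqs v <->
  solves e (fun i => v (lift ord0 i)) /\ v ord0 * peval (fun i => v (lift ord0 i)) H = 1.
Proof.
split=> [sol|[sol e1] i].
  split=> [i|].
    by have := sol (lift ord0 i); rewrite /ext_eqs liftK peval_up.
  have := sol ord0; rewrite /ext_eqs unlift_none /= peval_up rmorphN rmorph1.
  by move/eqP; rewrite subr_eq0 => /eqP.
rewrite /ext_eqs; case: unliftP => [i' _|_]; first by rewrite peval_up.
by rewrite /= peval_up e1 rmorphN rmorph1 subrr.
Qed.

Lemma peval_pderiv_up (R : alg Q) (v : 'I_n.+1 -> R) t j :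
  peval v (pderiv (lift ord0 j) (pexpr_up t)) =
    peval (fun i => v (lift ord0 i)) (pderiv j t).
Proof.
elim: t => [i|b|t1 IH1 t2 IH2|t1 IH1 t2 IH2] //=.
- by rewrite -!/(pexpr_up _) IH1 IH2.
- by rewrite -!/(pexpr_up _) IH1 IH2 !peval_up.
Qed.

Lemma peval_pderiv0_up (R : alg Q) (v : 'I_n.+1 -> R) (t : pexpr Q n) :
  peval v (pderiv ord0 (pexpr_up t)) = 0.
Proof.
elim: t => [i|b|t1 IH1 t2 IH2|t1 IH1 t2 IH2] /=; rewrite ?rmorph0 //.
- by rewrite -!/(pexpr_up _) IH1 IH2 addr0.
- by rewrite -!/(pexpr_up _) IH1 IH2 mul0r mulr0 addr0.
Qed.

Lemma smooth_ext : smooth_eqs e -> smooth_eqs ext_eqs.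
Proof.
move=> sm R v /solves_ext [sol e1]; have [N hN] := sm _ _ sol.
pose z := v ord0; pose w i := v (lift ord0 i).
pose D i := \sum_j peval w (pderiv j H) * N j i.
(* The Jacobian is block triangular, and the derivative of z H - 1 in z is [H], with inverse [z].
   The corner block cancels the derivatives z dH of the new equation in the old variables. *)
exists (fun j i =>
  match unlift ord0 j, unlift ord0 i with
  | None, None => z
  | None, Some i' => - (z * (z * D i'))
  | Some j', Some i' => N j' i'
  | Some _, None => 0 end) => i i'.
rewrite big_ord_recl unlift_none.
under eq_bigr do rewrite liftK.
rewrite /ext_eqs; case: (unliftP ord0 i) => [k ->|->]; case: (unliftP ord0 i') => [k' ->|->].
- rewrite peval_pderiv0_up mul0r add0r eq_lift0 -hN.
  by apply: eq_bigr => j _; rewrite peval_pderiv_up.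
- rewrite peval_pderiv0_up mul0r add0r eq_lift0F.
  by rewrite big1 // => j _; rewrite mulr0.
- rewrite eq_0liftF /= peval_up rmorph1 mul1r peval_pderiv0_up mulr0 addr0 rmorph0 addr0.
  rewrite [X in _ + X](_ : _ = z * D k').
    rewrite -/z; have -> : peval (fun i => v (lift ord0 i)) H * - (z * (z * D k')) =
      - ((z * peval w H) * (z * D k')) by rewrite /w; ring.
    by rewrite e1 mul1r addNr.
  rewrite /D mulr_sumr; apply: eq_bigr => j _.
  by rewrite peval_pderiv_up mul0r add0r addr0 mulrA.
- rewrite /= peval_up rmorph1 mul1r peval_pderiv0_up mulr0 addr0 rmorph0 addr0.
  rewrite big1 ?addr0 => [|j _]; last by rewrite mulr0.
  by rewrite mulrC e1 ?eqxx.
Qed.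

End Localized.
End Charts.

(** * Transfer of a function to a fibre along linear relations *)

Section Overlap.
Variables (k : fieldType) (Q : comNzRingType) (fk : {rmorphism k -> Q}) (X : pre Q).
Hypothesis fX : functorial X.
Variables (K : comNzRingType) (j : {rmorphism Q -> K}) (r : nat) (q : 'I_r -> Q) (b : 'I_r -> K).
Hypothesis rel : forall a : 'I_r -> Q, \sum_s q s * a s = 0 -> \sum_s b s * j (a s) = 0.
Variables (U U' : sub X) (n c n' c' : nat) (e : 'I_c -> pexpr Q n) (e' : 'I_c' -> pexpr Q n')
  (y : forall R : alg Q, X R -> 'I_n -> R) (y' : forall R : alg Q, X R -> 'I_n' -> R).
Hypotheses (oU : is_open U) (oU' : is_open U') (ch : is_chart U e y) (ch' : is_chart U' e' y').
Variables (u : 'I_r -> pexpr Q n) (u' : 'I_r -> pexpr Q n').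
Hypothesis agree : forall (R : alg Q) (x : X R), U x -> U' x ->
  \sum_s str R (q s) * peval (y x) (u s) = \sum_s str R (q s) * peval (y' x) (u' s).

(** Each small locus in the overlap is again given by smooth equations, and there the difference of
    the two expressions is one polynomial combination with coefficients [q s]. Its vanishing over
    [Q] passes to [K] by [flat_relation]. *)
Lemma overlap_agree (R : alg K) (x : pre_bc j X R) : U x -> U' x ->
  \sum_s str R (b s) * peval (R := res j R) (y x) (u s) =
  \sum_s str R (b s) * peval (R := res j R) (y' x) (u' s).
Proof.
move=> Ux U'x; have [R0 [h0 [x0 [Ux0 yx0 surj lift0]]]] := ex_universal_point fX oU ch.
have [I hI] := oU' x0.
have [l lx] := lift0 (res j R) x Ux.
have Iunit : unit_ideal (fun s : R => exists2 a, I a & s = l a).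
  by apply/(hI (res j R) l); rewrite lx.
apply/eqP; rewrite -subr_eq0; apply/eqP; apply: (cover_vanish Iunit).
(* [I] cuts out the second open set inside the first chart, so the overlap is covered by the loci
   where some element of [I], a polynomial [H] in the coordinates, is invertible. *)
move=> _ [i0 Ii0 ->]; have [H hH] := surj i0.
have [S0 [f loc]] := ex_localization (powers_mult (l i0 : R)).
have [fu _ fkk] := loc.
pose S : alg K := push (R := R) f; pose fS : ahom R S := to_push (R := R) f.
pose x' : X (res j S) := pmap X (ahom_res j fS) x.
have Ux' : U x' by exact: open_stable.
have U'x' : U' x' by exact: open_stable.
set D := _ - _.
suff fD : f D = 0 by have [_ [[m ->] e0]] := fkk _ fD; exists m.
have yx' i : y x' i = f (y x i) by exact: (chart_nat ch).
have y'x' i : y' x' i = f (y' x i) by exact: (chart_nat ch').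
suff : \sum_s str S (b s) * (peval (R := res j S) (y x') (u s) - peval (R := res j S) (y' x') (u' s)) = 0.
  move=> <-; rewrite /D rmorphB !rmorph_sum -sumrB; apply: eq_bigr => s _.
  rewrite !rmorphM -mulrBr; congr (_ * (_ - _)).
    rewrite -[LHS]/(ahom_res j fS _) peval_hom.
    by apply: (@eq_peval _ _ (res j S)) => i; rewrite yx'.
  rewrite -[LHS]/(ahom_res j fS _) peval_hom.
  by apply: (@eq_peval _ _ (res j S)) => i; rewrite y'x'.
have [w hw] : is_unit (f (l i0)) by apply: fu; exists 1.
pose v (i : 'I_n.+1) : S := if unlift ord0 i is Some i' then y x' i' else w.
have vl i : v (lift ord0 i) = y x' i by rewrite /v liftK.
have solx' : solves (R := res j S) e (y x') by apply/(chart_sol ch); exists x'.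
have Hx' : peval (R := res j S) (y x') H = f (l i0).
  rewrite -hH -[RHS]/(ahom_comp (ahom_res j fS) l (h0 (Pev H))) /Pev !peval_hom.
  apply: (@eq_peval _ _ (res j S)) => i.
  by rewrite yx' -yx0 -[RHS]/(f (l (y x0 i))) -(chart_nat ch l Ux0) lx.
have solv : solves (R := res j S) (ext_eqs e H) v.
  apply/solves_ext; split=> [i|].
    by rewrite -[RHS](solx' i); apply: (@eq_peval _ _ (res j S)) => i'; exact: vl.
  rewrite /v unlift_none mulrC -[RHS]hw; congr (_ * _).
  by rewrite -Hx'; apply: (@eq_peval _ _ (res j S)) => i'; exact: vl.
have [R1 [h1 [surj1 ker1 E1 sol1]]] := ex_universal_solution (ext_eqs e H).
have [sol1e sol1H] := iffLR (solves_ext _ _ _) sol1.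
have [x1 Ux1 yx1] := iffLR (chart_sol ch _) sol1e.
have [l1 lx1] := lift0 R1 x1 Ux1.
have l1E i : l1 (h0 (Pvar Q i)) = h1 (Pvar Q (lift ord0 i)).
  by rewrite -yx1 -lx1 (chart_nat ch) // yx0.
have U'x1 : U' x1.
  rewrite -lx1; apply/hI; apply/unit_idealE.
  have : is_unit (l1 i0).
    exists (h1 (Pvar Q ord0)); rewrite mulrC -[RHS]sol1H; congr (_ * _).
    by rewrite -hH /Pev peval_hom peval_hom; apply: eq_peval => i; exact: l1E.
  move=> /unit_unit_ideal/unit_idealE; apply: span_min; first exact: span_ideal.
  by move=> _ ->; apply: span_mem; exists i0.
(* On this locus the coordinates of the second chart are polynomials [W] in those of the first and
   the inverse of [H]. *)
have /choice [W hW] i : exists t, h1 (Pev t) = y' x1 i.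
  by have [z <-] := surj1 (y' x1 i); have [t <-] := Pev_surj z; exists t.
have ptW (T : alg Q) (v1 : 'I_n.+1 -> T) : solves (ext_eqs e H) v1 ->
    exists x2 : X T, [/\ U x2, U' x2, forall i, y x2 i = v1 (lift ord0 i)
      & forall i, y' x2 i = peval v1 (W i)].
  move=> sv; have [l2 hl2] := universal_solution_lift surj1 ker1 sv.
  exists (pmap X l2 x1); split; [exact: open_stable|exact: open_stable| |] => i.
    by rewrite (chart_nat ch) // yx1 hl2.
  rewrite (chart_nat ch') // -hW /Pev peval_hom peval_hom.
  by apply: eq_peval => i'; exact: hl2.
pose ww s := PAdd (pexpr_up (u s)) (popp (psubst W (u' s))).
have wwE (T : alg Q) (v1 : 'I_n.+1 -> T) (x2 : X T) s :
    (forall i, y x2 i = v1 (lift ord0 i)) -> (forall i, y' x2 i = peval v1 (W i)) ->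
    peval v1 (ww s) = peval (y x2) (u s) - peval (y' x2) (u' s).
  move=> e1 e2; rewrite /ww /= rmorphN rmorph1 mulN1r peval_up peval_subst.
  by congr (_ - _); apply: eq_peval => i; rewrite ?e1 ?e2.
have [x2 [Ux2 U'x2 yx2 y'x2]] := ptW _ _ solv.
have ex2 : x2 = x'.
  by apply: (chart_inj ch) => // i; rewrite yx2 vl.
transitivity (\sum_s str S (b s) * peval (R := res j S) v (ww s)).
  apply: eq_bigr => s _; congr (_ * _); rewrite -ex2; symmetry.
  exact: (wwE (res j S) v x2 s yx2 y'x2).
apply: (@flat_relation k Q fk n.+1 c.+1 (ext_eqs e H) (smooth_ext (H := H) (chart_smooth ch))
  K j r q b ww rel) solv.
move=> T v1 sv; have [x3 [Ux3 U'x3 yx3 y'x3]] := ptW _ _ sv.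
transitivity (\sum_s (str T (q s) * peval (y x3) (u s) - str T (q s) * peval (y' x3) (u' s))).
  by apply: eq_bigr => s _; rewrite (wwE _ _ x3) // mulrBr.
by rewrite sumrB agree // subrr.
Qed.
End Overlap.

Lemma cover_eq (B : comPzRingType) (R S : alg B) n (T : 'I_n -> alg B)
    (l : forall i, ahom R (T i)) (h : ahom R S) (v w : S) :
  zariski_cover l ->
  (forall i (S' : alg B) (f : ahom S S') (t : ahom (T i) S'),
     (forall r, t (l i r) = f (h r)) -> f v = f w) -> v = w.
Proof.
move=> [r [r1 rl]] H; apply/eqP; rewrite -subr_eq0; apply/eqP.
apply: (cover_vanish (unit_ideal_map h r1)) => _ [_ [i ->] ->].
have [S0 [f loc]] := ex_localization (powers_mult (h (r i))).
have [fu _ fk] := loc.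
have [t0 ht] : exists t : {rmorphism T i -> S0}, forall a, t (l i a) = (f \o h) a.
  apply: (localizes_lift (powers_mult (r i))); first exact/is_localizationP.
  by move=> _ [m ->] /=; rewrite !rmorphXn; apply/is_unitX/fu; exists 1.
have tb b : t0 (str (T i) b) = str (push (R := S) f) b.
  by rewrite -(ahomE (l i)) ht /= ahomE.
pose t : ahom (T i) (push (R := S) f) := @AHom B (T i) (push (R := S) f) t0 tb.
have fvw := H i (push (R := S) f) (to_push f) t ht.
have [|_ [[m ->] e]] := fk (v - w); last by exists m.
by rewrite rmorphB -[f v]/(to_push f v) fvw subrr.
Qed.

Record chart_data (B : comPzRingType) (X : pre B) := ChartData {
  cd_n : nat; cd_c : nat;
  cd_e : 'I_cd_c -> pexpr B cd_n;
  cd_y : forall R : alg B, X R -> 'I_cd_n -> R }.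

Lemma smooth_charts (B : comPzRingType) d (X : pre B) : smooth_qc_scheme d X ->
  exists m (U : 'I_m -> sub X) (cd : 'I_m -> chart_data X),
    [/\ forall a, is_open (U a), covers U
      & forall a, is_chart (U a) (@cd_e _ _ (cd a)) (@cd_y _ _ (cd a))].
Proof.
move=> [_ _ [m [U [sU cU]]]].
have ex a : exists cd : chart_data X, is_chart (U a) (@cd_e _ _ cd) (@cd_y _ _ cd).
  have [_ [n [c [e [y h]]]]] := std_smooth_chart (sU a).
  by exists (ChartData e y).
have [cd hcd] := choice ex.
by exists m, U, cd; split=> // a; have [] := sU a.
Qed.

Section Glue.
Variables (k : fieldType) (Q : comNzRingType) (fk : {rmorphism k -> Q}) (X : pre Q).
Hypothesis fX : functorial X.
Variables (m : nat) (U : 'I_m -> sub X) (cd : 'I_m -> chart_data X).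
Hypotheses (oU : forall a, is_open (U a)) (cU : covers U)
  (ch : forall a, is_chart (U a) (@cd_e _ _ (cd a)) (@cd_y _ _ (cd a))).
Variables (K : comNzRingType) (j : {rmorphism Q -> K}) (r : nat) (q : 'I_r -> Q) (b : 'I_r -> K).
Hypothesis rel : forall a : 'I_r -> Q, \sum_s q s * a s = 0 -> \sum_s b s * j (a s) = 0.
Variables (u : forall a, 'I_r -> pexpr Q (cd_n (cd a))) (f0 : forall R : alg Q, X R -> R).
Hypothesis fu : forall a R (x : X R), U a x ->
  f0 x = \sum_s str R (q s) * peval (@cd_y _ _ (cd a) R x) (u a s).

Let G a (R : alg K) (x : X (res j R)) : R :=
  \sum_s str R (b s) * peval (R := res j R) (@cd_y _ _ (cd a) _ x) (u a s).

Let G_agree a a' R x : U a x -> U a' x -> @G a R x = G a' x.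
Proof.
move=> Ux U'x; apply: (overlap_agree fk fX rel (oU a) (oU a') (ch a) (ch a')) Ux U'x.
by move=> R' x' Ux' U'x'; rewrite -!fu.
Qed.

Let G_nat a (R S : alg K) (l : ahom R S) x : U a x -> G a (pmap X (ahom_res j l) x) = l (@G a R x).
Proof.
move=> Ux; rewrite /G rmorph_sum; apply: eq_bigr => s _; rewrite rmorphM ahomE; congr (_ * _).
rewrite -[RHS]/(ahom_res j l _) peval_hom; apply: (@eq_peval _ _ (res j S)) => i.
exact: (chart_nat (ch a)).
Qed.

Let good (R : alg K) (x : X (res j R)) (v : R) := forall a (S : alg K) (l : ahom R S),
  U a (pmap X (ahom_res j l) x) -> l v = G a (pmap X (ahom_res j l) x).

(** The local expressions with [q] replaced by [b] agree on overlaps and are glued. [good]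
    prescribes the value of a point after every further extension that meets a chart, which makes it
    unique and hence natural. *)
Lemma ex_glued_function : exists g : forall R : alg K, pre_bc j X R -> R, natural_fun g /\
  forall a R (x : pre_bc j X R), U a x ->
    g R x = \sum_s str R (b s) * peval (R := res j R) (@cd_y _ _ (cd a) _ x) (u a s).
Proof.
have cov (R : alg K) (x : pre_bc j X R) :=
  @open_cover _ (pre_bc j X) _ _ R x (fun a => open_bc (oU a)) (covers_bc cU).
have uniq (R : alg K) (x : X (res j R)) (v v' : R) : good x v -> good x v' -> v = v'.
  move=> gv gv'; have [n [S [l [a [[t [t1 tl]] ha]]]]] := cov R x.
  by apply: (cover_inj t1 tl) => i; rewrite (gv _ _ _ (ha i)) (gv' _ _ _ (ha i)).
have ex (R : alg K) (x : X (res j R)) : exists v, good x v.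
  have [n [S [l [a [cl ha]]]]] := cov R x.
  have [t [t1 tl]] := cl.
  have [i i' T g g' gg'|v hv] := cover_glue t1 tl (x := fun i => G (a i) (pmap X (ahom_res j (l i)) x)).
    pose T1 : alg K := @Alg K T (g \o str (S i)).
    pose h : ahom (S i) T1 := @AHom K (S i) T1 g (fun _ => erefl).
    have h'b c : g' (str (S i') c) = str T1 c.
      by rewrite -(ahomE (l i')) -gg' (ahomE (l i)).
    pose h' : ahom (S i') T1 := @AHom K (S i') T1 g' h'b.
    pose xT : X (res j T1) := pmap X (ahom_res j (ahom_comp h (l i))) x.
    have e1 : pmap X (ahom_res j h) (pmap X (ahom_res j (l i)) x) = xT by exact: pmap_comp.
    have e2 : pmap X (ahom_res j h') (pmap X (ahom_res j (l i')) x) = xT.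
      by apply: pmap_comp => // y; exact: gg'.
    rewrite -[LHS]/(h _) -[RHS]/(h' _) -!G_nat; try exact: ha.
    have Ux1 : U (a i) xT by rewrite -e1; apply: open_stable => //; exact: ha.
    have Ux2 : U (a i') xT by rewrite -e2; apply: open_stable => //; exact: ha.
    by rewrite e1 e2; exact: (@G_agree _ _ T1 xT Ux1 Ux2).
  exists v => c S' h Uc.
  apply: (cover_eq (h := h) cl) => i S'' f t' ht.
  pose xT : X (res j S'') := pmap X (ahom_res j (ahom_comp f h)) x.
  have e1 : pmap X (ahom_res j f) (pmap X (ahom_res j h) x) = xT by exact: pmap_comp.
  have e2 : pmap X (ahom_res j t') (pmap X (ahom_res j (l i)) x) = xT.
    by apply: pmap_comp => // y; rewrite /= -ht.
  rewrite -G_nat //; rewrite -ht hv -G_nat; last exact: ha.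
  have Ux1 : U c xT by rewrite -e1; exact: open_stable.
  have Ux2 : U (a i) xT by rewrite -e2; apply: open_stable => //; exact: ha.
  by rewrite e1 e2; exact: (@G_agree _ _ S'' xT Ux2 Ux1).
pose g (R : alg K) (x : X (res j R)) : R := sval (cid (ex R x)).
have gP (R : alg K) (x : X (res j R)) : good x (g R x) by exact: (proj2_sig (cid (ex R x))).
exists g; split=> [R S l x|a R x Ux].
  apply: (uniq _ (pmap X (ahom_res j l) x)); first exact: gP.
  move=> a T h Ua; rewrite (pmap_comp fX (h := ahom_res j (ahom_comp h l))) //.
  rewrite -[LHS]/(ahom_comp h l (g R x)); apply: gP.
  by rewrite -(pmap_comp fX (f := ahom_res j l) (g := ahom_res j h)).
have id_x : pmap X (ahom_res j (ahom_id R)) x = x by exact: pmap_id.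
by have := gP R x a R (ahom_id R); rewrite id_x => /(_ Ux).
Qed.

End Glue.

Lemma pexpr_map_comp (A B C : Type) (f : A -> B) (g : B -> C) n (t : pexpr A n) :
  pexpr_map g (pexpr_map f t) = pexpr_map (fun x => g (f x)) t.
Proof. by elim: t => [i|b|t1 IH1 t2 IH2|t1 IH1 t2 IH2] //=; rewrite IH1 IH2. Qed.

Lemma eq_pexpr_map (A B : Type) (f g : A -> B) n (t : pexpr A n) :
  (forall x, f x = g x) -> pexpr_map f t = pexpr_map g t.
Proof. by move=> e; elim: t => [i|b|t1 IH1 t2 IH2|t1 IH1 t2 IH2] //=; rewrite ?e ?IH1 ?IH2. Qed.

(** * Vanishing of a function that vanishes on a section *)

Section Constant.
Variables (k : fieldType) (p : nat) (kp : p \in [pchar k]).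
Variables (Q : comNzRingType) (fk : {rmorphism k -> Q}) (d : nat) (X : pre Q).
Hypotheses (X_smooth : smooth_qc_scheme d X) (X_closed : universally_closed X)
  (X_conn : geometrically_connected_fibres X).
Let fX : functorial X. Proof. by case: X_smooth. Qed.

Variables (m : nat) (U : 'I_m -> sub X) (cd : 'I_m -> chart_data X).
Hypotheses (oU : forall a, is_open (U a)) (cU : covers U)
  (ch : forall a, is_chart (U a) (@cd_e _ _ (cd a)) (@cd_y _ _ (cd a))).

Lemma charts_zero (f : forall R : alg Q, X R -> R) : natural_fun f ->
  (forall a R (x : X R), U a x -> f R x = 0) -> forall R (x : X R), f R x = 0.
Proof.
move=> fnat f0 R x; have [n [S [l [a [[t [t1 tl]] ha]]]]] := open_cover x oU cU.
by apply: (cover_inj t1 tl) => i; rewrite rmorph0 -fnat (f0 _ _ _ (ha i)).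
Qed.

Section Field.
Variables (K : closedFieldType) (j : {rmorphism Q -> K}) (r : nat) (q : 'I_r -> Q) (b : 'I_r -> K).
Hypothesis rel : forall a : 'I_r -> Q, \sum_s q s * a s = 0 -> \sum_s b s * j (a s) = 0.
Variables (u : forall a, 'I_r -> pexpr Q (cd_n (cd a))) (f : forall R : alg Q, X R -> R).
Hypotheses (f_nat : natural_fun f) (fu : forall a R (x : X R), U a x ->
  f x = \sum_s str R (q s) * peval (@cd_y _ _ (cd a) R x) (u a s)).
Variables (z : X (base Q)) (fz : f z = 0).

(* The function sum b_s u_s on the proper and connected fibre over K vanishes. *)
Lemma field_relation a : span (peqs (fun i => pexpr_map j (@cd_e _ _ (cd a) i)))
  (\sum_s Pcst K (cd_n (cd a)) (b s) * Pev (pexpr_map j (u a s))).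
Proof.
have [g [gnat gU]] := ex_glued_function fk fX oU cU ch rel fu.
pose jz : ahom (base Q) (res j (base K)) := @AHom Q (base Q) (res j (base K)) j (fun _ => erefl).
(* Near [z] the equation f z = 0 is a relation between the [q s] over a localization of [Q]. Once
   denominators are cleared, [rel] turns it into the vanishing of [g] at the image of [z]. *)
have gz : g (base K) (pmap X jz z) = 0.
  have [n [S [l [c [[t [t1 tl]] hc]]]]] := open_cover z oU cU.
  have [_ [i ->] ji] := unit_ideal_field_mem j t1.
  have [h hl] : exists h : {rmorphism S i -> K}, forall x, h (l i x) = j x.
    apply: (localizes_lift (powers_mult (t i))); first exact/is_localizationP.
    by move=> _ [e ->]; rewrite rmorphXn; apply/is_unitX/field_is_unit.
  have hb x : h (str (S i) x) = str (res j (base K)) x by rewrite -(ahomE (l i)) hl.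
  pose hh : ahom (S i) (res j (base K)) := @AHom Q (S i) (res j (base K)) h hb.
  have ez : pmap X jz z = pmap X hh (pmap X (l i) z).
    by symmetry; apply: pmap_comp => // x; rewrite /= hl.
  have Uz : U (c i) (pmap X jz z) by rewrite ez; apply: open_stable => //; exact: hc.
  rewrite (gU _ _ _ Uz).
  pose v s := peval (@cd_y _ _ (cd (c i)) _ (pmap X (l i) z)) (u (c i) s).
  have ev s : peval (R := res j (base K)) (@cd_y _ _ (cd (c i)) _ (pmap X jz z)) (u (c i) s) = h (v s).
    rewrite /v -[RHS]/(hh _) peval_hom; apply: (@eq_peval _ _ (res j (base K))) => i'.
    by rewrite ez (chart_nat (ch (c i))).
  have [_ frac ker] := tl i.
  have /choice [w hw] s : exists an : Q * nat, v s * l i (t i) ^+ an.2 = l i an.1.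
    by have [x [e E]] := frac (v s); exists (x, e).
  pose N := (\sum_s (w s).2)%N.
  pose a' s := (w s).1 * t i ^+ (N - (w s).2).
  have hw' s : v s * l i (t i) ^+ N = l i (a' s).
    have le : ((w s).2 <= N)%N by rewrite /N (bigD1 s) //= leq_addr.
    by rewrite /a' rmorphM -hw rmorphXn -mulrA -exprD subnKC.
  have [e he] : exists e, t i ^+ e * \sum_s q s * a' s = 0.
    apply: ker; transitivity (f (pmap X (l i) z) * l i (t i) ^+ N).
      rewrite (fu (hc i)) rmorph_sum mulr_suml; apply: eq_bigr => s _.
      by rewrite rmorphM -hw' -[l i (q s)]/(l i (str (base Q) (q s))) ahomE mulrA.
    by rewrite f_nat fz rmorph0 mul0r.
  have := @rel (fun s => t i ^+ e * a' s).
  under eq_bigr do rewrite mulrCA.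
  rewrite -mulr_sumr he => /(_ erefl) E.
  apply: (mulfI (_ : j (t i) ^+ (e + N) != 0)); first by rewrite expf_neq0.
  rewrite mulr0 -[RHS]E mulr_sumr; apply: eq_bigr => s _.
  rewrite ev -[str _ _]/(b s) rmorphM rmorphXn -(hl (a' s)) -hw' rmorphM rmorphXn hl exprD; ring.
have g0 := natural_fun_zero kp (j \o fk) (smooth_qc_bc j X_smooth)
  (universally_closed_bc X_closed) (X_conn j) gnat gz.
have [R0 [h [surj ker E sol]]] := ex_universal_solution (fun i => pexpr_map j (@cd_e _ _ (cd a) i)).
have sol' : solves (R := res j R0) (@cd_e _ _ (cd a)) (fun i => h (Pvar K i)).
  by move=> i; rewrite -[RHS](sol i) peval_map.
have [x Ux yx] := iffLR (chart_sol (ch a) _) sol'.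
apply/ker; rewrite rmorph_sum -[RHS](g0 R0 x) (gU _ _ _ Ux); apply: eq_bigr => s _.
rewrite rmorphM -[Pcst _ _ (b s)]/(str (Palg K _) (b s)) ahomE -E peval_map; congr (_ * _).
by apply: (@eq_peval _ _ (res j R0)) => i; rewrite yx.
Qed.

End Field.
End Constant.

Section ConstantMain.
Variables (k : fieldType) (p : nat) (kp : p \in [pchar k]).
Variables (Q : comNzRingType) (fk : {rmorphism k -> Q}) (d : nat) (X : pre Q).
Hypotheses (X_smooth : smooth_qc_scheme d X) (X_closed : universally_closed X)
  (X_conn : geometrically_connected_fibres X).
Let fX : functorial X. Proof. by case: X_smooth. Qed.

Variables (m : nat) (U : 'I_m -> sub X) (cd : 'I_m -> chart_data X).
Hypotheses (oU : forall a, is_open (U a)) (cU : covers U)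
  (ch : forall a, is_chart (U a) (@cd_e _ _ (cd a)) (@cd_y _ _ (cd a))).

Variables (S : comNzRingType) (i : {rmorphism S -> Q}) (g : {rmorphism k -> S}).
Hypotheses (noeS : noetherian S) (ig : forall x, i (g x) = fk x).
Variable e0 : forall a, 'I_(cd_c (cd a)) -> pexpr S (cd_n (cd a)).
Hypothesis ie0 : forall a x, pexpr_map i (e0 (a := a) x) = @cd_e _ _ (cd a) x.

Variables (f : forall R : alg Q, X R -> R).
Hypothesis f_nat : natural_fun f.
Variables (z : X (base Q)) (fz : f z = 0).

Let Z (t : S) := forall R (x : X R), str R (i t) * f x = 0.
Hypothesis Z1 : ~ Z 1.
Hypothesis Z_prime : forall a b, Z (a * b) -> Z a \/ Z b.

Let Z_ideal : is_ideal Z.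
Proof.
split=> [R x|a b ha hb R x|a b hb R x]; first by rewrite !rmorph0 mul0r.
  by rewrite !rmorphD mulrDl ha hb addr0.
by rewrite !rmorphM -mulrA hb mulr0.
Qed.

Let Z_mult : multiplicative_set (fun t => ~ Z t).
Proof. by split=> // a b ha hb /Z_prime [/ha|/hb]. Qed.

(* f is, up to a factor outside the prime Z, a combination of r functions on the
   charts with coefficients S, multiplied by elements of Q annihilated by Z. *)
Definition combination r (q : 'I_r -> Q) (t : S) :=
  [/\ ~ Z t, forall s c, Z c -> i c * q s = 0
    & forall a, exists u : 'I_r -> pexpr S (cd_n (cd a)), forall R (x : X R), U a x ->
        str R (i t) * f x = \sum_s str R (q s) * peval (@cd_y _ _ (cd a) R x) (pexpr_map i (u s))].

(** [Z] has finitely many generators and they kill [f], so [chart_torsion] expands [f] on each chart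
    with coefficients killed by [Z]. The lists for the various charts are concatenated, with zero
    functions for foreign entries, to obtain a common [q]. *)
Lemma ex_combination : (forall a, exists F : pexpr S (cd_n (cd a)), forall R (x : X R), U a x ->
    f x = peval (@cd_y _ _ (cd a) R x) (pexpr_map i F)) ->
  exists r (q : 'I_r -> Q), combination q 1.
Proof.
move=> hF; have [w [c hc]] := noetherian_fg noeS Z_ideal.
suff H (l : seq 'I_m) : exists r (q : 'I_r -> Q), (forall s c, Z c -> i c * q s = 0) /\
    forall a, a \in l -> exists u : 'I_r -> pexpr S (cd_n (cd a)), forall R (x : X R), U a x ->
      f x = \sum_s str R (q s) * peval (@cd_y _ _ (cd a) R x) (pexpr_map i (u s)).
  have [r [q [hq hu]]] := H (enum 'I_m); exists r, q; split=> // a.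
  have [|u ua] := hu a; first by rewrite mem_enum.
  by exists u => R x /ua <-; rewrite !rmorph1 mul1r.
elim: l => [|a l [r [q [hq hu]]]]; first by exists 0, (fun=> 0); split=> // -[].
have [F Fa] := hF a.
have [R v sol j|r' [q' [u' [hq' hu']]]] :=
  @chart_torsion k Q fk _ _ _ (chart_smooth (ch a)) (pexpr_map i F) w (fun j => i (c j)).
  have [x Ux yx] := iffLR (chart_sol (ch a) _) sol.
  have Zc : Z (c j) by apply/hc/span_mem; exists j.
  rewrite -[RHS](Zc R x) (Fa _ _ Ux); congr (_ * _).
  by apply: eq_peval => i'; rewrite yx.
have q'Z s b : Z b -> i b * q' s = 0.
  move=> /hc; apply: (span_min (J := fun b => i b * q' s = 0)).
    split=> [|x y hx hy|x y hy]; first by rewrite rmorph0 mul0r.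
      by rewrite rmorphD mulrDl hx hy addr0.
    by rewrite rmorphM -mulrA hy mulr0.
  by move=> _ [j ->].
exists (r + r')%N, (fun s => match split s with inl s => q s | inr s => q' s end); split.
  by move=> s b Zb; case: split => s'; [exact: hq|exact: q'Z].
move=> a'; have [a'l _|a'l] := boolP (a' \in l).
  have [u ua] := hu a' a'l.
  exists (fun s => match split s with inl s => u s | inr s => PCst 0 end) => R x Ux.
  rewrite big_split_ord /= [X in _ + X]big1 ?addr0 => [|s _]; last first.
    by rewrite (unsplitK (inr s : 'I_r + 'I_r')%type) /= !rmorph0 mulr0.
  rewrite (ua _ _ Ux); apply: eq_bigr => s _.
  by rewrite (unsplitK (inl s : 'I_r + 'I_r')%type).
rewrite inE (negbTE a'l) orbF => /eqP ->.
exists (fun s => match split s with inl s => PCst 0 | inr s => pexpr_map g (u' s) end) => R x Ux.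
rewrite big_split_ord /= [X in X + _]big1 ?add0r => [|s _]; last first.
  by rewrite (unsplitK (inl s : 'I_r + 'I_r')%type) /= !rmorph0 mulr0.
rewrite (Fa _ _ Ux) hu'; last by apply/(chart_sol (ch a)); exists x.
apply: eq_bigr => s _; rewrite (unsplitK (inr s : 'I_r + 'I_r')%type) pexpr_map_comp.
by congr (_ * peval _ _); apply: eq_pexpr_map.
Qed.

(** On a fibre over [K] the function with coefficients [b] vanishes. A functional F turns this into
    a relation with coefficients F(b_s) that holds modulo [Z], hence exactly after multiplication by
    q_s0, which [Z] kills. It serves to eliminate the term with index [s0]. *)
Lemma shorten_combination r (q : 'I_r.+1 -> Q) t : combination q t ->
  exists (q' : 'I_r -> Q) t', combination q' t'.
Proof.
move=> [Zt hq hu].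
pose u a := sval (cid (hu a)).
have ua a R (x : X R) : U a x -> str R (i t) * f x =
    \sum_s str R (q s) * peval (@cd_y _ _ (cd a) R x) (pexpr_map i (u a s)).
  exact: (proj2_sig (cid (hu a))).
pose M x := exists2 c, ~ Z c & x = i c.
have hM : multiplicative_set M.
  split; first by exists 1; rewrite ?rmorph1.
  by move=> _ _ [a ha ->] [b hb ->]; exists (a * b); rewrite ?rmorphM //; exact: (proj2 Z_mult).
(* Otherwise a product of elements outside the prime [Z] would kill all the [q s], hence [t * f],
   and would belong to [Z] after multiplication by [t]. *)
have nk : ~ (forall s, exists c, M c /\ c * q s = 0).
  move=> /choice [c hc].
  have /choice [c' hc'] s : exists c', ~ Z c' /\ i c' * q s = 0.
    by have [[c' Zc' e] h] := hc s; exists c'; rewrite -e.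
  have Zprod : ~ Z (\prod_s c' s).
    apply: (big_ind (fun x => ~ Z x)) => [||s _]; first exact: (proj1 Z_mult).
      exact: (proj2 Z_mult).
    by have [] := hc' s.
  apply: (proj2 Z_mult _ _ Zprod Zt).
  apply: (@charts_zero Q X m U oU cU (fun R x => str R (i ((\prod_s c' s) * t)) * f x)).
    by move=> R T l x; rewrite f_nat [RHS]rmorphM ahomE.
  move=> a R x Ux; rewrite rmorphM rmorphM -mulrA (ua _ _ _ Ux) mulr_sumr big1 // => s _.
  have qs : i (\prod_s c' s) * q s = 0.
    by have [_ qs] := hc' s; rewrite (bigD1 s) //= rmorphM mulrAC qs mul0r.
  by rewrite mulrA -rmorphM qs rmorph0 mul0r.
have [K [j [b [jM [s0 bs0] rel]]]] := relation_closed_field hM nk.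
pose phi : {rmorphism S -> K} := j \o i.
(* An element of [Z] kills every [q s], so its image in [K] kills [b s0], which is nonzero. Together
   with [Zphi] this makes [Z] the kernel of [phi]. *)
have phiZ c : Z c -> phi c = 0.
  move=> Zc; have := rel (fun s => if s == s0 then i c else 0).
  rewrite (bigD1 s0) //= eqxx big1 => [|s /negbTE ->]; last by rewrite mulr0.
  rewrite mulrC hq // addr0 => /(_ erefl).
  rewrite (bigD1 s0) //= eqxx big1 => [|s /negbTE ->]; last by rewrite rmorph0 mulr0.
  by rewrite addr0 => /eqP; rewrite mulf_eq0 (negbTE bs0) => /eqP.
have Zphi c : phi c = 0 -> Z c.
  by move=> e; apply: contrapT => nZ; have /eqP[] : j (i c) != 0 by [apply: jM; exists c].
have spa a : span (peqs (fun x => pexpr_map j (@cd_e _ _ (cd a) x)))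
    (\sum_s Pcst K (cd_n (cd a)) (b s) * Pev (pexpr_map phi (u a s))).
  under eq_bigr do rewrite -[pexpr_map phi _]/(pexpr_map (fun x => j (i x)) _) -pexpr_map_comp.
  apply: (@field_relation k p kp Q fk d X X_smooth X_closed X_conn m U cd oU cU ch K j _ q b rel
    (fun a s => pexpr_map i (u a s)) (fun R x => str R (i t) * f x) _ ua z).
    by move=> R T l x; rewrite f_nat rmorphM ahomE.
  by rewrite fz mulr0.
(* The vanishing function is written as a combination of multiples of the equations, with constants
   [h] in [K] and expressions [v] over [S]. The latter already vanish on the chart over [Q]. *)
have ex a : exists (T : finType) (h : T -> K) (v : T -> pexpr S (cd_n (cd a))),
    \sum_s Pcst K (cd_n (cd a)) (b s) * Pev (pexpr_map phi (u a s)) =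
      \sum_x Pcst K _ (h x) * Pev (pexpr_map phi (v x)) /\
    forall x R (y : X R), U a y -> peval (@cd_y _ _ (cd a) R y) (pexpr_map i (v x)) = 0.
  have [H eH] := span_range (spa a).
  pose phig : {rmorphism k -> K} := phi \o g.
  have TT (n : nat) (P : Pn K n) : Pcoefs (fun=> True) P by elim: n P => //=.
  have /choice [w hw] x : exists w : {r : nat & (('I_r -> K) * ('I_r -> pexpr k (cd_n (cd a))))%type},
      H x = \sum_s Pcst K _ ((projT2 w).1 s) * Pev (pexpr_map phig ((projT2 w).2 s)).
    have [r' [h [v [_ ->]]]] := Pcoefs_expand phig (TT _ (H x)).
    by exists (existT _ r' (h, v)).
  pose T : finType := {x : 'I_(cd_c (cd a)) & 'I_(projT1 (w x))}.
  exists T, (fun y => (projT2 (w (tag y))).1 (tagged y)),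
    (fun y => PMul (pexpr_map g ((projT2 (w (tag y))).2 (tagged y))) (e0 (tag y))); split.
    rewrite eH; under eq_bigr do rewrite hw mulr_suml.
    rewrite (sig_big_dep _ (fun x => xpredT) (fun x (s : 'I_(projT1 (w x))) =>
      Pcst K (cd_n (cd a)) ((projT2 (w x)).1 s) * Pev (pexpr_map phig ((projT2 (w x)).2 s))
        * Pev (pexpr_map j (@cd_e _ _ (cd a) x)))) /=.
    apply: eq_bigr => y _; rewrite -mulrA; congr (_ * _).
    rewrite /Pev /= pexpr_map_comp -ie0 pexpr_map_comp.
    by [].

  move=> [x s] R y Uy /=; rewrite ie0.
  have sol : solves (@cd_e _ _ (cd a)) (@cd_y _ _ (cd a) R y) by apply/(chart_sol (ch a)); exists y.
  by rewrite sol mulr0.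
pose TT a : finType := sval (cid (ex a)).
have ex2 a : exists (h : TT a -> K) (v : TT a -> pexpr S (cd_n (cd a))),
    \sum_s Pcst K (cd_n (cd a)) (b s) * Pev (pexpr_map phi (u a s)) =
      \sum_x Pcst K _ (h x) * Pev (pexpr_map phi (v x)) /\
    forall x R (y : X R), U a y -> peval (@cd_y _ _ (cd a) R y) (pexpr_map i (v x)) = 0.
  exact: (proj2_sig (cid (ex a))).
pose h a := sval (cid (ex2 a)).
have ex3 a : exists v : TT a -> pexpr S (cd_n (cd a)),
    \sum_s Pcst K (cd_n (cd a)) (b s) * Pev (pexpr_map phi (u a s)) =
      \sum_x Pcst K _ (h a x) * Pev (pexpr_map phi (v x)) /\
    forall x R (y : X R), U a y -> peval (@cd_y _ _ (cd a) R y) (pexpr_map i (v x)) = 0.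
  exact: (proj2_sig (cid (ex2 a))).
(* One functional must serve all charts, because the new coefficients are to be common to them. *)
pose L := [seq b s | s <- enum 'I_r.+1] ++
  flatten [seq [seq h a x | x <- enum (TT a)] | a <- enum 'I_m].
have [F [F0 hF]] := ex_functional phi L bs0.
have bL s : b s \in b s0 :: L.
  by rewrite inE mem_cat map_f ?mem_enum // orbT.
have hL a x : h a x \in b s0 :: L.
  rewrite inE mem_cat; apply/orP; right; apply/orP; right; apply/flattenP.
  exists [seq h a x | x <- enum (TT a)]; first by apply: map_f; rewrite mem_enum.
  by apply: map_f; rewrite mem_enum.
have rel' a R (y : X R) : U a y ->
    str R (q s0) * (\sum_s str R (i (F (b s))) * peval (@cd_y _ _ (cd a) R y) (pexpr_map i (u a s))) = 0.
  move=> Uy; have [v [ev v0]] := ex3 a.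
  pose N := cd_n (cd a).
  pose I : finType := ('I_r.+1 + TT a)%type.
  pose w (x : I) : K := match x with inl s => b s | inr x => h a x end.
  pose c (x : I) : pexpr S N := match x with inl s => u a s | inr x => popp (v x) end.
  have wL x : w x \in b s0 :: L by case: x => x; [exact: bL|exact: hL].
  have e1 : \sum_x Pcst K N (w x) * Pmap phi N (Pev (c x)) = 0.
    rewrite big_sumType /=; apply/eqP; rewrite addr_eq0 -sumrN; apply/eqP.
    under eq_bigr do rewrite Pmap_ev.
    rewrite ev; apply: eq_bigr => x _.
    by rewrite -mulrN Pmap_ev /Pev /= !rmorphN !rmorph1 mulN1r opprK.
  have e2 := @Pn_relation S K K phi phi I w (fun x => phi (F (w x))) _ N (fun x => Pev (c x)) e1.
  have {e1 e2} e3 : \sum_x Pcst K N (phi (F (w x))) * Pmap phi N (Pev (c x)) = 0.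
    apply: e2 => l el.
    transitivity (phi (\sum_(x <- [seq (w x, l x) | x <- index_enum I]) F x.1 * x.2)).
      by rewrite big_map rmorph_sum; apply: eq_bigr => x _; rewrite rmorphM.
    apply: hF; first by move=> y0 /mapP [x _ ->]; exact: wL.
    by rewrite big_map.
  pose Y : Pn S N := \sum_x Pcst S N (F (w x)) * Pev (c x).
  have Y0 : Pmap phi N Y = 0.
    transitivity (\sum_x Pcst K N (phi (F (w x))) * Pmap phi N (Pev (c x))) => //.
    by rewrite rmorph_sum; apply: eq_bigr => x _; rewrite rmorphM Pmap_cst.
  (* The coefficients of [Y] die under [phi], so they lie in [Z] and are killed by [q s0]. *)
  have qY : Pcst Q N (q s0) * Pmap i N Y = 0.
    apply/Pcoefs_ann; apply: (Pcoefs_map _ (Pcoefs_ker Y0)) => x /Zphi Zx.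
    by rewrite mulrC hq.
  have [r0|nz] := pselect ((1 : R) = 0); first exact: zero_ring_eq.
  have [ee hv] := Pn_eval (@cd_y _ _ (cd a) R y) nz.
  have evE (t0 : pexpr Q N) : ee (Pev t0) = peval (@cd_y _ _ (cd a) R y) t0.
    by rewrite /Pev peval_hom; exact: eq_peval.
  have evc x : ee (Pcst Q N x) = str R x by rewrite -[Pcst Q N x]/(str (Palg Q N) x) ahomE.
  transitivity (ee (Pcst Q N (q s0) * Pmap i N Y)); last by rewrite qY rmorph0.
  rewrite rmorphM evc; congr (_ * _); rewrite rmorph_sum rmorph_sum big_sumType /=.
  rewrite [X in _ = _ + X]big1 ?addr0 => [|x _]; last first.
    rewrite !rmorphM Pmap_ev evE /= v0 // !mulr0.
    by [].
  by apply: eq_bigr => s _; rewrite !rmorphM Pmap_ev evE Pmap_cst evc.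
(* These are the coefficients of F(b_s0) t f minus q_s0 times the vanishing relation; the entry at
   [s0] cancels. The factor F(b_s0) is outside [Z] since its image in [K] is nonzero. *)
exists (fun s => i (F (b s0)) * q (lift s0 s) - i (F (b (lift s0 s))) * q s0), (F (b s0) * t).
split.
- by apply: (proj2 Z_mult) => // /phiZ /eqP; rewrite (negbTE F0).
- move=> s c Zc; rewrite mulrBr !mulrA ![i c * _]mulrC -!mulrA !hq // !mulr0 subr0.
  by [].
- move=> a; exists (fun s => u a (lift s0 s)) => R x Ux.
  rewrite rmorphM rmorphM -mulrA (ua _ _ _ Ux).
  have := rel' a R x Ux; set E := str R (q s0) * _ => e0'.
  transitivity (str R (i (F (b s0))) * (\sum_s str R (q s) * peval (@cd_y _ _ (cd a) R x) (pexpr_map i (u a s))) - E).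
    by rewrite e0' subr0.
  rewrite /E !mulr_sumr -sumrB (bigD1_ord s0) //=.
  rewrite [X in X + _](_ : _ = 0) ?add0r; last by ring.
  by apply: eq_bigr => s _; rewrite rmorphB !rmorphM; ring.
Qed.

(** Infinite descent on the number of terms: with none left, some [t] outside [Z] kills [f],
    contrary to the definition of [Z]. *)
Lemma combination_zero : (forall a, exists F : pexpr S (cd_n (cd a)), forall R (x : X R), U a x ->
    f x = peval (@cd_y _ _ (cd a) R x) (pexpr_map i F)) -> False.
Proof.
move=> /ex_combination [r [q hq]]; move: r q 1 hq.
elim=> [|r IH] q t hq; last by have [q' [t' /IH]] := shorten_combination hq.
have [Zt _ hu] := hq; apply: Zt.
apply: (@charts_zero Q X m U oU cU (fun R x => str R (i t) * f x)).
  by move=> R T l x; rewrite f_nat rmorphM ahomE.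
by move=> a R x Ux; have [u ->] := hu a; rewrite ?big_ord0.
Qed.

End ConstantMain.

Lemma proper_function_zero_nz (k : fieldType) (p : nat) (kp : p \in [pchar k])
    (Q : comNzRingType) (fk : {rmorphism k -> Q}) (d : nat) (X : pre Q)
    (f : forall R : alg Q, X R -> R) (z : X (base Q)) :
  smooth_qc_scheme d X -> universally_closed X -> geometrically_connected_fibres X ->
  natural_fun f -> f _ z = 0 -> forall R x, f R x = 0.
Proof.
move=> X_smooth X_closed X_conn f_nat fz.
have [m [U [cd [oU cU ch]]]] := smooth_charts X_smooth.
have fX : functorial X by case: X_smooth.
have exF0 a := chart_function fX (oU a) (ch a) f_nat.
pose F a := sval (cid (exF0 a)).
have hF a R (x : X R) : U a R x -> f R x = peval (@cd_y _ _ (cd a) R x) (F a).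
  exact: (proj2_sig (cid (exF0 a))).
pose cs : seq Q := flatten [seq pconsts (F a) ++
  flatten [seq pconsts (@cd_e _ _ (cd a) x) | x <- enum 'I_(cd_c (cd a))] | a <- enum 'I_m].
have [S [i [g [noeS inji ig im]]]] := ex_noetherian_subring fk (fun x : 'I_(size cs) => cs`_x).
have lift b : b \in cs -> exists x, i x = b.
  by move=> /(nthP 0) [x lt <-]; exact: (im (Ordinal lt)).
have exF a : exists F0, pexpr_map i F0 = F a.
  apply: pexpr_lift => b /mem_In hb; apply: lift; apply/flattenP.
  exists (pconsts (F a) ++ flatten [seq pconsts (@cd_e _ _ (cd a) x) | x <- enum 'I_(cd_c (cd a))]).
    by apply/mapP; exists a; rewrite ?mem_enum.
  by rewrite mem_cat hb.
have exe a x : exists e0, pexpr_map i e0 = @cd_e _ _ (cd a) x.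
  apply: pexpr_lift => b /mem_In hb; apply: lift; apply/flattenP.
  exists (pconsts (F a) ++ flatten [seq pconsts (@cd_e _ _ (cd a) x) | x <- enum 'I_(cd_c (cd a))]).
    by apply/mapP; exists a; rewrite ?mem_enum.
  rewrite mem_cat; apply/orP; right; apply/flattenP; exists (pconsts (@cd_e _ _ (cd a) x)) => //.
  by apply/mapP; exists x; rewrite ?mem_enum.
pose e0 a x := sval (cid (exe a x)).
have he0 a x : pexpr_map i (e0 a x) = @cd_e _ _ (cd a) x by exact: (proj2_sig (cid (exe a x))).
apply: contrapT => no.
pose Z (t : S) := forall R (x : X R), str R (i t) * f R x = 0.
have Z1 : ~ Z 1 by move=> h; apply: no => R x; rewrite -[RHS](h R x) !rmorph1 mul1r.
(* The annihilators of the nonzero multiples of [f]; a maximal one is prime, as for associated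
   primes. The multiple [f'] that attains it replaces [f]. *)
pose Fam I := exists t, ~ Z t /\ I = (fun a => Z (a * t)).
have [||I [[t [Zt ->]] mx]] := noetherian_max noeS (Fam := Fam).
- by exists (fun a => Z (a * 1)), 1.
- move=> _ [t [_ ->]]; split=> [R x|a b ha hb R x|a b hb R x].
  + by rewrite mul0r !rmorph0 mul0r.
  + by rewrite mulrDl !rmorphD mulrDl ha hb addr0.
  + by rewrite -mulrA !rmorphM -mulrA -!rmorphM hb mulr0.
pose f' R (x : X R) := str R (i t) * f R x.
have f'_nat : natural_fun f' by move=> R T l x; rewrite /f' f_nat [RHS]rmorphM ahomE.
have ZE a : (forall R (x : X R), str R (i a) * f' R x = 0) <-> Z (a * t).
  by split=> h R x; have := h R x; rewrite /f' !rmorphM mulrA.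
apply: (@combination_zero k p kp Q fk d X X_smooth X_closed X_conn m U cd oU cU ch S i g noeS ig
  e0 he0 f' f'_nat z).
- by rewrite /f' fz mulr0.
- by move/ZE; rewrite mul1r.
- move=> a b /ZE hab; have [hb|hb] := pselect (Z (b * t)); first by right; apply/ZE.
  left; apply/ZE; apply: (mx (fun c => Z (c * (b * t)))).
  + by exists (b * t).
  + by move=> c hc R x; rewrite mulrCA !rmorphM -mulrA -!rmorphM hc mulr0.
  + by rewrite mulrA.
- move=> a; have [F0 hF0] := exF a; exists (PMul (PCst t) F0) => R x Ux.
  by rewrite /f' /= hF0 -hF.
Qed.

Lemma proper_function_zero (k : fieldType) (p : nat) (kp : p \in [pchar k])
    (B : alg k) (d : nat) (X : pre B) (f : forall R : alg B, X R -> R) (z : X (base B)) :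
  smooth_qc_scheme d X -> universally_closed X -> geometrically_connected_fibres X ->
  natural_fun f -> f _ z = 0 -> forall R x, f R x = 0.
Proof.
have [e|nz] := pselect ((1 : B) = 0).
  move=> _ _ _ _ _ R x; apply: zero_ring_eq.
  by rewrite -(rmorph1 (str R)) e rmorph0.
case: B X f z nz => B fk X f z /= /comNz_eq [Q eQ]; case: B / eQ fk X f z => fk X f z.
exact: (@proper_function_zero_nz k p kp Q fk d X f z).
Qed.

(** * Square-zero extensions and tangent functors *)

Definition mk_rmorphism (R S : comPzRingType) (f : R -> S) (fn : nmod_morphism f)
    (fm : monoid_morphism f) : {rmorphism R -> S} :=
  HB.pack f (GRing.isNmodMorphism.Build _ _ f fn) (GRing.isMonoidMorphism.Build _ _ f fm).

(** The ring R + M in which M has square zero. It needs a name of its own because pairs of rings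
    already carry the componentwise multiplication. *)
Definition sqz (R : comPzRingType) (M : lmodType R) : Type := (R * M)%type.

Section SquareZero.
Variables (R : comPzRingType) (M : lmodType R).
HB.instance Definition _ := GRing.Zmodule.on (sqz M).

Definition sqz_mul (x y : sqz M) : sqz M := (x.1 * y.1, x.1 *: y.2 + y.1 *: x.2).
Fact sqz_mulA : associative sqz_mul.
Proof.
move=> x y z; congr pair; rewrite /= ?mulrA // !scalerDr !scalerA.
by rewrite addrA [z.1 * _]mulrC [z.1 * _]mulrC.
Qed.
Fact sqz_mulC : commutative sqz_mul.
Proof. by move=> x y; congr pair; [exact: mulrC|exact: addrC]. Qed.
Fact sqz_mul1 : left_id (1, 0) sqz_mul.
Proof. by move=> [r m]; rewrite /sqz_mul /= mul1r scale1r scaler0 addr0. Qed.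
Fact sqz_mulD : left_distributive sqz_mul +%R.
Proof.
move=> x y z; congr pair; rewrite /= ?mulrDl // scalerDl scalerDr.
by rewrite !addrA; congr (_ + _); rewrite addrAC.
Qed.
HB.instance Definition _ :=
  GRing.Zmodule_isComPzRing.Build (sqz M) sqz_mulA sqz_mulC sqz_mul1 sqz_mulD.

Lemma sqzM2 (x y : sqz M) : (x * y).2 = x.1 *: y.2 + y.1 *: x.2. Proof. by []. Qed.
Lemma sqzD2 (x y : sqz M) : (x + y).2 = x.2 + y.2. Proof. by []. Qed.

Fact sqz_fst_nmod : nmod_morphism (fun x : sqz M => x.1). Proof. by []. Qed.
Fact sqz_fst_monoid : monoid_morphism (fun x : sqz M => x.1). Proof. by []. Qed.
Definition sqz_fst : {rmorphism sqz M -> R} := mk_rmorphism sqz_fst_nmod sqz_fst_monoid.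

Definition sqz_pair_hom (S : comPzRingType) (f : {rmorphism S -> R}) (d : S -> M) : Prop :=
  (forall r s, d (r + s) = d r + d s) /\
  (forall r s, d (r * s) = f r *: d s + f s *: d r).

Section Pair.
Variables (S : comPzRingType) (f : {rmorphism S -> R}) (d : S -> M).
Hypothesis fd : sqz_pair_hom f d.
Fact sqz_pair_nmod : nmod_morphism (fun r => (f r, d r) : sqz M).
Proof.
have [dD dM] := fd; split=> [|r s]; last by rewrite rmorphD dD.
have d0 : d 0 = 0 by apply: (addrI (d 0)); rewrite -dD !addr0.
by rewrite rmorph0 d0.
Qed.
Fact sqz_pair_monoid : monoid_morphism (fun r => (f r, d r) : sqz M).
Proof.
have [dD dM] := fd; split=> [|r s]; last by rewrite rmorphM dM.
have d1 : d 1 = 0.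
  by apply: (addrI (d 1)); rewrite -{3}(mulr1 1) dM rmorph1 scale1r addr0.
by rewrite rmorph1 d1.
Qed.
Definition sqz_pair : {rmorphism S -> sqz M} := mk_rmorphism sqz_pair_nmod sqz_pair_monoid.
End Pair.

Lemma sqz_pair0 (S : comPzRingType) (f : {rmorphism S -> R}) : sqz_pair_hom f (fun=> 0).
Proof. by split=> *; rewrite ?scaler0 addr0. Qed.

(** Elements of M have square zero and vanish in every field, so fields do not distinguish R + M
    from R. *)
Lemma sqz_unit_ideal (I : sqz M -> Prop) :
  unit_ideal (fun r => exists2 x, I x & r = sqz_fst x) -> unit_ideal I.
Proof.
move=> h; apply: unit_ideal_fields => K j.
have jn (m : M) : j (0, m) = 0.
  have : j (0, m) * j (0, m) = 0.
    rewrite -rmorphM (_ : _ * _ = 0) ?rmorph0 //.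
    by congr pair; rewrite /= ?mulr0 // !scale0r addr0.
  by move/eqP; rewrite mulf_eq0 orbb => /eqP.
have E : sqz_pair_hom idfun (fun=> 0) := sqz_pair0 idfun.
have [_ [x Ix ->] nz] := unit_ideal_field_mem (j \o sqz_pair E) h.
exists x => //; apply: contraNneq nz => jx.
apply/eqP; transitivity (j (x - (0, x.2))).
  by congr (j _); congr pair; rewrite /= ?subr0 // subrr.
by rewrite rmorphB jx jn subrr.
Qed.

End SquareZero.

(** Formal sums are identified if all compatible pairs of homomorphisms evaluate them equally, which
    builds the universal property into the relation. *)
Lemma ex_tensor_ring (B R S : comPzRingType) (f : {rmorphism B -> R})
    (g : {rmorphism B -> S}) :
  exists (P : comPzRingType) (fP : {rmorphism R -> P}) (gP : {rmorphism S -> P}),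
    [/\ forall b, fP (f b) = gP (g b),
      forall x, exists s : seq (R * S), x = \sum_(y <- s) fP y.1 * gP y.2
    & forall (T : comPzRingType) (h : {rmorphism R -> T}) (l : {rmorphism S -> T}),
        (forall b, h (f b) = l (g b)) ->
        exists u : {rmorphism P -> T}, (forall r, u (fP r) = h r) /\ forall s, u (gP s) = l s].
Proof.
pose tev (T : comPzRingType) (h : {rmorphism R -> T}) (l : {rmorphism S -> T})
  (s : seq (R * S)) := \sum_(y <- s) h y.1 * l y.2.
pose e s t := forall (T : comPzRingType) (h : {rmorphism R -> T}) (l : {rmorphism S -> T}),
  (forall b, h (f b) = l (g b)) -> tev T h l s = tev T h l t.
pose mulP (s t : seq (R * S)) := [seq (x.1 * y.1, x.2 * y.2) | x <- s, y <- t].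
pose negP (s : seq (R * S)) := [seq (- x.1, x.2) | x <- s].
have tevD T h l s t : tev T h l (s ++ t) = tev T h l s + tev T h l t.
  by rewrite /tev big_cat.
have tevN T h l s : tev T h l (negP s) = - tev T h l s.
  by rewrite /tev big_map -sumrN; apply: eq_bigr => x _; rewrite rmorphN mulNr.
have tevM T h l s t : tev T h l (mulP s t) = tev T h l s * tev T h l t.
  rewrite /tev /mulP big_allpairs_dep mulr_suml; apply: eq_bigr => x _.
  by rewrite mulr_sumr; apply: eq_bigr => y _; rewrite /= !rmorphM mulrACA.
have tev0 T h l : tev T h l [::] = 0 by rewrite /tev big_nil.
have tev1 T h l : tev T h l [:: (1, 1)] = 1 by rewrite /tev big_seq1 !rmorph1 mulr1.
have eE s t : (forall T h l, tev T h l s = tev T h l t) -> e s t by move=> H T h l _.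
have [A AE] : exists A : setoid_ring (seq (R * S)),
   [/\ sr_eq A = e, sr0 A = [::], sr1 A = [:: (1, 1)], srD A = cat & srN A = negP /\ srM A = mulP].
  unshelve eexists (@SetoidRing _ e [::] [:: (1, 1)] cat negP mulP _ _ _ _ _ _ _ _ _ _ _ _ _ _) => //.
  - by move=> x y E T h l c; rewrite E.
  - by move=> y x z E1 E2 T h l c; rewrite E1 // E2.
  - by move=> x x' y y' E1 E2 T h l c; rewrite !tevD E1 // E2.
  - by move=> x x' E T h l c; rewrite !tevN E.
  - by move=> x x' y y' E1 E2 T h l c; rewrite !tevM E1 // E2.
  - by move=> x y z; apply: eE => *; rewrite !tevD addrA.
  - by move=> x y; apply: eE => *; rewrite !tevD addrC.
  - by move=> x; apply: eE => *; rewrite !tevD tevN tev0 addNr.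
  - by move=> x y z; apply: eE => *; rewrite !tevM mulrA.
  - by move=> x y; apply: eE => *; rewrite !tevM mulrC.
  - by move=> x; apply: eE => *; rewrite !tevM tev1 mul1r.
  - by move=> x y z; apply: eE => *; rewrite !(tevM, tevD) mulrDl.
case: AE => eA A0 A1 AD [AN AM].
pose P : comPzRingType := setoid_quot A; pose cl : seq (R * S) -> P := sq_class A.
have clP s t : e s t -> cl s = cl t by rewrite -eA => /sq_classP.
have [||fP hfP] := @pack_rmorphism R P (fun r => cl [:: (r, 1)]).
- split=> [|x y].
    transitivity (cl (sr0 A)); last by [].
    by rewrite A0; apply: clP => T h l _; rewrite tev0 /tev big_seq1 !rmorph0 mul0r.
  rewrite -sq_classD AD; apply: clP => T h l _.
  by rewrite tevD /tev !big_seq1 /= rmorphD mulrDl.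
- split; first by transitivity (cl (sr1 A)); last by []; rewrite A1.
  move=> x y; rewrite -sq_classM AM; apply: clP => T h l _.
  by rewrite tevM /tev !big_seq1 /= rmorphM rmorph1 !mulr1.
have [||gP hgP] := @pack_rmorphism S P (fun r => cl [:: (1, r)]).
- split=> [|x y].
    transitivity (cl (sr0 A)); last by [].
    by rewrite A0; apply: clP => T h l _; rewrite tev0 /tev big_seq1 !rmorph0 mulr0.
  rewrite -sq_classD AD; apply: clP => T h l _.
  by rewrite tevD /tev !big_seq1 /= rmorphD mulrDr.
- split; first by transitivity (cl (sr1 A)); last by []; rewrite A1.
  move=> x y; rewrite -sq_classM AM; apply: clP => T h l _.
  by rewrite tevM /tev !big_seq1 /= rmorphM rmorph1 !mul1r.
have clE s : cl s = \sum_(y <- s) fP y.1 * gP y.2.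
  elim: s => [|y s IH]; first by rewrite big_nil -A0.
  rewrite big_cons -IH hfP hgP -sq_classM -sq_classD AD AM; apply: clP => T h l _.
  by rewrite /mulP /= mulr1 mul1r -surjective_pairing.
exists P, fP, gP; split.
- move=> b; rewrite hfP hgP; apply: clP => T h l c.
  by rewrite /tev !big_seq1 /= c !rmorph1 mulr1 mul1r.
- by move=> x; exists (sq_repr x); rewrite -clE /cl sq_reprK.
- move=> T h l c.
  have uE s t : sr_eq A s t -> tev T h l s = tev T h l t by rewrite eA; exact.
  have u1 : tev T h l (sr1 A) = 1 by rewrite A1.
  have uD s t : tev T h l (srD A s t) = tev T h l s + tev T h l t by rewrite AD.
  have uM s t : tev T h l (srM A s t) = tev T h l s * tev T h l t by rewrite AM.
  exists (sq_lift_rmorphism uE u1 uD uM); split=> r.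
    by rewrite hfP [LHS]sq_liftE /tev big_seq1 /= rmorph1 mulr1.
  by rewrite hgP [LHS]sq_liftE /tev big_seq1 /= rmorph1 mul1r.
Qed.

(** * Functions on a functor that is representable over a cover of the base *)

Lemma ex_alg_localization (B : comPzRingType) (R : alg B) (b : R) :
  exists (S : alg B) (f : ahom R S), is_localization b f.
Proof.
have [S [f loc]] := ex_localization (powers_mult b).
by exists (push f), (to_push f); apply/is_localizationP.
Qed.

Lemma alg_localization_lift (B : comPzRingType) (R S T : alg B) (b : R) (f : ahom R S)
    (g : ahom R T) :
  is_localization b f -> is_unit (g b) -> exists h : ahom S T, forall r, h (f r) = g r.
Proof.
move=> /is_localizationP loc u.
have [h hE] : exists h : {rmorphism S -> T}, forall r, h (f r) = g r.
  apply: (localizes_lift (powers_mult b) loc) => _ [m ->].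
  by rewrite rmorphXn; exact: is_unitX.
have hb c : h (str S c) = str T c by rewrite -(ahomE f) hE ahomE.
by exists (AHom hb).
Qed.

(* X is representable over each member of a cover of Spec B by basic open sets. *)
Record rep_cover (B : comPzRingType) (X : pre B) n (r : 'I_n -> B) (Q : 'I_n -> alg B)
    (z : forall l, X (Q l)) : Prop := RepCover {
  rc_unit : unit_ideal (fun b => exists i, b = r i);
  rc_inv : forall l, is_unit (str (Q l) (r l));
  rc_ex : forall l (R : alg B) (x : X R), is_unit (str R (r l)) ->
    exists f : ahom (Q l) R, pmap X f (z l) = x;
  rc_eq : forall l (R : alg B) (f g : ahom (Q l) R),
    pmap X f (z l) = pmap X g (z l) -> forall q, f q = g q }.

Section RepCover.
Variables (B : comPzRingType) (X : pre B) (n : nat) (r : 'I_n -> B) (Q : 'I_n -> alg B)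
  (z : forall l, X (Q l)).
Hypotheses (fX : functorial X) (rc : rep_cover r z).

Let loc_unit (R S : alg B) (b : B) (f : ahom R S) :
  is_localization (str R b) f -> is_unit (str S b).
Proof. by case; rewrite ahomE. Qed.

Let r_unit (R : alg B) : unit_ideal (fun x => exists i, x = str R (r i)).
Proof.
have := unit_ideal_map (str R) (rc_unit rc); rewrite !unit_idealE; apply: span_min.
  exact: span_ideal.
by move=> _ [_ [i ->] ->]; apply: span_mem; exists i.
Qed.

Let eq_local (R : alg B) (v w : R) :
  (forall l (S : alg B) (f : ahom R S), is_unit (str S (r l)) -> f v = f w) -> v = w.
Proof.
move=> H; apply/eqP; rewrite -subr_eq0; apply/eqP; apply: (cover_vanish (r_unit R)).
move=> _ [l ->]; have [S [f loc]] := ex_alg_localization (str R (r l)).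
have [_ _ h] := loc; apply: h; apply/eqP; rewrite rmorphB subr_eq0; apply/eqP.
exact: (H l S f (loc_unit loc)).
Qed.

(** It suffices to kill the values at the finitely many universal points, each of which dies in a
    localization at [b]. *)
Lemma rep_cover_kill (b : B) (G : forall R : alg B, X R -> R) :
  natural_fun G -> (forall (R : alg B) (x : X R), is_unit (str R b) -> G R x = 0) ->
  exists N, forall (R : alg B) (x : X R), str R b ^+ N * G R x = 0.
Proof.
move=> Gn G0.
have /choice [N hN] l : exists N, str (Q l) b ^+ N * G _ (z l) = 0.
  have [S [f loc]] := ex_alg_localization (str (Q l) b).
  have [_ _ h] := loc; apply: h; rewrite -Gn; exact: G0 (loc_unit loc).
exists (\max_l N l) => R x; apply: eq_local => l S f u.
have [g gx] := rc_ex rc (pmap X f x) u.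
rewrite rmorph0 rmorphM rmorphXn ahomE -Gn -gx Gn -(ahomE g) -rmorphXn -rmorphM.
have le : (N l <= \max_l N l)%N := leq_bigmax l.
by rewrite -(subnK le) exprD -mulrA hN mulr0 rmorph0.
Qed.

(** A function on X amounts to a compatible family of values at the universal points. [good] says
    that a value is the prescribed one wherever the point factors through a [z l]. *)
Lemma rep_cover_glue (q : forall l, Q l) :
  (forall l l' (T : alg B) (g : ahom (Q l) T) (g' : ahom (Q l') T),
     pmap X g (z l) = pmap X g' (z l') -> g (q l) = g' (q l')) ->
  exists h : forall R : alg B, X R -> R, natural_fun h /\ forall l, h _ (z l) = q l.
Proof.
move=> compat.
pose good (R : alg B) (x : X R) (v : R) := forall l (S : alg B) (f : ahom R S)
  (g : ahom (Q l) S), pmap X g (z l) = pmap X f x -> f v = g (q l).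
have gnat (R S : alg B) (f : ahom R S) (x : X R) v : good R x v -> good S (pmap X f x) (f v).
  move=> gv l T f' g; rewrite (pmap_comp fX (h := ahom_comp f' f)) // => e.
  exact: (gv l T (ahom_comp f' f) g e).
have guniq (R : alg B) (x : X R) v w : good R x v -> good R x w -> v = w.
  move=> gv gw; apply: eq_local => l S f u; have [g gx] := rc_ex rc (pmap X f x) u.
  by rewrite (gv l S f g gx) (gw l S f g gx).
have gz l : good _ (z l) (q l) by move=> l' S f g e; rewrite (compat _ _ _ _ _ e).
have gex (R : alg B) (x : X R) : exists v, good R x v.
  have ex l : exists Sf : {S : alg B & ahom R S}, is_localization (str R (r l)) (projT2 Sf).
    by have [S [f h]] := ex_alg_localization (str R (r l)); exists (existT _ S f).
  have [Sf loc] := choice ex.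
  have exg l : exists g : ahom (Q l) (projT1 (Sf l)), pmap X g (z l) = pmap X (projT2 (Sf l)) x.
    exact: (rc_ex rc _ (loc_unit (loc l))).
  pose g l := sval (cid (exg l)); pose gE l := proj2_sig (cid (exg l)).
  have [|v hv] := @cover_glue R n (fun l => projT1 (Sf l)) (fun l => projT2 (Sf l)) _ (r_unit R)
    loc (fun l => g l (q l)).
    move=> l l' T t t' e.
    pose T1 := push t; pose t1 : ahom _ T1 := to_push t.
    have t'b b : t' (str _ b) = str T1 b.
      by rewrite /= -(ahomE (projT2 (Sf l'))) -e (ahomE (projT2 (Sf l))).
    pose t2 : ahom (projT1 (Sf l')) T1 := @AHom B _ T1 t' t'b.
    apply: (compat l l' T1 (ahom_comp t1 (g l)) (ahom_comp t2 (g l'))).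
    rewrite -!(pmap_comp fX (f := g _) (h := ahom_comp _ _) (z _) (fun=> erefl)).
    rewrite !gE (pmap_comp fX (h := ahom_comp t1 (projT2 (Sf l)))) //.
    by rewrite (pmap_comp fX (h := ahom_comp t1 (projT2 (Sf l)))) // => c; rewrite /= e.
  exists v => l S f g' e; have ru : is_unit (str S (r l)).
    by rewrite -(ahomE g'); apply: is_unit_map; exact: (rc_inv rc).
  have ru' : is_unit (f (str R (r l))) by rewrite ahomE.
  have [h hE] := alg_localization_lift (loc l) ru'.
  have hgz : pmap X (ahom_comp h (g l)) (z l) = pmap X g' (z l).
    rewrite -(pmap_comp fX (f := g l) (h := ahom_comp h (g l)) (z l) (fun=> erefl)) gE.
    by rewrite e; apply: pmap_comp => // c; rewrite hE.
  by rewrite -(rc_eq rc hgz) /= -hv hE.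
pose h (R : alg B) (x : X R) := sval (cid (gex R x)).
have hP (R : alg B) (x : X R) : good R x (h R x) := proj2_sig (cid (gex R x)).
exists h; split=> [R S f x|l]; first exact: guniq (hP _ _) (gnat _ _ _ _ _ (hP _ _)).
exact: guniq (hP _ _) (gz l).
Qed.

(** The analogue of extending a section from a basic open set after multiplication by a power of its
    equation. One power of [r k] clears denominators on each member of the cover, and a second one
    makes the results agree on overlaps. *)
Lemma rep_cover_extend k (q : Q k) : exists N (h : forall R : alg B, X R -> R),
  natural_fun h /\ h _ (z k) = str _ (r k) ^+ N * q.
Proof.
have exP l : exists Pf : {P : alg B & ahom (Q l) P},
    is_localization (str (Q l) (r k)) (projT2 Pf).
  by have [S [f h]] := ex_alg_localization (str (Q l) (r k)); exists (existT _ S f).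
pose Pf l := sval (cid (exP l)).
have loc l : is_localization (str (Q l) (r k)) (projT2 (Pf l)) := proj2_sig (cid (exP l)).
have exf l : exists f : ahom (Q k) (projT1 (Pf l)), pmap X f (z k) = pmap X (projT2 (Pf l)) (z l).
  exact: (rc_ex rc _ (loc_unit (loc l))).
pose f l := sval (cid (exf l)); pose fE l := proj2_sig (cid (exf l)).
have /choice [N hN] l : exists N, exists h, projT2 (Pf l) h = str _ (r k) ^+ N * f l q.
  have [_ h _] := loc l; have [a [m e]] := h (f l q); exists m, a.
  by rewrite -e ahomE mulrC.
pose M := \max_l N l.
have exh l : exists h, projT2 (Pf l) h = str _ (r k) ^+ M * f l q.
  have [h hE] := hN l; have le : (N l <= M)%N := leq_bigmax l.
  exists (str _ (r k) ^+ (M - N l) * h).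
  by rewrite rmorphM rmorphXn ahomE hE mulrA -exprD subnK.
pose h l := sval (cid (exh l)); pose hE l := proj2_sig (cid (exh l)).
have key l (T : alg B) (g : ahom (Q l) T) (g0 : ahom (Q k) T) : is_unit (str T (r k)) ->
    pmap X g (z l) = pmap X g0 (z k) -> g (h l) = str T (r k) ^+ M * g0 q.
  move=> u e; have u' : is_unit (g (str _ (r k))) by rewrite ahomE.
  have [t tE] := alg_localization_lift (loc l) u'.
  have e' : pmap X (ahom_comp t (f l)) (z k) = pmap X g0 (z k).
    rewrite -(pmap_comp fX (f := f l) (h := ahom_comp t (f l)) (z k) (fun=> erefl)) fE -e.
    by apply: pmap_comp => // c; rewrite tE.
  by rewrite -(rc_eq rc e') -tE hE rmorphM rmorphXn (ahomE t).
(* [O] represents X over the overlap of two members. After inverting [r k] both candidates come from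
   [q] and coincide, so a power of [r k] kills their difference. *)
have exO (p : 'I_n * 'I_n) : exists m, forall (T : alg B) (g : ahom (Q p.1) T)
    (g' : ahom (Q p.2) T), pmap X g (z p.1) = pmap X g' (z p.2) ->
    str T (r k) ^+ m * (g (h p.1) - g' (h p.2)) = 0.
  case: p => l l' /=; have [O [o oloc]] := ex_alg_localization (str (Q l) (r l')).
  have [o' o'E] := rc_ex rc (pmap X o (z l)) (loc_unit oloc).
  have [W [w wloc]] := ex_alg_localization (str O (r k)).
  have [_ _ ker] := wloc.
  have [g0 g0E] := rc_ex rc (pmap X (ahom_comp w o) (z l)) (loc_unit wloc).
  have [m hm] : exists m, str O (r k) ^+ m * (o (h l) - o' (h l')) = 0.
    apply: ker; rewrite rmorphB -[w (o _)]/(ahom_comp w o _) -[w (o' _)]/(ahom_comp w o' _).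
    rewrite (key l _ _ g0) ?(key l' _ _ g0) ?subrr //; try exact: loc_unit wloc.
    rewrite -(pmap_comp fX (f := o') (h := ahom_comp w o') _ (fun=> erefl)) o'E g0E.
    exact: pmap_comp.
  exists m => T g g' e; have u : is_unit (g (str _ (r l'))).
    by rewrite ahomE -(ahomE g'); apply: is_unit_map; exact: (rc_inv rc).
  have [t tE] := alg_localization_lift oloc u.
  have e' : pmap X (ahom_comp t o') (z l') = pmap X g' (z l').
    rewrite -(pmap_comp fX (f := o') (h := ahom_comp t o') _ (fun=> erefl)) o'E -e.
    by apply: pmap_comp => // c; rewrite tE.
  rewrite -(rc_eq rc e') -tE /= -rmorphB -(ahomE t) -rmorphXn -rmorphM hm; exact: rmorph0.
have [m hm] := choice exO; pose m0 := \max_p m p.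
have [|H [Hn HE]] := @rep_cover_glue (fun l => str _ (r k) ^+ m0 * h l).
  move=> l l' T g g' e; apply/eqP; rewrite -subr_eq0 !rmorphM !rmorphXn !ahomE -mulrBr.
  have le : (m (l, l') <= m0)%N := leq_bigmax (F := m) (l, l').
  by rewrite -(subnK le) exprD -mulrA (hm (l, l')) ?mulr0.
exists (m0 + M)%N, H; split=> //; rewrite HE exprD -mulrA; congr (_ * _).
have := key k (Q k) (ahom_id _) (ahom_id _); apply=> //; exact: (rc_inv rc).
Qed.

End RepCover.

(** * Functions after base change *)

Section Split.
Variables (B E : comPzRingType) (phi : {rmorphism B -> E}) (X : pre B).

(** The representing rings are tensored with [E]; that their elements are finite sums of pure
    tensors is the source of the splitting. *)
Lemma rep_cover_bc n (r : 'I_n -> B) (Q : 'I_n -> alg B) (z : forall l, X (Q l)) :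
  functorial X -> rep_cover r z ->
  exists (Q' : 'I_n -> alg E) (f : forall l, ahom (Q l) (res phi (Q' l))),
    rep_cover (X := pre_bc phi X) (fun l => phi (r l)) (fun l => pmap X (f l) (z l)) /\
    forall l (x : Q' l), exists s : seq (Q l * E),
      x = \sum_(y <- s) f l y.1 * str (Q' l) y.2.
Proof.
move=> fX rc.
have ex l : exists Pf : {P : alg E & ahom (Q l) (res phi P)},
    (forall x : projT1 Pf, exists s : seq (Q l * E),
      x = \sum_(y <- s) projT2 Pf y.1 * str (projT1 Pf) y.2) /\
    forall (T : alg E) (h : ahom (Q l) (res phi T)), exists u : ahom (projT1 Pf) T,
      forall q, u (projT2 Pf q) = h q.
  have [P [f [g [fg gen univ]]]] := ex_tensor_ring (str (Q l)) phi.
  exists (existT _ (@Alg E P g) (@AHom B (Q l) (res phi (@Alg E P g)) f fg)); split=> //=.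
  move=> T h; have [|u [uf ug]] := univ T h (str T); first by move=> b; rewrite ahomE.
  by exists (@AHom E (@Alg E P g) T u ug).
pose P l := projT1 (sval (cid (ex l))); pose f l := projT2 (sval (cid (ex l))).
have gen l : forall x : P l, exists s : seq (Q l * E),
    x = \sum_(y <- s) f l y.1 * str (P l) y.2 by have [] := proj2_sig (cid (ex l)).
have univ l : forall (T : alg E) (h : ahom (Q l) (res phi T)), exists u : ahom (P l) T,
    forall q, u (f l q) = h q by have [] := proj2_sig (cid (ex l)).
exists P, f; split=> //; split.
- have := unit_ideal_map phi (rc_unit rc); rewrite !unit_idealE; apply: span_min.
    exact: span_ideal.
  by move=> _ [_ [i ->] ->]; apply: span_mem; exists i.
- by move=> l; rewrite -[str _ _](ahomE (f l)); apply: is_unit_map; exact: (rc_inv rc).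
- move=> l R x u; have [h hx] := rc_ex rc (x : X (res phi R)) u.
  by have [v vE] := univ l R h; exists v; rewrite -hx /=; apply: pmap_comp => // q; rewrite /= vE.
- move=> l R g h /=.
  rewrite (pmap_comp fX (h := ahom_comp (ahom_res phi g) (f l))) //.
  rewrite (pmap_comp fX (h := ahom_comp (ahom_res phi h) (f l))) // => e q.
  have [s ->] := gen l q; rewrite !rmorph_sum; apply: eq_bigr => y _.
  by rewrite !rmorphM !ahomE; congr (_ * _); exact: (rc_eq rc e).
Qed.

Definition nat_fun_of := {h : forall R : alg B, X R -> R | natural_fun h}.

(** [F] is in the image of the tensor product over B of E with the ring of functions on X. *)
Definition splits (F : forall R : alg E, pre_bc phi X R -> R) : Prop :=
  exists s : seq (E * nat_fun_of), forall (R : alg E) (x : pre_bc phi X R),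
    F R x = \sum_(y <- s) str R y.1 * (sval y.2 (res phi R) x : R).

Lemma splitsD F G : splits F -> splits G -> splits (fun R x => F R x + G R x).
Proof.
move=> [s sE] [t tE]; exists (s ++ t) => R x; by rewrite big_cat /= sE tE.
Qed.

Lemma splitsZ e F : splits F -> splits (fun R x => str R e * F R x).
Proof.
move=> [s sE]; exists [seq (e * y.1, y.2) | y <- s] => R x.
rewrite sE big_map mulr_sumr; apply: eq_bigr => y _ /=.
by rewrite rmorphM mulrA.
Qed.

Lemma splits0 : splits (fun R x => 0).
Proof. by exists [::] => R x; rewrite big_nil. Qed.

Lemma splits_ext F G : (forall R x, F R x = G R x) -> splits G -> splits F.
Proof. by move=> e [s sE]; exists s => R x; rewrite e sE. Qed.

Lemma rep_cover_splits n (r : 'I_n -> B) (Q : 'I_n -> alg B) (z : forall l, X (Q l))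
    (F : forall R : alg E, pre_bc phi X R -> R) :
  functorial X -> rep_cover r z -> natural_fun F -> splits F.
Proof.
move=> fX rc Fn; have [Q' [f [rc' gen]]] := rep_cover_bc fX rc.
have fX' : functorial (pre_bc phi X) by exact: functorial_bc.
pose z' l : pre_bc phi X (Q' l) := pmap X (f l) (z l).
(* Each first factor of a pure tensor becomes the value of a global function over [B] after
   multiplication by a power of [r k]. *)
have local k (x : Q' k) : exists N F', [/\ splits F', natural_fun F' &
    F' _ (z' k) = str (Q' k) (phi (r k)) ^+ N * x].
  have [s ->] := gen k x; elim: s => [|y s [N [F' [sF nF Fz]]]].
    exists 0%N, (fun R x => 0); split; first exact: splits0.
      by move=> R S l x'; rewrite rmorph0.
    by rewrite big_nil mulr0.
  have [M [h [hn hz]]] := rep_cover_extend fX rc y.1.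
  exists (M + N)%N, (fun R t => str R (phi (r k) ^+ N * y.2) * (h (res phi R) t : R)
     + str R (phi (r k) ^+ M) * F' R t); split.
  - apply: splitsD; last exact: splitsZ.
    apply: splitsZ; exists [:: (1, exist _ h hn)] => R t.
    by rewrite big_seq1 rmorph1 mul1r.
  - move=> R S l t; rewrite rmorphD !rmorphM !ahomE nF; congr (_ * _ + _).
    exact: (hn _ _ (ahom_res phi l) t).
  - rewrite Fz hn hz big_cons !rmorphM !rmorphXn ahomE /= exprD; ring.
(* The split function [F'] and the multiple of [F] agree where [r k] is invertible, so a further
   power of [r k] kills their difference. *)
have loc k : exists N, splits (fun R x => str R (phi (r k)) ^+ N * F R x).
  have [N [F' [sF nF Fz]]] := local k (F _ (z' k)).
  have [||M hM] := @rep_cover_kill _ _ _ _ _ _ rc' (phi (r k))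
      (fun R x => str R (phi (r k)) ^+ N * F R x - F' R x).
  - by move=> R S l x; rewrite rmorphB rmorphM rmorphXn ahomE Fn nF.
  - move=> R x u; have [g gx] := rc_ex rc' x u; rewrite -gx Fn nF Fz.
    by rewrite rmorphM rmorphXn ahomE subrr.
  exists (M + N)%N; apply: splits_ext (splitsZ (phi (r k) ^+ M) sF) => R x.
  by apply/eqP; rewrite -subr_eq0 exprD -mulrA rmorphXn -mulrBr hM.
have [N hN] := choice loc.
have [c hc] : exists c, \sum_(k < n) c k * phi (r k) ^+ N k = 1.
  by apply: (cover_combination (rc_unit rc')) => i; exists (N i).
have : splits (fun R x => \sum_(k < n) str R (c k) * (str R (phi (r k)) ^+ N k * F R x)).
  have gensum (I : Type) (t : seq I) (H : I -> forall R : alg E, pre_bc phi X R -> R) :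
      (forall i, splits (H i)) -> splits (fun R x => \sum_(i <- t) H i R x).
    move=> hH; elim: t => [|i t IH].
      by apply: splits_ext splits0 => R x; rewrite big_nil.
    by apply: splits_ext (splitsD (hH i) IH) => R x; rewrite big_cons.
  by apply: gensum => k; exact: splitsZ.
apply: splits_ext => R x.
transitivity (str R (\sum_(k < n) c k * phi (r k) ^+ N k) * F R x).
  by rewrite hc rmorph1 mul1r.
rewrite rmorph_sum mulr_suml; apply: eq_bigr => k _.
by rewrite rmorphM rmorphXn mulrA.
Qed.

End Split.

Lemma ex_representing_solution (Q : comPzRingType) n c (e : 'I_c -> pexpr Q n) :
  exists (R : alg Q) (v : 'I_n -> R), [/\ solves e v,
    forall (S : alg Q) (w : 'I_n -> S), solves e w ->
      exists u : ahom R S, forall i, u (v i) = w i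
  & forall (S : alg Q) (u u' : ahom R S), (forall i, u (v i) = u' (v i)) ->
      forall x, u x = u' x].
Proof.
have [e1|nz] := pselect ((1 : Q) = 0).
  exists (base Q), (fun=> 0).
  have z (S : alg Q) (x y : S) : x = y.
    by apply: zero_ring_eq; rewrite -(rmorph1 (str S)) e1 rmorph0.
  by split=> [i|S w _|S u u' _ x]; [exact: z|exists (from_base S) => i; exact: z|exact: z].
have [N eN] := comNz_eq nz; subst Q.
have [R [h [surj ker E sol]]] := ex_universal_solution e.
exists R, (fun i => h (Pvar N i)); split=> // [S w sw|S u u' uu x].
  exact: universal_solution_lift surj ker _ _ sw.
have [y <-] := surj x; have [t <-] := Pev_surj y.
by rewrite -E !peval_hom; exact: eq_peval.
Qed.

(** * Dual numbers and the functor of tangent vectors *)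

Section DualNumbers.
Variable B : comPzRingType.

Definition dual_alg (R : alg B) : alg B :=
  @Alg B (sqz R^o) (sqz_pair (sqz_pair0 R^o (str R))).

Section Map.
Variables (R S : alg B) (f : ahom R S).
Fact dual_map_nmod : nmod_morphism (fun x : dual_alg R => (f x.1, f x.2) : dual_alg S).
Proof. by split=> [|x y]; [congr pair|congr pair]; rewrite /= ?rmorph0 ?rmorphD. Qed.
Fact dual_map_monoid : monoid_morphism (fun x : dual_alg R => (f x.1, f x.2) : dual_alg S).
Proof.
split=> [|x y]; congr pair; rewrite /= ?rmorph1 ?rmorph0 //; first exact: rmorphM.
by rewrite /GRing.scale /= rmorphD !rmorphM.
Qed.
Fact dual_map_str b : mk_rmorphism dual_map_nmod dual_map_monoid (str (dual_alg R) b)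
  = str (dual_alg S) b.
Proof. by congr pair; rewrite /= ?ahomE ?rmorph0. Qed.
Definition dual_map : ahom (dual_alg R) (dual_alg S) := AHom dual_map_str.
End Map.

Definition dual_fst (R : alg B) : ahom (dual_alg R) R :=
  @AHom B (dual_alg R) R (sqz_fst R^o) (fun b => erefl).

Lemma peval_dual (R : alg B) n (v : 'I_n -> dual_alg R) (e : pexpr B n) :
  peval v e = (peval (fun i => (v i).1) e,
    \sum_j (v j).2 * peval (fun i => (v i).1) (pderiv j e)) :> dual_alg R.
Proof.
elim: e => [i|b|e1 IH1 e2 IH2|e1 IH1 e2 IH2] /=.
- rewrite (bigD1 i) //= eqxx rmorph1 mulr1 big1 ?addr0; last first.
    by move=> j /negbTE nij; rewrite eq_sym nij rmorph0 mulr0.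
  by rewrite -surjective_pairing.
- by rewrite big1 // => j _; rewrite rmorph0 mulr0.
- rewrite IH1 IH2; congr pair; rewrite /= -big_split; apply: eq_bigr => j _.
  by rewrite mulrDr.
- rewrite IH1 IH2; congr pair; rewrite /= /GRing.scale /= !mulr_sumr -big_split.
  by apply: eq_bigr => j _ /=; ring.
Qed.

Variables (X : pre B) (z : X (base B)).
Hypothesis fX : functorial X.

Fact tangent_subproof (R S : alg B) (f : ahom R S) (x : X (dual_alg R)) :
  pmap X (dual_fst R) x = pmap X (from_base R) z ->
  pmap X (dual_fst S) (pmap X (dual_map f) x) = pmap X (from_base S) z.
Proof.
move=> hx; rewrite -(pmap_comp fX (f := from_base R) (g := f)) => [|b]; last by rewrite /= ahomE.
rewrite -hx (pmap_comp fX (h := ahom_comp f (dual_fst R))) //.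
exact/esym/pmap_comp.
Qed.

Definition tangent : pre B :=
  @Pre B (fun R => {x : X (dual_alg R) | pmap X (dual_fst R) x = pmap X (from_base R) z})
    (fun R S f x => exist _ _ (tangent_subproof f (proj2_sig x))).

Lemma tangent_eq (R : alg B) (x y : tangent R) : sval x = sval y -> x = y.
Proof. by case: x => x hx; case: y => y hy /= e; apply: eq_exist. Qed.

Lemma functorial_tangent : functorial tangent.
Proof.
split=> [R f x e|R S T f g h x e]; apply: tangent_eq => /=.
  by apply: pmap_id => // r; rewrite /= !e -surjective_pairing.
by apply: pmap_comp => // r; rewrite /= !e.
Qed.

Lemma open_dual (U : sub X) (R : alg B) (x : X (dual_alg R)) :
  is_open U -> U R (pmap X (dual_fst R) x) -> U _ x.
Proof.
move=> oU; have [I hI] := oU _ x => /hI /sqz_unit_ideal h.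
rewrite -(pmap_id fX x (f := ahom_id _)) //; apply/hI.
move: h; rewrite !unit_idealE; apply: span_min; first exact: span_ideal.
by move=> a Ia; apply: span_mem; exists a.
Qed.

Lemma is_localization_epi (R S T : comPzRingType) (b : R) (f : {rmorphism R -> S})
    (g h : {rmorphism S -> T}) :
  is_localization b f -> (forall r, g (f r) = h (f r)) -> forall s, g s = h s.
Proof.
move=> [u ff _] e s; have [a [m sm]] := ff s.
apply: (is_unit_cancel (u := g (f b) ^+ m)).
  by apply: is_unitX; exact: is_unit_map.
by rewrite ![_ ^+ _ * _]mulrC -rmorphXn -rmorphM sm rmorphXn e -rmorphXn -rmorphM sm e.
Qed.

(** Where [z] lies in a chart, its tangent vectors are the solutions of the linear system given by
    the Jacobian at [z], and these are representable. *)
Lemma tangent_rep_cover d : smooth_qc_scheme d X ->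
  exists n (r : 'I_n -> B) (Q : 'I_n -> alg B) (t : forall l, tangent (Q l)), rep_cover r t.
Proof.
move=> X_smooth; have [m [U [cd [oU cU ch]]]] := smooth_charts X_smooth.
have [n [S [l [a [[r [r1 rl]] Uz]]]]] := open_cover z oU cU.
have ex i : exists Qt : {Q : alg B & tangent Q}, [/\ is_unit (str (projT1 Qt) (r i)),
    forall (R : alg B) (x : tangent R), is_unit (str R (r i)) ->
      exists f : ahom (projT1 Qt) R, pmap tangent f (projT2 Qt) = x
  & forall (R : alg B) (f g : ahom (projT1 Qt) R),
      pmap tangent f (projT2 Qt) = pmap tangent g (projT2 Qt) -> forall q, f q = g q].
  set zi := pmap X (l i) z; have {}Uz : U (a i) _ zi := Uz i.
  set e := @cd_e _ _ (cd (a i)); set y := @cd_y _ _ (cd (a i)).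
  have {ch}ch : is_chart (U (a i)) e y := ch (a i).
  have {oU}oU := oU (a i); have {rl}rl := rl i.
  set v0 := y _ zi.
  pose J b j := peval v0 (pderiv j (e b)).
  have [R0 [v [sv vex veq]]] := ex_representing_solution
    (fun b => psum (enum 'I_(cd_n (cd (a i)))) (fun j => PMul (PCst (J b j)) (PVar j))).
  pose Q := res (str (S i)) R0; pose s : ahom (S i) Q := from_alg R0.
  pose w j : dual_alg Q := (str R0 (v0 j), v j).
  have sw : solves e w.
    move=> b; rewrite peval_dual; congr pair.
      transitivity (s (peval v0 (e b))); first by rewrite peval_hom.
      have -> : peval v0 (e b) = 0 by apply: (iffRL (chart_sol ch v0)); exists zi.
      exact: rmorph0.
    have := sv b; rewrite peval_sum => e0; rewrite -[RHS]e0 big_enum.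
    apply: eq_bigr => j _ /=; rewrite mulrC; congr (_ * _).
    by rewrite -[LHS](peval_hom s).
  have [x0 Ux0 yx0] := iffLR (chart_sol ch w) sw.
  have Es (R : alg B) (h : ahom (S i) R) : pmap X (from_base R) z = pmap X h zi.
    by rewrite (pmap_comp fX (h := from_base R)) // => b; rewrite -[l i b]/(l i (str (base B) b)) !ahomE.
  have hx0 : pmap X (dual_fst Q) x0 = pmap X (from_base Q) z.
    rewrite (Es Q s); apply: (chart_inj ch); try exact: open_stable.
    move=> j; rewrite (chart_nat ch) // (chart_nat ch) //.
    by rewrite yx0.
  exists (existT _ Q (exist _ x0 hx0 : tangent Q)); split=> /=.
  - apply: is_unit_map; have [u _ _] := rl.
    by rewrite -[r i]/(str (base B) (r i)) ahomE in u.
  - move=> R [x hx] u.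
    have u' : is_unit (from_base R (r i)) by [].
    have [h hE] := alg_localization_lift rl u'.
    have Ux : U (a i) _ x.
      by apply: open_dual => //; rewrite hx (Es R h); exact: open_stable.
    have y1 j : (y _ x j).1 = h (v0 j).
      rewrite -[LHS]/(dual_fst R _) -(chart_nat ch) // hx (Es R h); exact: (chart_nat ch).
    have sy : solves e (y _ x) by apply/(chart_sol ch); exists x.
    have [|f fE] := vex (@Alg (S i) R h) (fun j => (y _ x j).2).
      move=> b; have := congr1 snd (sy b); rewrite peval_dual /= => e0.
      rewrite peval_sum -[RHS]e0 big_enum; apply: eq_bigr => j _ /=; rewrite mulrC.
      by congr (_ * _); rewrite /J peval_hom; apply: eq_peval => j'; rewrite y1.
    have fb b : f (str Q b) = str R b by rewrite [f _](ahomE f) /= ahomE.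
    exists (@AHom B Q R f fb); apply: tangent_eq => /=.
    apply: (chart_inj ch) => //; first exact: open_stable.
    move=> j; rewrite (chart_nat ch) // yx0 [RHS]surjective_pairing y1; congr pair => //=.
    exact: (ahomE f).
  - move=> R f g /(congr1 sval) /= fg.
    (* A localization is an epimorphism of rings, so two B-linear maps agree on [S i] automatically
       and become comparable over it. *)
    have es : forall b, f (str R0 b) = g (str R0 b).
      apply: (@is_localization_epi _ _ _ _ _ (f \o str R0) (g \o str R0) rl) => b /=.
      rewrite -[str R0 _]/(s _) -[b]/(str (base B) b) (ahomE (l i)) !(ahomE s).
      by rewrite !ahomE.
    pose R' := @Alg (S i) R (f \o str R0).
    apply: (veq R' (@AHom (S i) R0 R' f (fun=> erefl))
                   (@AHom (S i) R0 R' g (fun b => esym (es b)))) => j /=.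
    have := congr1 (fun x => (y (dual_alg R) x j).2) fg.
    by rewrite !(chart_nat ch) // yx0.
pose Qt i := sval (cid (ex i)).
exists n, r, (fun i => projT1 (Qt i)), (fun i => projT2 (Qt i)); split=> //.
- by move=> i; have [] := proj2_sig (cid (ex i)).
- by move=> i; have [] := proj2_sig (cid (ex i)).
- by move=> i; have [] := proj2_sig (cid (ex i)).
Qed.

End DualNumbers.

(** * Differential forms and functions on the tangent functor *)

Definition restr (R S : comPzRingType) (f : {rmorphism R -> S}) (M : lmodType S) : Type := M.

Section RestrictScalars.
Variables (R S : comPzRingType) (f : {rmorphism R -> S}) (M : lmodType S).
HB.instance Definition _ := GRing.Zmodule.on (restr f M).
Let act (r : R) (m : restr f M) : restr f M := f r *: (m : M).
Fact restr_A a b v : act a (act b v) = act (a * b) v.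
Proof. by rewrite /act scalerA rmorphM. Qed.
Fact restr_1 : left_id 1 act. Proof. by move=> v; rewrite /act rmorph1 scale1r. Qed.
Fact restr_D : right_distributive act +%R.
Proof. by move=> a u v; rewrite /act scalerDr. Qed.
Fact restr_Dl v : {morph act^~ v : a b / a + b}.
Proof. by move=> a b; rewrite /act rmorphD scalerDl. Qed.
HB.instance Definition _ :=
  GRing.Zmodule_isLmodule.Build R (restr f M) restr_A restr_1 restr_D restr_Dl.
End RestrictScalars.

Section Principal.
Variable B : comPzRingType.

Definition sqz_alg (R : alg B) (M : lmodType R) : alg B :=
  @Alg B (sqz M) (sqz_pair (sqz_pair0 M (str R))).

(* P is the ring of principal parts, and i r = r (x) 1 + eps (1 (x) r - r (x) 1).  The
   elements of P are lists of tensors a (x) b, identified if all derivations d of R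
   give the sums of the (a, 0) * (b, d b) the same value. *)
Lemma ex_principal_parts (R : alg B) : exists (P : alg B) (i : ahom R (dual_alg P)),
  forall x : P, exists s : seq (R * R), forall (M : lmodType R) (d : R -> M),
    is_derivation d -> exists u : ahom P (sqz_alg M),
      (forall r, u (i r).1 = (r, 0) /\ u (i r).2 = (0, d r)) /\
      (u x).2 = \sum_(y <- s) y.1 *: d y.2.
Proof.
pose tev (M : lmodType R) (d : R -> M) (s : seq (R * R)) : sqz M :=
  \sum_(y <- s) ((y.1, 0) : sqz M) * (y.2, d y.2).
pose e s t := forall (M : lmodType R) (d : R -> M), is_derivation d -> tev M d s = tev M d t.
pose mulP (s t : seq (R * R)) := [seq (x.1 * y.1, x.2 * y.2) | x <- s, y <- t].
pose negP (s : seq (R * R)) := [seq (- x.1, x.2) | x <- s].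
have tev1E (M : lmodType R) (d : R -> M) x y : tev M d [:: (x, y)] = (x * y, x *: d y).
  rewrite /tev big_seq1; congr pair; rewrite /= ?scaler0 ?addr0 //.
have tevD (M : lmodType R) (d : R -> M) s t : tev M d (s ++ t) = tev M d s + tev M d t.
  by rewrite /tev big_cat.
have tevN (M : lmodType R) (d : R -> M) s : tev M d (negP s) = - tev M d s.
  rewrite /tev big_map -sumrN; apply: eq_bigr => x _.
  by rewrite -mulNr; congr (_ * _); congr pair; rewrite /= oppr0.
have tevM (M : lmodType R) (d : R -> M) s t : is_derivation d ->
    tev M d (mulP s t) = tev M d s * tev M d t.
  move=> [_ dM _]; rewrite /tev /mulP big_allpairs_dep mulr_suml; apply: eq_bigr => x _.
  rewrite mulr_sumr; apply: eq_bigr => y _; rewrite mulrACA; congr (_ * _).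
    by congr pair; rewrite /= !scaler0 addr0.
  by congr pair; rewrite /= dM.
have tev0 (M : lmodType R) (d : R -> M) : tev M d [::] = 0 by rewrite /tev big_nil.
have der1 (M : lmodType R) (d : R -> M) : is_derivation d -> d 1 = 0.
  by move=> [_ _ d0]; rewrite -(rmorph1 (str R)) d0.
have tev1 (M : lmodType R) (d : R -> M) : is_derivation d -> tev M d [:: (1, 1)] = 1.
  by move=> hd; rewrite tev1E mulr1 scale1r der1.
have eE s t : (forall (M : lmodType R) (d : R -> M), tev M d s = tev M d t) -> e s t by move=> H M d _.
have [A AE] : exists A : setoid_ring (seq (R * R)),
   [/\ sr_eq A = e, sr0 A = [::], sr1 A = [:: (1, 1)], srD A = cat & srN A = negP /\ srM A = mulP].
  unshelve eexists (@SetoidRing _ e [::] [:: (1, 1)] cat negP mulP _ _ _ _ _ _ _ _ _ _ _ _ _ _) => //.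
  - by move=> x y E M d hd; rewrite E.
  - by move=> y x z E1 E2 M d hd; rewrite E1 // E2.
  - by move=> x x' y y' E1 E2 M d hd; rewrite !tevD E1 // E2.
  - by move=> x x' E M d hd; rewrite !tevN E.
  - by move=> x x' y y' E1 E2 M d hd; rewrite !tevM // E1 // E2.
  - by move=> x y z; apply: eE => *; rewrite !tevD addrA.
  - by move=> x y; apply: eE => *; rewrite !tevD addrC.
  - by move=> x; apply: eE => *; rewrite !tevD tevN tev0 addNr.
  - by move=> x y z M d hd; rewrite !tevM // mulrA.
  - by move=> x y M d hd; rewrite !tevM // mulrC.
  - by move=> x M d hd; rewrite !tevM // tev1 // mul1r.
  - by move=> x y z M d hd; rewrite !(tevM, tevD) // mulrDl.
case: AE => eA A0 A1 AD [AN AM].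
pose P0 : comPzRingType := setoid_quot A; pose cl : seq (R * R) -> P0 := sq_class A.
have clP s t : e s t -> cl s = cl t by rewrite -eA => /sq_classP.
have clD s t : cl s + cl t = cl (s ++ t) by rewrite -sq_classD AD.
have clM s t : cl s * cl t = cl (mulP s t) by rewrite -sq_classM AM.
have clN s : - cl s = cl (negP s) by rewrite -sq_classN AN.
have [||j hj] := @pack_rmorphism R P0 (fun r => cl [:: (r, 1)]).
- split=> [|x y].
    transitivity (cl (sr0 A)); last by [].
    by rewrite A0; apply: clP => M d hd; rewrite tev1E tev0 mul0r scale0r.
  by rewrite clD; apply: clP => M d hd; rewrite tevD !tev1E !mulr1 scalerDl.
- split=> [|x y]; first by transitivity (cl (sr1 A)); last by []; rewrite A1.
  rewrite clM; apply: clP => M d hd; rewrite tevM // !tev1E !mulr1 (der1 _ _ hd).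
  by rewrite !scaler0; congr pair; rewrite /= !scaler0 addr0.
pose delta r := cl ([:: (1, r)] ++ negP [:: (r, 1)]).
have dE (M : lmodType R) (d : R -> M) r : is_derivation d ->
    tev M d ([:: (1, r)] ++ negP [:: (r, 1)]) = (0, d r).
  move=> hd; rewrite tevD tevN !tev1E (der1 _ _ hd) mulr1 mul1r scale1r scaler0.
  by congr pair; rewrite /= ?subrr // subr0.
have jd : sqz_pair_hom (M := P0^o) j delta.
  split=> r s.
    rewrite clD; apply: clP => M d hd; rewrite tevD !dE //; have [dD _ _] := hd.
    by rewrite dD; congr pair; rewrite /= addr0.
  transitivity (j r * delta s + j s * delta r); last by [].
  rewrite !hj !clM clD; apply: clP => M d hd.
  rewrite tevD !tevM // !dE // !tev1E !mulr1 (der1 _ _ hd) !scaler0; have [_ dM _] := hd.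
  by rewrite dM; congr pair; rewrite /= ?mulr0 ?scaler0 !addr0.
pose P : alg B := @Alg B P0 (j \o str R).
have ib b : sqz_pair jd (str R b) = str (dual_alg P) b.
  congr pair; rewrite /= /delta; transitivity (cl (sr0 A)); last by [].
  rewrite A0; apply: clP => M d hd; rewrite dE // tev0; have [_ _ ->] := hd.
  by [].
exists P, (@AHom B R (dual_alg P) (sqz_pair jd) ib) => x.
exists (sq_repr x) => M d hd.
have uE s t : sr_eq A s t -> tev M d s = tev M d t by rewrite eA; exact.
have u1 : tev M d (sr1 A) = 1 by rewrite A1 tev1.
have uD s t : tev M d (srD A s t) = tev M d s + tev M d t by rewrite AD.
have uM s t : tev M d (srM A s t) = tev M d s * tev M d t by rewrite AM tevM.
pose u := sq_lift_rmorphism uE u1 uD uM.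
have ucl s : u (cl s) = tev M d s by exact: sq_liftE.
have uj r : u (j r) = (r, 0) by rewrite hj ucl tev1E mulr1 (der1 _ _ hd) scaler0.
have ub b : u (str P b) = str (sqz_alg M) b by exact: uj.
exists (@AHom B P (sqz_alg M) u ub); split=> [r|]; first by split; rewrite /= ?uj // ucl dE.
rewrite -{1}(sq_reprK x) [u _]ucl /tev; elim: (sq_repr x) => [|y s IH].
  by rewrite !big_nil.
by rewrite !big_cons sqzD2 IH sqzM2 /= scaler0 addr0.
Qed.

End Principal.

(** Tangent vectors need coefficients in a ring. A derivation into a module M therefore gives the
    tangent vector r + eps (d r) over the ring R + M. *)
Lemma ex_derivation_hom (B : comPzRingType) (R : alg B) (M : lmodType R) (d : R -> M) :
  is_derivation d ->
  exists i : ahom R (dual_alg (sqz_alg M)), forall r, i r = ((r, 0), (0, d r)).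
Proof.
move=> [dD dM d0].
pose j := sqz_pair (sqz_pair0 M idfun); pose d' r : (sqz M)^o := (0, d r).
have jd : sqz_pair_hom (M := (sqz M)^o) j d'.
  split=> r s; first by rewrite /d' dD; congr pair; rewrite /= addr0.
  transitivity (j r * d' s + j s * d' r); last by [].
  rewrite /d' dM; congr pair; rewrite /= ?mulr0 ?addr0 //.
  by rewrite !scaler0 !addr0.
have ib b : sqz_pair jd (str R b) = str (dual_alg (sqz_alg M)) b.
  by congr pair; rewrite /= /d' d0.
by exists (@AHom B R (dual_alg (sqz_alg M)) (sqz_pair jd) ib).
Qed.

Section TangentPart.
Variables (B : comPzRingType) (A : gpre B).
Hypotheses (fA : functorial A)
  (addA : forall (R S : alg B) (f : ahom R S) (a b : gpt A R),
    gmap A f (a + b) = gmap A f a + gmap A f b).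

Lemma gmap0 (R S : alg B) (f : ahom R S) : gmap A f 0 = 0.
Proof. by apply: (addrI (gmap A f 0)); rewrite -addA !addr0. Qed.

Lemma gmapB (R S : alg B) (f : ahom R S) a b : gmap A f (a - b) = gmap A f a - gmap A f b.
Proof. by apply: (addIr (gmap A f b)); rewrite -addA !subrK. Qed.

Lemma gmap_comp (R S T : alg B) (f : ahom R S) (g : ahom S T) (h : ahom R T) a :
  (forall r, h r = g (f r)) -> gmap A g (gmap A f a) = gmap A h a.
Proof. exact: (pmap_comp (X := A)). Qed.

Definition dual_inc (P : alg B) : ahom P (dual_alg P) :=
  @AHom B P (dual_alg P) (sqz_pair (sqz_pair0 P^o idfun)) (fun b => erefl).

Definition dual_red (P : alg B) : ahom (dual_alg P) (dual_alg P) :=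
  ahom_comp (dual_inc P) (dual_fst P).

Definition tangent0 : pre B := @tangent B A (0 : gpt A (base B)) fA.

Fact tangent_part_subproof (P : alg B) (a : gpt A (dual_alg P)) :
  gmap A (dual_fst P) (a - gmap A (dual_red P) a) = gmap A (from_base P) 0.
Proof. by rewrite gmapB gmap0 (gmap_comp (h := dual_fst P)) // subrr. Qed.

(** Subtracting the base point, included as a constant, translates a tangent vector to the
    origin. *)
Definition tangent_part (P : alg B) (a : gpt A (dual_alg P)) : tangent0 P :=
  exist _ _ (tangent_part_subproof a).

Lemma tangent_part_nat (P P' : alg B) (u : ahom P P') a :
  pmap tangent0 u (tangent_part a) = tangent_part (gmap A (dual_map u) a).
Proof.
apply: tangent_eq; rewrite /= gmapB; congr (_ - _).
rewrite (gmap_comp (h := ahom_comp (dual_map u) (dual_red P))) //.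
by apply/esym/gmap_comp => r; congr pair; rewrite /= rmorph0.
Qed.

(** The universal derivation of [R] moves a point [a] to a tangent vector over the principal parts,
    where [h] takes a value that is a list of terms r dt. Every other derivation factors through the
    universal one, and [h] is natural. *)
Lemma ex_form_of_functional (h : forall R : alg B, tangent0 R -> R) : natural_fun h ->
  exists w : form A, is_form w /\
    forall (R : alg B) (a : gpt A R) (M : lmodType R) (d : R -> M)
      (i : ahom R (dual_alg (sqz_alg M))),
    is_derivation d -> (forall r, i r = ((r, 0), (0, d r))) ->
    \sum_(x <- w R a) x.1 *: d x.2 = (h _ (tangent_part (gmap A i a)) : sqz M).2.
Proof.
move=> hn.
pose P R := sval (cid (@ex_principal_parts B R)).
pose i R : ahom R (dual_alg (P R)) := sval (cid (proj2_sig (cid (@ex_principal_parts B R)))).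
have iP R := proj2_sig (cid (proj2_sig (cid (@ex_principal_parts B R)))) :
   forall x : P R, _.
pose w : form A := fun R a => sval (cid (iP R (h _ (tangent_part (gmap A (i R) a))))).
have wE (R : alg B) (a : gpt A R) (M : lmodType R) (d : R -> M)
      (j : ahom R (dual_alg (sqz_alg M))) :
    is_derivation d -> (forall r, j r = ((r, 0), (0, d r))) ->
    \sum_(x <- w R a) x.1 *: d x.2 = (h _ (tangent_part (gmap A j a)) : sqz M).2.
  move=> hd hj; have := proj2_sig (cid (iP R (h _ (tangent_part (gmap A (i R) a))))).
  move=> /(_ M d hd) [u [ui <-]]; rewrite -hn tangent_part_nat.
  apply: (congr1 (fun x : sqz_alg M => (x : sqz M).2)); congr (h _ (tangent_part _)); apply: gmap_comp => r.
  by have [u1 u2] := ui r; rewrite hj /= u1 u2.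
exists w; split=> // R S f a M d hd.
have [l lE] := ex_derivation_hom hd.
rewrite (wE _ _ _ _ _ hd lE) big_map /=.
have hd' : is_derivation (M := restr f M) (fun r => d (f r)).
  have [dD dM d0] := hd; split=> [r s|r s|b].
  - by rewrite rmorphD dD.
  - by rewrite rmorphM dM.
  - by rewrite ahomE d0.
have [l' lE'] := ex_derivation_hom hd'.
have := wE _ a _ _ _ hd' lE' => /= e; apply: etrans (esym e).
(* A derivation of [S] with values in M restricts to one of [R] along [f]. This map of square-zero
   extensions relates the two evaluations of [h]. *)
have [||v vE] := @pack_rmorphism (sqz (restr f M)) (sqz M) (fun x => (f x.1, x.2)).
- by split=> [|x y]; congr pair; rewrite /= ?rmorph0 ?rmorphD.
- by split=> [|x y]; congr pair; rewrite /= ?rmorph1 ?rmorphM.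
have vb b : v (str (sqz_alg (restr f M)) b) = str (sqz_alg M) b.
  by rewrite vE /= ahomE.
pose V : ahom (sqz_alg (restr f M)) (sqz_alg M) := @AHom B (sqz_alg (restr f M)) (sqz_alg M) v vb.
transitivity (V (h _ (tangent_part (gmap A l' a))) : sqz M).2; last by rewrite /= vE.
rewrite -hn tangent_part_nat; apply: (congr1 (fun x : sqz_alg M => (x : sqz M).2)).
congr (h _ (tangent_part _)).
rewrite (gmap_comp (h := ahom_comp l f)) //; apply/esym/gmap_comp => r.
by rewrite /= lE lE' /= !vE /= rmorph0.
Qed.

Variables (eta : form A).
Hypothesis eta_form : is_form eta.

(** The contraction of [eta] with a tangent vector: each term x dy of the pullback to the dual
    numbers becomes x at eps = 0 times the eps-coefficient of y. *)
Definition contract (P : alg B) (a : gpt A (dual_alg P)) : P :=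
  \sum_(x <- eta a) (x.1 : sqz P^o).1 * (x.2 : sqz P^o).2.

Lemma contract_nat (P P' : alg B) (u : ahom P P') a :
  contract (gmap A (dual_map u) a) = u (contract a).
Proof.
have hd : is_derivation (R := dual_alg P') (M := restr (dual_fst P') P'^o)
    (fun x : dual_alg P' => (x : sqz P'^o).2) by split.
have := eta_form (dual_map u) a hd; rewrite big_map /= => e.
rewrite /contract; apply: etrans e _; rewrite rmorph_sum; apply: eq_bigr => x _.
by rewrite rmorphM.
Qed.

Lemma contract_derivation (R : alg B) (a : gpt A R) (M : lmodType R) (d : R -> M)
    (i : ahom R (dual_alg (sqz_alg M))) :
  is_derivation d -> (forall r, i r = ((r, 0), (0, d r))) ->
  contract (gmap A i a) = (0, \sum_(x <- eta a) x.1 *: d x.2).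
Proof.
move=> hd hi; set P' := sqz_alg M.
have hd' : is_derivation (R := dual_alg P') (M := restr (dual_fst P') P'^o)
    (fun x : dual_alg P' => (x : sqz P'^o).2) by split.
have := eta_form i a hd'; rewrite big_map /= => e.
rewrite /contract; apply: etrans e _; elim: (eta a) => [|x s IH].
  by rewrite !big_nil.
rewrite !big_cons IH !hi /=; congr pair; rewrite /= ?mulr0 ?addr0 //.
by rewrite scaler0 addr0.
Qed.

(* The function x |-> contract (x + t) on the base change of A to P is constant. *)
Lemma contract_tangent_part (k : fieldType) (p : nat) (kp : p \in [pchar k])
    (fk : {rmorphism k -> B}) d (P : alg B) (a : gpt A (dual_alg P)) :
  smooth_qc_scheme d A -> universally_closed A -> geometrically_connected_fibres A ->
  contract a = contract (sval (tangent_part a)).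
Proof.
move=> A_smooth A_closed A_conn; set t := sval (tangent_part a).
pose X := pre_bc (str P) A.
pose f (S : alg P) (x : X S) : S :=
  contract (gmap A (dual_inc (res (str P) S)) x + gmap A (dual_map (from_alg S)) t)
  - contract (gmap A (dual_map (from_alg S)) t).
have fn : natural_fun f.
  move=> R S l x; rewrite /f rmorphB -!(contract_nat (ahom_res (str P) l)).
  congr (_ - _); apply: congr1.
    rewrite addA /=; congr (_ + _); last first.
      by apply/esym/gmap_comp => r; congr pair; rewrite /= ahomE.
    rewrite (gmap_comp (h := ahom_comp (dual_inc _) (ahom_res (str P) l))) //.
    by apply/esym/gmap_comp => r; congr pair; rewrite /= rmorph0.
  by apply/esym/gmap_comp => r; congr pair; rewrite /= ahomE.
pose b := from_alg (base P).
have := @proper_function_zero k p kp (@Alg k P (str P \o fk)) d X f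
  (0 : gpt A (res (str P) (base P))) (smooth_qc_bc _ A_smooth)
  (@universally_closed_bc _ _ (str P) A A_closed)
  (@geometrically_connected_bc _ _ (str P) A A_conn) fn.
(* [f] vanishes at the origin by construction, hence everywhere. It is evaluated at the base point
   of [a], whose sum with [t] is [a] itself. *)
rewrite /f gmap0 add0r subrr => /(_ erefl (base P) (gmap A b (gmap A (dual_fst P) a))) /eqP.
rewrite subr_eq0 => /eqP; rewrite -/b contract_nat /= => <-.
have -> : gmap A (dual_inc (res (str P) (base P))) (gmap A b (gmap A (dual_fst P) a)) =
    gmap A (dual_map b) (gmap A (dual_red P) a).
  rewrite (gmap_comp (h := ahom_comp b (dual_fst P))) //.
  rewrite (gmap_comp (h := ahom_comp (dual_inc _) (ahom_comp b (dual_fst P)))) //.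
  exact/esym/gmap_comp.
by rewrite -addA /t /= addrC subrK contract_nat.
Qed.

End TangentPart.

Lemma tens_act_sum (L : fieldExtType rat) (B : comPzRingType) (D : hb_data L B)
    (t : tens L B) (w : form (hbA D)) (R : alg B) (a : gpt (hbA D) R) (M : lmodType R) (d : R -> M) :
  \sum_(x <- tens_act t w a) x.1 *: d x.2 =
  \sum_(b <- t) str R b.1 *: \sum_(u <- w R (hb_iota b.2 a)) u.1 *: d u.2.
Proof.
rewrite /tens_act big_flatten big_map; apply: eq_bigr => b _.
by rewrite big_map scaler_sumr; apply: eq_bigr => u _ /=; rewrite scalerA.
Qed.

(** * Generators of the differentials after base change *)

Section GeneratorBaseChange.
Variables (L : fieldExtType rat) (B E : comPzRingType) (phi : {rmorphism B -> E}).

Lemma omega_eq_res (R : alg E) (s t : seq (R * R)) :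
  omega_eq (R := res phi R) s t -> omega_eq s t.
Proof. by move=> st M d [dD dM d0]; apply: (st M d); split=> // b; exact: d0. Qed.

Lemma is_form_bc (A : gpre B) (w : form A) : is_form w -> is_form (form_bc (phi := phi) w).
Proof. by move=> wf R S f a; apply: omega_eq_res; exact: (wf _ _ (ahom_res phi f)). Qed.

Lemma is_generator_bc (k : fieldType) (p : nat) (kp : p \in [pchar k])
    (fk : {rmorphism k -> E}) d (D : hb_data L B) (w : form (hbA D)) :
  abelian_scheme d (hbA D) -> is_generator w ->
  is_generator (D := hb_bc phi D) (form_bc (phi := phi) w).
Proof.
move=> [addA A_smooth [_ A_closed] A_conn] [w_form w_gen]; split; first exact: is_form_bc.
move=> eta eta_form; set A := hbA D in eta eta_form *; pose AE := gpre_bc phi A.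
have [fA _ _] := A_smooth; have fAE : functorial AE := @functorial_bc _ _ phi A fA.
have addAE (R S : alg E) (f : ahom R S) (a b : gpt AE R) :
    gmap AE f (a + b) = gmap AE f a + gmap AE f b by exact: addA.
pose T := @tangent0 B A fA.
(* Dual numbers and restriction of scalars commute, but the two structure maps agree only pointwise;
   [sw] and [sw'] are the identity in the two directions. *)
pose sw (P : alg E) : ahom (dual_alg (res phi P)) (res phi (dual_alg P)) :=
  @AHom B (dual_alg (res phi P)) (res phi (dual_alg P)) idfun (fun b => erefl).
pose sw' (P : alg E) : ahom (res phi (dual_alg P)) (dual_alg (res phi P)) :=
  @AHom B (res phi (dual_alg P)) (dual_alg (res phi P)) idfun (fun b => erefl).
pose F (P : alg E) (t : pre_bc phi T P) : P :=
  contract (A := AE) eta (P := P) (gmap A (sw P) (sval t)).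
have Fn : natural_fun F.
  move=> R S l x; rewrite /F -(contract_nat eta_form); apply: congr1 => /=.
  rewrite (gmap_comp fA (h := ahom_comp (sw S) (dual_map (ahom_res phi l)))) //.
  exact/esym/(gmap_comp fA).
have [n [r [Q [z rc]]]] := @tangent_rep_cover B A (0 : gpt A (base B)) fA d A_smooth.
have [s sE] := rep_cover_splits (functorial_tangent _ fA) rc Fn.
have exU (h : nat_fun_of T) : exists u : tens L B,
    forall (R : alg B) (a : gpt A R) (M : lmodType R) (d : R -> M)
      (i : ahom R (dual_alg (sqz_alg M))),
    is_derivation d -> (forall r, i r = ((r, 0), (0, d r))) ->
    \sum_(x <- tens_act u w a) x.1 *: d x.2 =
      (sval h _ (tangent_part fA addA (gmap A i a)) : sqz M).2.
  have [v [v_form vE]] := ex_form_of_functional addA (proj2_sig h).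
  have [u uE] := w_gen v v_form; exists u => R a M d' i hd hi.
  by rewrite -(vE _ _ _ _ _ hd hi); apply/esym/uE.
have [U UE] := choice exU.
(* [F] splits as a sum of [y.1] times functions over [B], each of which is the function of a form
   [U y.2] times [w]; the two coefficients in [E] multiply. *)
exists (flatten [seq [seq (y.1 * phi b.1, b.2) | b <- U y.2] | y <- s]) => R a M d' hd.
rewrite tens_act_sum big_flatten big_map /=.
have hd' : is_derivation (R := res phi R) (M := M) d'.
  by have [dD dM d0] := hd; split=> // b; exact: d0.
have [i iE] := ex_derivation_hom hd; have [j jE] := ex_derivation_hom hd'.
set P := sqz_alg M in i iE.
have e1 := contract_derivation eta_form a hd iE.
have e2 := contract_tangent_part fAE addAE eta_form kp fk (gmap AE i a)
  (smooth_qc_bc phi A_smooth) (@universally_closed_bc _ _ phi A A_closed)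
  (@geometrically_connected_bc _ _ phi A A_conn).
pose i' : ahom (res phi R) (dual_alg (res phi P)) := ahom_comp (sw' P) (ahom_res phi i).
pose t : pre_bc phi T P := tangent_part fA addA (gmap A i' a).
have e3 : contract eta (sval (tangent_part fAE addAE (gmap AE i a))) = F P t.
  rewrite /F; apply: congr1 => /=; rewrite (gmapB addA); congr (_ - _).
    by rewrite (gmap_comp fA (h := ahom_res phi i)).
  pose h : ahom (res phi R) (res phi (dual_alg P)) := ahom_res phi (ahom_comp (dual_red P) i).
  transitivity (gmap A h a); first exact: (gmap_comp fA).
  rewrite (gmap_comp fA (f := i') (h := ahom_comp (dual_red (res phi P)) i')) //.
  exact/esym/(gmap_comp fA).
have hE (h : nat_fun_of T) : (sval h _ t : sqz M).2 = \sum_(x <- tens_act (U h) w a) x.1 *: d' x.2.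
  rewrite (UE h _ a _ _ _ hd' jE).
  have sw2b b : idfun (str (@sqz_alg _ (res phi R) M) b) = str (res phi P) b.
    by [].
  pose sw2 : ahom (@sqz_alg _ (res phi R) M) (res phi P) :=
    @AHom B (@sqz_alg _ (res phi R) M) (res phi P) idfun sw2b.
  rewrite -[RHS]/(sw2 (sval h _ (tangent_part fA addA (gmap A j a))) : sqz M).2.
  rewrite -(proj2_sig h) tangent_part_nat.
  apply: (congr1 (fun x : sqz_alg M => (x : sqz M).2)); apply: (congr1 (sval h (res phi P))).
  apply: (congr1 (@tangent_part B A fA addA (res phi P))).
  by rewrite (gmap_comp fA (h := i')) // => x; rewrite /= jE iE.
have e4 : (0, \sum_(x <- eta R a) x.1 *: d' x.2) = F P t.
  by rewrite -e3 -e2 -e1.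
have := congr1 (fun x : sqz M => x.2) e4; rewrite sE /= => ->.
rewrite (_ : (\sum_(y <- s) _).2 = \sum_(y <- s) str R y.1 *: (sval y.2 _ t : sqz M).2); last first.
  elim: s {sE} => [|y s IH]; rewrite ?big_nil // !big_cons sqzD2 IH; congr (_ + _).
  by rewrite sqzM2 /= scaler0 addr0.
apply: eq_bigr => y _; rewrite hE tens_act_sum scaler_sumr big_map.
by apply: eq_bigr => b _ /=; rewrite scalerA rmorphM.
Qed.

End GeneratorBaseChange.

(** * Base change of Hilbert-Blumenthal data *)

Section Along.
Variables (L : fieldExtType rat) (B E : comPzRingType).

(* Both sides of the identities between iterated base changes below are instances of
   hb_along up to conversion, and only the family h distinguishes them. *)
Section Family.
Variables (h : forall R : alg E, {rmorphism B -> R})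
  (hN : forall (R S : alg E) (f : ahom R S) b, f (h R b) = h S b).

Definition alg_along (R : alg E) : alg B := @Alg B R (h R).
Definition ahom_along (R S : alg E) (f : ahom R S) : ahom (alg_along R) (alg_along S) :=
  @AHom B (alg_along R) (alg_along S) f (hN f).
Definition gpre_along (A : gpre B) : gpre E :=
  @GPre E (fun R => gpt A (alg_along R)) (fun R S f x => gmap A (ahom_along f) x).
Definition lb_along (X : pre B) (P : lbundle X) : lbundle (pre_along hN X) :=
  @LBundle E (pre_along hN X) (pre_along hN (fr P))
    (fun R p => @prj B X P (alg_along R) p)
    (fun R u p => @scl B X P (alg_along R) u p).
Definition hb_along (D : hb_data L B) : hb_data L E :=
  @HBData L E (gpre_along (hbA D))
    (fun x R => @hb_iota L B D x (alg_along R))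
    (fun i => lb_along (hb_lam D i))
    (fun R => @hb_eps L B D (alg_along R)).
Definition form_along (A : gpre B) (w : form A) : form (gpre_along A) :=
  fun R a => w (alg_along R) a.
End Family.

(** The types of the two forms depend on the data, so an equality of forms would need a transport;
    an arbitrary function [g] of data and form avoids it. *)
Lemma hb_along_eq (T : Type) (g : forall D : hb_data L E, form (hbA D) -> T)
    (D : hb_data L B) (w : form (hbA D))
    (h h' : forall R : alg E, {rmorphism B -> R}) hN h'N : (forall R b, h R b = h' R b) ->
  g (@hb_along h hN D) (@form_along h hN _ w) = g (@hb_along h' h'N D) (@form_along h' h'N _ w).
Proof.
move=> e; have {}e : h = h'.
  by apply: functional_extensionality_dep => R; exact: rmorphism_ext.
by subst h'; rewrite (Prop_irrelevance hN h'N).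
Qed.

End Along.

Lemma hb_bc_square (L : fieldExtType rat) (B B1 B2 B' : comPzRingType) (T : Type)
    (g : forall D : hb_data L B', form (hbA D) -> T)
    (phi1 : {rmorphism B -> B1}) (psi1 : {rmorphism B1 -> B'})
    (phi2 : {rmorphism B -> B2}) (psi2 : {rmorphism B2 -> B'})
    (D : hb_data L B) (w : form (hbA D)) :
  (forall b, psi1 (phi1 b) = psi2 (phi2 b)) ->
  g (hb_bc psi1 (hb_bc phi1 D)) (form_bc (form_bc w)) =
  g (hb_bc psi2 (hb_bc phi2 D)) (form_bc (form_bc w)).
Proof.
move=> e; apply: (hb_along_eq g w
  (h := fun R => (str R \o psi1) \o phi1) (h' := fun R => (str R \o psi2) \o phi2)
  (fun R S f b => ahomE f (psi1 (phi1 b)))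
  (fun R S f b => ahomE f (psi2 (phi2 b)))) => R b /=.
by rewrite e.
Qed.

Lemma hb_bc_comp (L : fieldExtType rat) (B E E' : comPzRingType)
    (phi : {rmorphism B -> E}) (psi : {rmorphism E -> E'}) (D : hb_data L B) :
  hb_bc psi (hb_bc phi D) = hb_bc (psi \o phi) D.
Proof.
by apply: (hb_along_eq (D := D) (fun D _ => D) (fun _ _ => [::])
  (h := fun R => (str R \o psi) \o phi) (h' := fun R => str R \o (psi \o phi))
  (fun R S f b => ahomE f (psi (phi b)))
  (fun R S f b => ahomE f (psi (phi b)))).
Qed.

Section LineBundleBaseChange.
Variables (B E : comPzRingType) (phi : {rmorphism B -> E}).

Lemma lb_trivial_bc (Y X : pre B) (h : forall R : alg B, Y R -> X R) (P : lbundle X) :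
  lb_trivial h P ->
  @lb_trivial E (pre_bc phi Y) (pre_bc phi X) (fun R => h (res phi R)) (lb_bc phi P).
Proof.
move=> [s [s_prj s_nat]]; exists (fun R => s (res phi R)); split=> [R y|R S f y] /=.
  exact: s_prj.
exact: (s_nat _ _ (ahom_res phi f)).
Qed.

Lemma lb_iso_bc (Y X0 X1 : pre B) (h0 : forall R : alg B, Y R -> X0 R) (P0 : lbundle X0)
    (h1 : forall R : alg B, Y R -> X1 R) (P1 : lbundle X1) :
  lb_iso h0 P0 h1 P1 ->
  @lb_iso E (pre_bc phi Y) (pre_bc phi X0) (pre_bc phi X1)
    (fun R => h0 (res phi R)) (lb_bc phi P0) (fun R => h1 (res phi R)) (lb_bc phi P1).
Proof.
move=> [t [t_prj t_scl t_nat]]; exists (fun R => t (res phi R)).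
split=> [R y q e|R y q e u e' uu|R S f y q e e'] /=.
- exact: t_prj.
- exact: t_scl.
- exact: (t_nat _ _ (ahom_res phi f)).
Qed.

Lemma lb_tensor_bc (Y X0 X1 X2 : pre B) (h0 : forall R : alg B, Y R -> X0 R)
    (P0 : lbundle X0) (h1 : forall R : alg B, Y R -> X1 R) (P1 : lbundle X1)
    (h2 : forall R : alg B, Y R -> X2 R) (P2 : lbundle X2) :
  lb_tensor h0 P0 h1 P1 h2 P2 ->
  @lb_tensor E (pre_bc phi Y) (pre_bc phi X0) (pre_bc phi X1) (pre_bc phi X2)
    (fun R => h0 (res phi R)) (lb_bc phi P0) (fun R => h1 (res phi R)) (lb_bc phi P1)
    (fun R => h2 (res phi R)) (lb_bc phi P2).
Proof.
move=> [t [t_prj t_scl t_nat]]; exists (fun R => t (res phi R)).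
split=> [R y p1 p2 e1 e2|R y p1 p2 e1 e2 u1 u2 e1' e2' v1 v2|R S f y p1 p2 e1 e2 e1' e2'] /=.
- exact: t_prj.
- exact: t_scl.
- exact: (t_nat _ _ (ahom_res phi f)).
Qed.

Lemma is_lbundle_bc (X : pre B) (P : lbundle X) :
  functorial X -> is_lbundle P -> is_lbundle (lb_bc phi P).
Proof.
move=> fX hP; split=> /=.
- by apply: functorial_bc; exact: (fr_functorial hP).
- by apply: sheaf_bc; [exact: (fr_functorial hP)|exact: (fr_sheaf hP)].
- by move=> R S f q; exact: (prj_nat hP (ahom_res phi f)).
- by move=> R S f u q uu; exact: (scl_nat hP (ahom_res phi f)).
- by move=> R q; exact: (scl_one hP).
- by move=> R u v q uu uv; exact: (scl_mul hP).
- by move=> R u q uu; exact: (scl_prj hP).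
- by move=> R q q' e; exact: (@scl_simply_transitive B X P hP (res phi R) q q' e).
- move=> R x; have [n [S [l [[r [r1 rl]] ex]]]] := fr_local hP x.
  (* Local triviality provides a cover by B-algebras; they receive the structure of E-algebras
     through [R]. *)
  pose S' i : alg E := @Alg E (S i) (l i \o str R).
  exists n, S', (fun i => @AHom E R (S' i) (l i) (fun b => erefl)); split; first by exists r.
  move=> i; have [q hq] := ex i.
  pose v : ahom (S i) (res phi (S' i)) := @AHom B (S i) (res phi (S' i)) idfun (fun b =>
    esym (ahomE (l i) b)).
  exists (pmap (fr P) v q); rewrite /= (prj_nat hP) hq.
  exact: (pmap_comp fX).
Qed.

End LineBundleBaseChange.

Section HBBaseChange.
Variables (L : fieldExtType rat) (B E : comPzRingType) (phi : {rmorphism B -> E}).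

Lemma abelian_scheme_bc d (A : gpre B) : abelian_scheme d A -> abelian_scheme d (gpre_bc phi A).
Proof.
move=> [addA A_smooth [A_sep A_closed] A_conn]; split.
- by move=> R S f a b; exact: addA.
- exact: (smooth_qc_bc phi A_smooth).
- split; last exact: (@universally_closed_bc _ _ phi A A_closed).
  move=> R x x'; have [I hI] := A_sep (res phi R) x x'; exists I => S f.
  exact: (hI _ (ahom_res phi f)).
- exact: (@geometrically_connected_bc _ _ phi A A_conn).
Qed.

Lemma symmetric_hom_bc (D : hb_data L B) i : functorial (hbA D) ->
  symmetric_hom (D := D) (hb_lam D i) ->
  symmetric_hom (D := hb_bc phi D) (hb_lam (hb_bc phi D) i).
Proof.
move=> fA [[P_lb P_triv P_pic P_add] P_sym P_iota]; split; [split| |].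
- apply: (@is_lbundle_bc _ _ phi (sq (hbA D)) (hb_lam D i)) => //.
  split=> [R f [x y] e|R S T f g h [x y] e] /=.
    by congr pair; exact: (pmap_id fA).
  by congr pair; exact: (pmap_comp fA).
- exact: (lb_trivial_bc phi P_triv).
- move=> K psi.
  (* Stated for all data at once, so that [hb_bc_comp] can replace an iterated base change under
     dependent types. *)
  pose stm (D' : hb_data L K) := forall b : gpt (hbA D') (base K),
    @pic0_along K (hbA D') (sq (hbA D'))
      (fun R a => (a, gmap (hbA D') (from_base R) b)) (hb_lam D' i).
  have : stm (hb_bc (psi \o phi) D) by exact: P_pic.
  by rewrite -hb_bc_comp.
- exact: (lb_tensor_bc phi P_add).
- exact: (lb_iso_bc phi P_sym).
- by move=> x; exact: (lb_iso_bc phi (P_iota x)).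
Qed.

Lemma lam_linear_bc (I : L -> Prop) (D : hb_data L B) : functorial (hbA D) ->
  lam_linear I D -> lam_linear I (hb_bc phi D).
Proof.
move=> fA [lam_sym lam_add lam_scal]; split.
- by move=> i Ii; exact: symmetric_hom_bc (lam_sym i Ii).
- by move=> i j Ii Ij; exact: (lb_tensor_bc phi (lam_add i j Ii Ij)).
- by move=> x i Ii; exact: (lb_iso_bc phi (lam_scal x i Ii)).
Qed.

End HBBaseChange.

(** * Hilbert-Blumenthal structures after base change *)

Section HB.
Variables (L : fieldExtType rat) (I : L -> Prop).
Hypothesis I_ideal : fractional_ideal I.

(* If x acts as 0 then lam (x i) is the pullback of lam i along A x 0, which is
   trivial by symmetry. *)
Lemma iota_faithful (B : comPzRingType) (D : hb_data L B) (x : ringOfIntegers L) :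
  (forall (R S : alg B) (f : ahom R S) (a b : gpt (hbA D) R),
    gmap (hbA D) f (a + b) = gmap (hbA D) f a + gmap (hbA D) f b) ->
  lam_linear I D ->
  (forall i, I i -> @lb_trivial B (sq (hbA D)) (sq (hbA D)) pid (hb_lam D i) -> i = 0) ->
  (forall (R : alg B) a, @hb_iota L B D x R a = 0) -> x = 0.
Proof.
set A := hbA D => addA [lam_sym _ lam_scal] lam_inj x0.
have g0 (R S : alg B) (f : ahom R S) : gmap A f 0 = 0.
  by apply: (addrI (gmap A f 0)); rewrite -addA !addr0.
have [_ IM [i Ii i0] _] := I_ideal.
have [[P_lb [s [s_prj s_nat]] _ _] [t [t_prj t_scl t_nat]] _] := lam_sym i Ii.
have [t' [t'_prj t'_scl t'_nat]] := lam_scal x i Ii.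
set P := hb_lam D i in s s_prj s_nat t t_prj t_scl t_nat t' t'_prj t'_scl t'_nat.
have t_eq (R : alg B) y y' q q' e e' : y = y' -> q = q' -> t R y q e = t R y' q' e'.
  by move=> yy qq; subst y' q'; rewrite (Prop_irrelevance e e').
have t'_eq (R : alg B) y y' q q' e e' : y = y' -> q = q' -> t' R y q e = t' R y' q' e'.
  by move=> yy qq; subst y' q'; rewrite (Prop_irrelevance e e').
(* Triviality along the zero section provides frames over the points (0, a), and symmetry moves them
   to the points (a, 0). *)
pose s' (R : alg B) (a : gpt A R) : fr P R := t R (0, a) (s R a) (s_prj R a).
have s'_prj (R : alg B) (y : sq A R) : prj P (s' R y.1) = (y.1, @hb_iota L B D x R y.2).
  by rewrite t_prj x0.
have : val x * i = 0.
  apply: lam_inj; first exact: IM.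
  exists (fun R y => t' R y (s' R y.1) (s'_prj R y)); split=> [R y|R S f y].
    exact: t'_prj.
  have e : prj P (pmap (fr P) f (s' R y.1)) =
      ((pmap (sq A) f y).1, @hb_iota L B D x S (pmap (sq A) f y).2).
    by rewrite x0 (prj_nat P_lb) s'_prj x0 /= g0.
  rewrite -(t'_nat _ _ _ _ _ _ e); apply: t'_eq => //.
  have e2 : prj P (pmap (fr P) f (s R y.1)) = pid S (pmap (sq A) f (0, y.1)).
    by rewrite (prj_nat P_lb) s_prj.
  rewrite /s' -(t_nat _ _ _ _ _ _ e2); apply: t_eq; first by rewrite /= g0.
  by rewrite -s_nat.
by move/eqP; rewrite mulf_eq0 (negbTE i0) orbF => /eqP x00; apply: val_inj.
Qed.

Section BaseChange.
Variables (B E : comPzRingType) (phi : {rmorphism B -> E}).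
Hypothesis E0 : (1 : E) = 0 -> (1 : B) = 0.

(** Faithfulness does not pass to a base change by itself. Over a nonzero [E] it follows from the
    injectivity of [lam] there. If [E] is zero, so is [B]; every B-algebra is then a restricted
    E-algebra up to isomorphism, and the assumption over [B] applies. *)
Lemma is_real_multiplication_bc d (D : hb_data L B) :
  abelian_scheme d (hbA D) -> is_real_multiplication D -> lam_linear I D ->
  lam_iso I (hb_bc phi D) -> is_real_multiplication (hb_bc phi D).
Proof.
move=> A_ab [i_nat i_add i_addl [i_one i_mul] i_faith] D_lin [lam_inj _ _].
have [addA [fA _ _] _ _] := A_ab.
split=> [x R S f a|x R a b|x y R a||x x0] /=.
- exact: (i_nat x _ _ (ahom_res phi f)).
- exact: i_add.
- exact: i_addl.
- by split=> *; [exact: i_one|exact: i_mul].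
have [e1|nz] := pselect ((1 : E) = 0); last first.
  apply: (iota_faithful (D := hb_bc phi D)) x0; first by move=> R S f a b; exact: addA.
    exact: lam_linear_bc.
  exact: lam_inj.
apply: i_faith => R a.
have R0 : (1 : R) = 0 by rewrite -(rmorph1 (str R)) (E0 e1) rmorph0.
have [||h _] := @pack_rmorphism E R (fun=> 0).
- by split=> // u v; rewrite addr0.
- by split=> [|u v]; exact: zero_ring_eq.
pose R' : alg E := @Alg E R h.
pose v : ahom R (res phi R') :=
  @AHom B R (res phi R') idfun (fun b => zero_ring_eq _ _ R0).
pose v' : ahom (res phi R') R :=
  @AHom B (res phi R') R idfun (fun b => zero_ring_eq _ _ R0).
have vK (c : gpt (hbA D) R) : gmap (hbA D) v' (gmap (hbA D) v c) = c.
  rewrite [LHS](pmap_comp fA (h := ahom_id R)) //; exact: (pmap_id fA).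
have g0 : gmap (hbA D) v' 0 = 0 by apply: (addrI (gmap (hbA D) v' 0)); rewrite -addA !addr0.
by rewrite -[LHS]vK -i_nat [hb_iota _ _](x0 R').
Qed.

Lemma is_hb_bc N (D : hb_data L B) : is_hb N I D -> is_hb N I (hb_bc phi D).
Proof.
move=> [D_ab D_rm D_lin D_iso [e1 e2 e3 e4 e5]]; have [_ [fA _ _] _ _] := D_ab; split.
- exact: abelian_scheme_bc.
- have [h _] := D_iso E phi; exact: (is_real_multiplication_bc D_ab D_rm D_lin h).
- exact: lam_linear_bc.
- by move=> B' psi; rewrite hb_bc_comp; exact: D_iso.
- split=> [R S f z d|R|R|R|R s] /=.
  + exact: (e1 _ _ (ahom_res phi f)).
  + exact: (e2 (res phi R)).
  + exact: (e3 (res phi R)).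
  + exact: (e4 (res phi R)).
  + exact: (e5 (res phi R)).
Qed.

End BaseChange.
End HB.

(** * Compatibility of units, forms and isomorphisms with base change *)

Section TensorMap.
Variables (L : fieldExtType rat) (R S : comPzRingType) (f : {rmorphism R -> S}).

Lemma tens_eq_map (s t : tens L R) : tens_eq s t -> tens_eq (tens_map f s) (tens_map f t).
Proof.
move=> st G beta bD1 bD2 _.
have := st G (fun r x => beta (f r) x) => /=.
rewrite !big_cat !big_map /= => e; rewrite -[RHS]e.
- by congr (_ + _); apply: eq_bigr => y _; rewrite rmorphN.
- by move=> u u' v _ _ _; rewrite rmorphD bD1.
- by move=> u v v' _ _ _; rewrite bD2.
- by case.
Qed.

Lemma tens_inverse_map (s t : tens L R) :
  tens_inverse s t -> tens_inverse (tens_map f s) (tens_map f t).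
Proof.
move=> /tens_eq_map; rewrite /tens_inverse.
have -> : tens_map f (tens_mul s t) = tens_mul (tens_map f s) (tens_map f t).
  rewrite /tens_map /tens_mul map_allpairs allpairs_mapl allpairs_mapr.
  by apply: eq_allpairs => x y /=; rewrite rmorphM.
by rewrite /tens_map /tens_one /= rmorph1.
Qed.

Lemma form_bc_tens_act (D : hb_data L R) (t : tens L R) (w : form (hbA D)) :
  form_bc (tens_act t w) = tens_act (D := hb_bc f D) (tens_map f t) (form_bc w).
Proof.
apply: functional_extensionality_dep => T; apply: functional_extensionality_dep => a.
by rewrite /form_bc /tens_act /tens_map -map_comp.
Qed.

End TensorMap.

Lemma hb_iso_bc (L : fieldExtType rat) (I : L -> Prop) (N : nat) (B E : comPzRingType)
    (phi : {rmorphism B -> E}) (D D' : hb_data L B) w w'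
    (h : forall R : alg B, gpt (hbA D) R -> gpt (hbA D') R) :
  hb_iso I N w w' h ->
  hb_iso (D := hb_bc phi D) (D' := hb_bc phi D') I N (form_bc w) (form_bc w')
    (fun R => h (res phi R)).
Proof.
move=> [[h1 h2] [h3 h4] h5 h6 h7]; split=> /=.
- by split=> [R S f a|R]; [exact: (h1 _ _ (ahom_res phi f))|exact: h2].
- by split=> [R a b|x R a]; [exact: h3|exact: h4].
- by move=> i Ii; exact: (lb_iso_bc phi (h5 i Ii)).
- by move=> R z d hz hd; exact: (h6 (res phi R)).
- by move=> R a; apply: omega_eq_res; exact: (h7 (res phi R)).
Qed.

Theorem mainTheorem6
  (L : fieldExtType rat) (L_real : totally_real L)
  (I : L -> Prop) (I_ideal : fractional_ideal I)
  (p : nat)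
  (Fpbar : closedFieldType) (iF : {rmorphism 'F_p -> Fpbar})
  (Fpbar_algebraic : forall x : Fpbar, algebraicOver iF x)
  (k : fieldType) (kp : p \in [pchar k])
  (ik : {rmorphism k -> Fpbar})
  (k_perfect : forall x : k, exists y : k, y ^+ p = x)
  (k_residue : contains_residue_fields L p k)
  (N : nat) (N_ge4 : (4 <= N)%N) (N_prime_to_p : coprime N p)
  (psi : char_data L k) (psi_char : is_char psi)
  (g : rule L k) :
  modular_form N I psi g -> modular_form N I (char_frob kp psi) (V_op kp g).
Proof.
move=> [g1 g2 g3].
(* The source and the target of Frobenius are the same ring, so the proviso on the zero ring is
   trivial. *)
have E0 (B : alg k) : (1 : B) = 0 -> (1 : B) = 0 by [].
have test (B : alg k) (D : hb_data L B) w : test_object N I w ->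
    test_object N I (D := hb_bc (frob kp B) D) (form_bc w).
  move=> [D_hb w_gen]; split; first exact: (is_hb_bc I_ideal (frob kp B) (@E0 B) D_hb).
  by have [D_ab _ _ _ _] := D_hb; exact: (is_generator_bc (frob kp B) kp (str B) D_ab w_gen).
split=> [B D D' w w' h tw tw' iso|B B' f D w tw|B D w s t tw st]; rewrite /V_op.
- by apply: g1 (hb_iso_bc _ iso); exact: test.
(* Frobenius commutes with [f], so twisting after base change agrees with base change of the
   twist. *)
- rewrite -(g2 _ _ f _ _ (test _ _ _ tw)).
  apply: (hb_bc_square (fun D w => g B' D w)) => b.
  exact/esym/rmorphXn.
(* The twist of [t w] is the Frobenius image of [t] acting on the twist of [w], and [char_frob]
   evaluates [psi] at the Frobenius image of the inverse [s]. *)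
- rewrite form_bc_tens_act; apply: g3; first exact: test.
  exact: tens_inverse_map.
Qed.
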